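(* (i) For $g=4$, $m=2$, the focal submanifold $M_+$ of OT-FKM type with the complex structure $J$ given (in the notation of the context) by $JP_0P_1x=P_0P_1P_2x$, $JP_0P_1P_2x=-P_0P_1x$, and $JX=P_0P_1X$ for $X\in E$, cannot admit any balanced metric. (ii) For $g=4$, $m=4$ in the definite case, the focal submanifold $M_+$ of OT-FKM type with the complex structure $J$ given by $JP_0P_1x=P_3P_4x$, $JP_3P_4x=-P_0P_1x$, $JP_2P_3x=P_2P_4x$, $JP_2P_4x=-P_2P_3x$, and $JX=P_0P_1X$ for $X\in V$, cannot admit any balanced metric.
   Context: Let $\{P_0,\dots,P_m\}$ be a symmetric Clifford system on $\mathbb{R}^{2l}$: symmetric real matrices with $P_iP_j+P_jP_i=2\delta_{ij}I_{2l}$, with $l-m-1>0$. The focal submanifold $M_+$ of OT-FKM type is $$M_+=\{x\in S^{2l-1}(1):\langle P_0x,x\rangle=\cdots=\langle P_mx,x\rangle=0\}.$$ For $m=2$ (then $l=2k$), $P_0P_1x$ and $P_0P_1P_2x$ are orthonormal tangent vectors of $M_+$ at $x$, and $E$ is the orthogonal complement of $\mathrm{Span}\{P_0P_1x,P_0P_1P_2x\}$ in $T_xM_+$. For $m=4$ (then $l=4k$), the definite case is $P_0P_1P_2P_3P_4=\pm I_{2l}$; then $P_0P_1x,P_2P_3x,P_2P_4x,P_3P_4x$ are orthonormal tangent vectors of $M_+$ at $x$, and $V$ is the orthogonal complement of their span in $T_xM_+$. In both cases $J$ is a globally defined integrable almost complex structure on $M_+$. A balanced metric on a complex manifold of complex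 dimension $n$ is a Hermitian metric (compatible with $J$) whose Kähler form $\omega$ satisfies $d(\omega^{n-1})=0$. *)

(* Defs.v *)
From HB Require Import structures.
From mathcomp Require Import all_boot all_order all_algebra all_fingroup.
From mathcomp Require Import all_classical all_reals all_analysis.

Set Implicit Arguments.
Unset Strict Implicit.
Unset Printing Implicit Defensive.

Import Order.TTheory GRing.Theory Num.Theory.
Import numFieldNormedType.Exports.
Local Open Scope classical_set_scope.
Local Open Scope ring_scope.

(* f is C^k on the open set U.  For finite-dimensional V (the only use below)
   continuity of all iterated directional derivatives is the usual notion. *)
Fixpoint Ck (R : realType) (V W : normedModType R) (k : nat)
    (U : set V) (f : V -> W) : Prop :=
  if k is k'.+1 then
    (forall x, U x -> differentiable f x) /\
    (forall v : V, Ck k' U (fun x => 'D_v f x))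
  else forall x, U x -> {for x, continuous f}.

Definition smooth_on (R : realType) (V W : normedModType R)
    (U : set V) (f : V -> W) : Prop := forall k, Ck k U f.

(* Velocities at x of the smooth curves drawn on M. *)
Definition tangent (R : realType) (V : normedModType R) (M : set V) (x : V)
    : set V :=
  [set v | exists (c : R^o -> V) (U : set R^o),
     [/\ open_nbhs 0 U, smooth_on U c, (forall t, U t -> M (c t)),
         c 0 = x & 'D_1 c 0 = v]].

Section MultilinearForms.
Variables (R : realType) (V : normedModType R).

(* A k-form at a point is only meaningful on k-tuples of tangent vectors; its
   values elsewhere are junk. *)
Definition kform (k : nat) : Type := ('I_k -> V) -> R.

Definition multilinear k (a : kform k) : Prop :=
  forall (i : 'I_k) (w : 'I_k -> V) (c : R) (u v : V),
    a [eta w with i |-> c *: u + v] =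
    c * a [eta w with i |-> u] + a [eta w with i |-> v].

Definition alternating k (a : kform k) : Prop :=
  forall (w : 'I_k -> V) (i j : 'I_k), i != j -> w i = w j -> a w = 0.

Definition wedge k l (a : kform k) (b : kform l) : kform (k + l) := fun w =>
  ((k`! * l`!)%N%:R)^-1 *
  \sum_(s : 'S_(k + l)) (-1) ^+ s *
     (a (fun i => w (s (lshift l i))) * b (fun j => w (s (rshift k j)))).

(* The exterior power a ^ ... ^ a (p factors) of a 2-form; the type uses that
   p.+1.*2 and 2 + p.*2 are convertible. *)
Fixpoint wedge_pow (a : kform 2) (p : nat) : kform p.*2 :=
  if p is p'.+1 then wedge a (@wedge_pow a p') else fun=> 1.

Definition smooth_kform k (U : set V) (A : V -> kform k) : Prop :=
  [/\ forall x, U x -> multilinear (A x),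
      forall x, U x -> alternating (A x) &
      forall w : 'I_k -> V, smooth_on U (fun x => A x w : R^o)].

(* Exterior derivative of a form on an open subset of V. *)
Definition ext_deriv k (A : V -> kform k) (x : V) : kform k.+1 := fun w =>
  \sum_(i < k.+1)
     (-1) ^+ i * ('D_(w i) (fun y => A y (fun j => w (lift i j)) : R^o) x : R).

(* For a submanifold M of V with inclusion iota, alpha is a smooth k-form on M
   and d alpha = beta.  A smooth form on M is locally iota^* A for some smooth
   form A on an open subset of V, and then d alpha = iota^* (d A), whatever the
   choice of A. *)
Definition is_ext_deriv k (M : set V) (alpha : V -> kform k)
    (beta : V -> kform k.+1) : Prop :=
  forall x, M x -> exists (U : set V) (A : V -> kform k),
    [/\ open_nbhs x U, smooth_kform U A,
        (forall y (w : 'I_k -> V), M y -> U y ->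
           (forall i, tangent M y (w i)) -> A y w = alpha y w) &
        (forall y (w : 'I_k.+1 -> V), M y -> U y ->
           (forall i, tangent M y (w i)) -> ext_deriv A y w = beta y w)].

Definition linear_on (T : set V) (W : lmodType R) (f : V -> W) : Prop :=
  forall (c : R) (u v : V), T u -> T v -> f (c *: u + v) = c *: f u + f v.

Definition smooth_metric (M : set V) (g : V -> V -> V -> R) : Prop :=
  forall x, M x -> exists (U : set V) (B : V -> V -> V -> R),
    [/\ open_nbhs x U,
        (forall y, U y -> (forall u, linear_on setT (B y u : V -> R^o)) /\
           (forall v, linear_on setT (fun u => B y u v : R^o))),
        (forall u v, smooth_on U (fun y => B y u v : R^o)) &
        (forall y u v, M y -> U y -> tangent M y u -> tangent M y v ->
           B y u v = g y u v)].

Definition riemannian_metric (M : set V) (g : V -> V -> V -> R) : Prop :=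
  [/\ smooth_metric M g,
      (forall x u, M x -> tangent M x u ->
         linear_on (tangent M x) (g x u : V -> R^o)),
      (forall x u v, M x -> tangent M x u -> tangent M x v ->
         g x u v = g x v u) &
      (forall x u, M x -> tangent M x u -> u != 0 -> 0 < g x u u)].

Definition hermitian_metric (M : set V) (J : V -> V -> V)
    (g : V -> V -> V -> R) : Prop :=
  riemannian_metric M g /\
  (forall x u v, M x -> tangent M x u -> tangent M x v ->
     g x (J x u) (J x v) = g x u v).

Definition kahler_form (J : V -> V -> V) (g : V -> V -> V -> R) (x : V)
    : kform 2 := fun w => g x (J x (w 0)) (w 1).

(* n is the complex dimension of (M, J). *)
Definition balanced_metric (n : nat) (M : set V) (J : V -> V -> V)
    (g : V -> V -> V -> R) : Prop :=
  hermitian_metric M J g /\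
  is_ext_deriv M (fun x => @wedge_pow (kahler_form J g x) n.-1) (fun _ _ => 0).

End MultilinearForms.

Section FocalSubmanifold.
Variable R : realType.

Definition dot N (x y : 'cV[R]_N) : R := \sum_i x i 0 * y i 0.

Definition clifford_system l m (P : 'I_m.+1 -> 'M[R]_(2 * l)) : Prop :=
  (forall i, (P i)^T = P i) /\
  (forall i j, P i *m P j + P j *m P i = (2 * (i == j)%:R)%:M).

Definition focal_plus l m (P : 'I_m.+1 -> 'M[R]_(2 * l))
    : set 'cV[R]_(2 * l) :=
  [set x | dot x x = 1 /\ forall i, dot (P i *m x) x = 0].

(* The real dimension is 2l - 1 - (m + 1). *)
Definition focal_plus_cdim (l m : nat) : nat := ((2 * l - (m + 2))./2)%N.

Definition orth_compl N (T : set 'cV[R]_N) (s : seq 'cV[R]_N)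
    : set 'cV[R]_N :=
  [set X | T X /\ forall e, e \in s -> dot e X = 0].

(* In the next two definitions the numerals indexing P are elements of the
   ring 'I_m.+1, all smaller than m.+1.  The conditions determine J x on the
   tangent space at x, for x in the focal submanifold. *)
Definition focal_J2 l (P : 'I_3 -> 'M[R]_(2 * l))
    (J : 'cV[R]_(2 * l) -> 'cV[R]_(2 * l) -> 'cV[R]_(2 * l)) : Prop :=
  forall x, focal_plus P x ->
    let T := tangent (focal_plus P) x in
    let e1 := P 0 *m P 1 *m x in
    let e2 := P 0 *m P 1 *m P 2 *m x in
    [/\ linear_on T (J x), J x e1 = e2, J x e2 = - e1 &
        forall X, orth_compl T [:: e1; e2] X -> J x X = P 0 *m P 1 *m X].

Definition focal_J4 l (P : 'I_5 -> 'M[R]_(2 * l))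
    (J : 'cV[R]_(2 * l) -> 'cV[R]_(2 * l) -> 'cV[R]_(2 * l)) : Prop :=
  forall x, focal_plus P x ->
    let T := tangent (focal_plus P) x in
    let e01 := P 0 *m P 1 *m x in
    let e23 := P 2 *m P 3 *m x in
    let e24 := P 2 *m P 4 *m x in
    let e34 := P 3 *m P 4 *m x in
    [/\ linear_on T (J x),
        J x e01 = e34 /\ J x e34 = - e01,
        J x e23 = e24 /\ J x e24 = - e23 &
        forall X, orth_compl T [:: e01; e23; e24; e34] X ->
          J x X = P 0 *m P 1 *m X].

Definition definite_case l (P : 'I_5 -> 'M[R]_(2 * l)) : Prop :=
  let Q := P 0 *m P 1 *m P 2 *m P 3 *m P 4 in Q = 1%:M \/ Q = - 1%:M.

End FocalSubmanifold.

(* Main.v *)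
Require Import Defs.
From HB Require Import structures.
From mathcomp Require Import all_boot all_order all_algebra all_fingroup.
From mathcomp Require Import all_classical all_reals all_analysis.
From mathcomp Require Import zify ring lra.

(** Let [omega] be the Kahler form of a Hermitian metric on the focal submanifold
   [M], of complex dimension [n], and suppose that its power of exponent [n - 1]
   is closed. For every 1-form [alpha] on [M], the exterior derivative of
   [alpha ^ omega ^ ... ^ omega] is then [d alpha ^ omega ^ ... ^ omega], and in a
   unitary frame [u_i, J u_i] this top form is a positive multiple of the sum of
   the [d alpha (u_i, J u_i)]. If [d alpha (u, J u)] had the same sign for all
   tangent vectors [u] and were nonzero for some [u] at each point, then an exact
   top form on a compact manifold would have no zero, against Stokes' theorem.

   Such a form is [alpha_x (v) = <x, P_0 P_1 v>]. As [P_0 P_1] is skew,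
   [d alpha (u, J u) = - 2 <P_0 P_1 u, J u>]. The matrix [P_0 P_1] agrees with [J]
   on a subspace of the tangent space, and takes the exceptional tangent vectors,
   which span its orthogonal complement, to normal vectors. So
   [<P_0 P_1 u, J u>] is the square of the norm of the component of [u] in this
   subspace ([J3_tangent], [J5_tangent]), and the subspace is not zero
   ([J3_positive], [J5_positive]).

   Stokes' theorem on [M] is reduced to the ambient space. The function
   [retraction] is an explicit retraction of a neighbourhood onto [M]; it also
   determines the tangent spaces ([tangent_focalP]) and gives a point of [M]
   ([focal_nonempty]). Pulling the power of [omega] back along it and multiplying
   by [alpha] and by the differentials of the functions that define [M], one gets
   a form of degree one less than the dimension ([prodform]), whose exterior
   derivative ([density]) is nonzero at the points of [M] if the above top form
   is. A cutoff turns this form into a vector field with compact support, whose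
   divergence is nonnegative and positive somewhere ([density_vanishes]). Summing
   its increments over finer and finer grids shows that there is no such field
   ([no_positive_divergence]).

   The sign of [d alpha ^ omega ^ ... ^ omega] comes out of the expansion of the
   wedge product on a unitary frame: no two terms have opposite signs
   ([wedge_term], [wedge_pow_sign_gt0]). *)

Set Implicit Arguments.
Unset Strict Implicit.
Unset Printing Implicit Defensive.

Import Order.TTheory GRing.Theory Num.Theory.
Import numFieldNormedType.Exports.
Local Open Scope classical_set_scope.
Local Open Scope ring_scope.

(** * Permutations and alternating sums *)

Lemma lift_permP n (i : 'I_n.+1) (s : 'S_n.+1) :
  exists t : 'S_n, s = lift_perm i (s i) t.
Proof.
pose f (j : 'I_n.+1) (u : 'S_n.+1) k := odflt k (unlift (u j) (u (lift j k))).
have fK j (u : 'S_n.+1) k : lift (u j) (f j u k) = u (lift j k).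
  rewrite /f; have := neq_lift j k.
  by rewrite -(can_eq (permK u)) => /unlift_some[] ? ? ->.
have inj_f : injective (f i s).
  move=> k l kl; apply: (@lift_inj _ i); apply: (@perm_inj _ s).
  by rewrite -!fK kl.
exists (perm inj_f); apply/permP=> k.
case: (unliftP i k) => [k'|] ->; last by rewrite lift_perm_id.
by rewrite lift_perm_lift permE fK.
Qed.

Fixpoint shift_perm q k (s : 'S_k) : 'S_(q + k) :=
  if q is q'.+1 then lift_perm ord0 ord0 (shift_perm q' s) else s.

Lemma rshiftS q k (j : 'I_k) :
  rshift q.+1 j = lift ord0 (rshift q j) :> 'I_(q.+1 + k).
Proof. exact: val_inj. Qed.

Lemma shift_perm_rshift q k (s : 'S_k) j :
  shift_perm q s (rshift q j) = rshift q (s j).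
Proof.
elim: q => [|q IH] /=; last by rewrite rshiftS lift_perm_lift IH -rshiftS.
have r0 (i : 'I_k) : rshift 0 i = i by apply: val_inj.
by rewrite !r0.
Qed.

Lemma shift_perm_lshift q k (s : 'S_k) i :
  shift_perm q s (lshift k i) = lshift k i.
Proof.
elim: q i => [|q IH] i /=; first by case: i.
case: (unliftP ord0 i) => [i'|] ->.
  rewrite (_ : lshift k (lift ord0 i') = lift ord0 (lshift k i')); last exact: val_inj.
  by rewrite lift_perm_lift IH.
by rewrite (_ : lshift k ord0 = ord0) ?lift_perm_id //; exact: val_inj.
Qed.

Lemma odd_shift_perm q k (s : 'S_k) : shift_perm q s = s :> bool.
Proof. by elim: q => [|q IH] //=; rewrite odd_lift_perm IH. Qed.

Lemma shift_permP q k (s : 'S_(q + k)) :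
  (forall i, s (lshift k i) = lshift k i) -> exists t, s = shift_perm q t.
Proof.
elim: q s => [|q IH] s Hs; first by exists s.
have [t st] := lift_permP ord0 s.
have s0 : s ord0 = ord0.
  by have := Hs ord0; rewrite (_ : lshift k ord0 = ord0) //; exact: val_inj.
move: st; rewrite s0 => st.
have [i|u tu] := IH t.
  apply: (@lift_inj _ ord0).
  have := Hs (lift ord0 i); rewrite st.
  rewrite (_ : lshift k (lift ord0 i) = lift ord0 (lshift k i)); last exact: val_inj.
  by rewrite lift_perm_lift.
by exists u; rewrite st tu.
Qed.

Section SignedSums.
Variable R : comPzRingType.

(** Pairing [s] with [s] after the transposition of two positions shows that a
   factor symmetric in these positions kills a signed sum. *)
Lemma signed_sum_sym (n : nat) (f : 'S_n -> R) (i j : 'I_n) :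
  i != j -> (forall s, f (tperm i j * s)%g = f s) ->
  \sum_(s : 'S_n) (-1) ^+ s * f s = 0.
Proof.
move=> ij fs.
rewrite (bigID (fun s : 'S_n => odd_perm s)) /=.
rewrite (reindex_inj (mulgI (tperm i j))) /=.
rewrite [X in X + _](eq_bigl (fun s : 'S_n => ~~ odd_perm s)); last first.
  by move=> s; rewrite odd_mul_tperm ij.
rewrite -big_split big1 //= => s Hs.
by rewrite fs odd_mul_tperm ij (negbTE Hs) /= expr1 expr0 mulN1r mul1r addNr.
Qed.

Lemma signed_sum_symr (n : nat) (f : 'S_n -> R) (i j : 'I_n) :
  i != j -> (forall s, f (s * tperm i j)%g = f s) ->
  \sum_(s : 'S_n) (-1) ^+ s * f s = 0.
Proof.
move=> ij fs; rewrite (reindex_inj invg_inj) /=.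
rewrite (eq_bigr (fun s : 'S_n => (-1) ^+ s * f (s^-1)%g)); last by move=> s _; rewrite odd_permV.
by apply: (signed_sum_sym ij) => s; rewrite invMg tpermV fs.
Qed.

End SignedSums.

(** * Powers of a 2-form on a symplectic frame *)

(** The matrix of the standard symplectic form in the ordering
   [u_0, J u_0, u_1, J u_1, ...]. *)
Definition sympl_entry (R : pzRingType) (i j : nat) : R :=
  if i./2 == j./2 then (i < j)%N%:R - (j < i)%N%:R else 0.

Section WedgePowers.
Variables (R : realType) (V : normedModType R).

Definition form2 (om : V -> V -> R) : kform V 2 := fun w => om (w 0) (w 1).

Definition symplectic_frame (om : V -> V -> R) n (w : 'I_n -> V) :=
  forall i j, om (w i) (w j) = sympl_entry R i j.

(** In each term of the defining sum, the vector perpendicular to all others is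
   an argument of [om] or of the lower power. *)
Lemma wedge_pow_perp (om : V -> V -> R) p (v : 'I_(p.*2) -> V) i0 :
  (forall j, om (v i0) (v j) = 0 /\ om (v j) (v i0) = 0) ->
  wedge_pow (form2 om) v = 0.
Proof.
elim: p v i0 => [|p IH] v i0; first by case: i0.
move=> Hv.
rewrite /= /wedge big1 ?mulr0 // => s _.
rewrite [X in _ * X](_ : _ = 0) ?mulr0 //.
pose i1 : 'I_(2 + p.*2) := (s^-1)%g i0.
have si1 : s i1 = i0 by rewrite /i1 permKV.
case: (split_ordP i1) => j ij; rewrite ij in si1.
  have [j0|j1] : j = 0 \/ j = 1.
  - by case: j {ij si1} => [[|[|]]] // ?; [left|right]; apply: val_inj.
  - by rewrite /form2 -j0 si1 (Hv _).1 mul0r.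
  - by rewrite /form2 -j1 si1 (Hv _).2 mul0r.
by rewrite (IH _ j) ?mulr0 // => j'; rewrite si1; exact: Hv.
Qed.

(** This sorts the terms of a product with a 2-form by the arguments of the
   2-form. *)
Lemma lift_perm2P n (s : 'S_(2 + n)) :
  exists (i : 'I_(2 + n)) (j : 'I_(1 + n)) (t : 'S_n),
    [/\ s (lshift n 0) = i, s (lshift n 1) = lift i j,
       forall a, s (rshift 2 a) = lift i (lift j (t a)) &
       s = odd i (+) odd j (+) t :> bool].
Proof.
have [s1 E1] := @lift_permP n.+1 ord0 s.
have [t E2] := @lift_permP n ord0 s1.
exists (s ord0), (s1 ord0), t.
have h0 : lshift n 0 = ord0 :> 'I_(2 + n) by apply: val_inj.
have h1 : lshift n 1 = lift ord0 ord0 :> 'I_(2 + n) by apply: val_inj.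
split.
- by rewrite h0.
- by rewrite h1 {1}E1 lift_perm_lift.
- move=> a; rewrite (_ : rshift 2 a = lift ord0 (lift ord0 a)); last exact: val_inj.
  by rewrite {1}E1 lift_perm_lift {1}E2 lift_perm_lift.
- by rewrite {1}E1 odd_lift_perm {1}E2 odd_lift_perm /= addbA.
Qed.

Lemma sympl_entry_neq (i j : nat) :
  i./2 != j./2 -> sympl_entry R i j = 0.
Proof. by rewrite /sympl_entry => /negbTE ->. Qed.

Lemma symplectic_frame_lift2 (om : V -> V -> R) n (w : 'I_(2 + n) -> V)
    (i : 'I_(2 + n)) (j : 'I_(1 + n)) :
  i./2 = (lift i j)./2 -> symplectic_frame om w ->
  symplectic_frame om (fun a => w (lift i (lift j a))).
Proof.
move=> ij Hw a b; rewrite Hw /sympl_entry.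
have H (c : 'I_n) : lift i (lift j c) = (if c < (i./2).*2 then c : nat else c.+2)%N :> nat.
  by move: ij; rewrite /= /bump; case: i j c => i Hi [j Hj] [c Hc] /=; case: ifP; lia.
rewrite !H.
move: (nat_of_ord a) (nat_of_ord b) => x y.
have -> : ((if x < (i./2).*2 then x else x.+2)./2 == (if y < (i./2).*2 then y else y.+2)./2)%N
   = (x./2 == y./2) by case: ifP; case: ifP; lia.
by case: eqP => // xy; congr (_%:R - _%:R); case: ifP; case: ifP; lia.
Qed.

Section Positivity.
Variables (om sg : V -> V -> R).

(** The sign of the permutation that brings a pair to the front is the sign
   picked up by reading the pair in reverse order. *)
Lemma pair_sign (i j : nat) :
  i./2 = (bump i j)./2 ->
  (-1) ^+ (odd i (+) odd j) = sympl_entry R i (bump i j).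
Proof.
move=> ij; rewrite /sympl_entry -ij eqxx.
have [ji|ji] := boolP (j < i)%N.
  have -> : bump i j = j by rewrite /bump; lia.
  have -> : (i < j)%N = false by lia.
  rewrite ji; have -> : odd i (+) odd j by move: ij; rewrite /bump; lia.
  by rewrite expr1 sub0r.
have -> : bump i j = j.+1 by rewrite /bump; lia.
have -> : (i < j.+1)%N by lia.
have -> : (j.+1 < i)%N = false by lia.
have -> : odd i (+) odd j = false by move: ij; rewrite /bump; lia.
by rewrite expr0 subr0.
Qed.

Definition sign_positive p := forall (w : 'I_(p.*2) -> V),
  symplectic_frame om w ->
  forall s : 'S_(p.*2), 0 < (-1) ^+ s * wedge_pow (form2 om) (w \o s).

(** Expanding the product of a 2-form [sg] with a power of [om] on a symplectic
   frame, the terms have a common sign once [sg] does not change the sign of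
   partners in the frame: if [sg] takes two vectors that are not partners, then
   the partner of one of them remains among the arguments of the power of [om]
   and is perpendicular to all others. This serves for [sg = om], to obtain the
   next power, and for the differential of the 1-form in the main argument. *)
Lemma wedge_term p (w : 'I_(2 + p.*2) -> V) :
  sign_positive p -> symplectic_frame om w ->
  (forall i j : 'I_(2 + p.*2),
     0 <= sympl_entry R i j * sg (w i) (w j)) ->
  forall s : 'S_(2 + p.*2),
  let i := s (lshift _ 0) in let j := s (lshift _ 1) in
  let t := (-1) ^+ s * (sg (w i) (w j) *
     wedge_pow (form2 om) (fun a => w (s (rshift 2 a)))) in
  0 <= t /\ (0 < sympl_entry R i j * sg (w i) (w j) -> 0 < t).
Proof.
move=> Hp Hw Hs s; have [i [j [t [-> -> st ss]]]] := lift_perm2P s.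
have -> : (fun a => w (s (rshift 2 a))) =
    (fun a => w (lift i (lift j a))) \o t.
  by apply/funext => a /=; rewrite st.
cbv zeta.
have [ij|ij] := eqVneq i./2 (lift i j)./2; last first.
  (* The partner of [i] is still present, but now perpendicular to all. *)
  rewrite sympl_entry_neq // mul0r ltxx; split=> //.
  suff -> : wedge_pow (form2 om) ((fun a => w (lift i (lift j a))) \o t) = 0.
    by rewrite !mulr0.
  pose k := (if odd i then i.-1 else i.+1)%N.
  have kp : (k < 2 + p.*2)%N by have := ltn_ord i; rewrite /k; case: ifP; lia.
  have [k1 Hk1] : exists k1, Ordinal kp = lift i k1.
    have [|k1 k1E _] := @unlift_some _ i (Ordinal kp); last by exists k1.
    by apply/eqP => /(congr1 val) /=; rewrite /k; case: ifP; lia.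
  have [k2 Hk2] : exists k2, k1 = lift j k2.
    have [|k2 k2E _] := @unlift_some _ j k1; last by exists k2.
    apply/eqP => kj; move: ij; rewrite kj -Hk1 /= /k; case: ifP; lia.
  apply: (@wedge_pow_perp _ _ _ ((t^-1)%g k2)) => a /=.
  rewrite permKV -Hk2 -Hk1 !Hw.
  have Ea : (lift i (lift j (t a)) : nat) != i.
    by have := neq_lift i (lift j (t a)); rewrite -val_eqE eq_sym.
  rewrite /sympl_entry; change (nat_of_ord (Ordinal kp)) with k; move: Ea;
    move: (nat_of_ord (lift i _)) => x xi.
  rewrite [x./2 == _]eq_sym; case: eqP => // kx.
  have -> : x = k by move: kx; rewrite /k; case: ifP; lia.
  by rewrite subrr.
have Hw' := symplectic_frame_lift2 ij Hw.
have := Hp _ Hw' t; set X := wedge_pow _ _; set E := sympl_entry R i _.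
rewrite ss signr_addb pair_sign // -/E.
move: (sg _ _) (Hs i (lift i j)); rewrite -/E => z Ez P.
rewrite mulrACA; split; first by rewrite mulr_ge0 // ltW.
by move=> H; rewrite mulr_gt0.
Qed.

End Positivity.

Lemma wedge_pow_sign_gt0 (om : V -> V -> R) p : sign_positive om p.
Proof.
elim: p => [|p IH] w Hw s.
  by rewrite (_ : odd_perm s = false) /= ?expr0 ?mulr1 // [s](_ : _ = 1%g) ?odd_perm1 //;
    apply/permP => -[].
have Hom (i j : 'I_(2 + p.*2)) : 0 <= sympl_entry R i j * om (w i) (w j).
  by rewrite Hw -expr2 sqr_ge0.
have T := wedge_term IH Hw Hom.
rewrite /= /wedge mulrCA mulr_gt0 //.
rewrite mulr_sumr (reindex_inj (mulIg (s^-1)%g)) /=.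
set F := BIG_F.
have FE (t : 'S_(2 + p.*2)) : F t = (-1) ^+ t * (om (w (t (lshift _ 0))) (w (t (lshift _ 1))) *
     wedge_pow (form2 om) (fun a => w (t (rshift 2 a)))).
  rewrite /F /form2 mulrA -signr_addb odd_permM odd_permV addbCA addbb addbF.
  rewrite !permM /= !permKV. congr (_ * (_ * _)).
  by congr (wedge_pow _ _); apply/funext => a /=; rewrite permM /= permKV.
rewrite (bigD1 (1%g : 'S_(2 + p.*2))) //= ltr_pwDl //.
  rewrite FE; apply: (T _).2.
  rewrite Hw !perm1 /= -expr2 exprn_even_gt0 //= /sympl_entry /= subr0.
  by rewrite oner_neq0.
by apply: sumr_ge0 => t _; rewrite FE; exact: (T t).1.
Qed.
End WedgePowers.

(** * Calculus of functions of class C^k *)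

Section NearEq.
Variables (R : realType) (V W : normedModType R).

Lemma near_eq_differentiable (f g : V -> W) x :
  (\forall y \near x, f y = g y) -> differentiable f x -> differentiable g x.
Proof.
move=> fg df.
have gx : g x = f x by rewrite (nbhs_singleton fg).
have [dc df'] := (diff_locallyP _ _).1 df.
have H : g \o shift x = cst (g x) + 'd f x +o_ 0 id.
  apply/eqaddoP => e e0.
  have := (eqaddoP _ _ _ _).1 df' e e0.
  move: fg; rewrite (near_shift 0) /= subr0 => fg.
  move=> H; near=> h.
  have E : f (h + x) = g (h + x).
    by near: h.
  rewrite gx -[X in `|X|]/(g (h + x) - (f x + 'd f x h)) -E.
  by near: h.
apply/diff_locallyP.
by rewrite (diff_unique dc H).
Unshelve. all: by end_near. Qed.

Lemma near_eq_continuous_at (f g : V -> W) x :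
  (\forall y \near x, f y = g y) ->
  {for x, continuous f} -> {for x, continuous g}.
Proof.
move=> fg cf; rewrite /continuous_at /prop_for -(nbhs_singleton fg).
apply: cvg_trans cf; apply: near_eq_cvg.
by apply: filterS fg => y ->.
Qed.

End NearEq.

Lemma derive_comp (R : realType) (U V W : normedModType R) (f : U -> V)
    (g : V -> W) x v : differentiable f x -> differentiable g (f x) ->
  'D_v (g \o f) x = 'D_('D_v f x) g (f x).
Proof.
move=> df dg; rewrite !deriveE //; last exact: differentiable_comp.
by rewrite diff_comp.
Qed.

Section Ck.
Variables (R : realType) (V : normedModType R).
Implicit Types (U : set V).

Lemma Ck_subset (W : normedModType R) k U U' (f : V -> W) :
  U' `<=` U -> Ck k U f -> Ck k U' f.
Proof.
move=> UU; elim: k f => [|k IH] f /=; first by move=> H x /UU; exact: H.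
by move=> [H1 H2]; split=> [x /UU|v]; [exact: H1|apply: IH].
Qed.

Lemma Ck_ext (W : normedModType R) k U (f g : V -> W) :
  open U -> (forall x, U x -> f x = g x) -> Ck k U f -> Ck k U g.
Proof.
move=> oU; elim: k f g => [|k IH] f g fg /=.
  move=> H x Ux; apply: near_eq_continuous_at (H x Ux).
  by apply: filterS (open_nbhs_nbhs (conj oU Ux)).
have nfg x : U x -> \forall y \near x, f y = g y.
  by move=> Ux; apply: filterS (open_nbhs_nbhs (conj oU Ux)).
move=> [H1 H2]; split=> [x Ux|v].
  by apply: near_eq_differentiable (H1 x Ux); exact: nfg.
by apply: IH (H2 v) => x Ux; apply: near_eq_derive; exact: nfg.
Qed.

(** The class is a local notion: the iterated derivatives at a point only
   depend on the germ of the function. *)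
Lemma Ck_local (W : normedModType R) k U (f : V -> W) :
  (forall x, U x -> exists B : set V, B x /\ Ck k B f) -> Ck k U f.
Proof.
elim: k f => [|k IH] f H /=.
  by move=> x /H[B [Bx HB]]; exact: HB.
split=> [x /H[B [Bx [HB _]]]|v]; first exact: HB.
by apply: IH => x /H[B [Bx [_ HB]]]; exists B; split=> //; exact: HB.
Qed.

Lemma Ck_continuous (W : normedModType R) k U (f : V -> W) :
  Ck k U f -> forall x, U x -> {for x, continuous f}.
Proof.
case: k => [//|k] [H _] x Ux.
exact/differentiable_continuous/H.
Qed.

Lemma CkW (W : normedModType R) k U (f : V -> W) : Ck k.+1 U f -> Ck k U f.
Proof.
elim: k f => [|k IH] f; first by move=> H x; exact: (Ck_continuous H).
by move=> [H1 H2]; split=> // v; apply: IH; exact: H2.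
Qed.

Lemma Ck_cst (W : normedModType R) k U (c : W) : Ck k U (fun=> c).
Proof.
elim: k c => [|k IH] c /=; first by move=> x _; exact: cst_continuous.
split=> [x _|v]; first exact: differentiable_cst.
rewrite [X in Ck _ _ X](_ : _ = fun=> 0); first exact: IH.
by apply/funext => x; exact: derive_cst.
Qed.

Lemma CkD (W : normedModType R) k U (f g : V -> W) : open U ->
  Ck k U f -> Ck k U g -> Ck k U (fun x => f x + g x).
Proof.
move=> oU; elim: k f g => [|k IH] f g /=.
  by move=> Hf Hg x Ux; apply: continuousD; [exact: Hf|exact: Hg].
move=> [f1 f2] [g1 g2]; split=> [x Ux|v].
  by apply: differentiableD; [exact: f1|exact: g1].
apply: Ck_ext (IH _ _ (f2 v) (g2 v)) => // x Ux.
by rewrite -[RHS]/('D_v (f + g) x) deriveD //; apply: diff_derivable; [exact: f1|exact: g1].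
Qed.

Lemma Ck_sum (W : normedModType R) k U (I : Type) (r : seq I) (P : pred I)
    (f : I -> V -> W) : open U ->
  (forall i, P i -> Ck k U (f i)) -> Ck k U (fun x => \sum_(i <- r | P i) f i x).
Proof.
move=> oU Hf; elim: r => [|i r IH].
  by rewrite [X in Ck _ _ X](_ : _ = fun=> 0); [exact: Ck_cst|apply/funext=> x; rewrite big_nil].
case Pi: (P i); last first.
  by rewrite [X in Ck _ _ X](_ : _ = (fun x => \sum_(i <- r | P i) f i x)) //; apply/funext=> x;
    rewrite big_cons Pi.
rewrite [X in Ck _ _ X](_ : _ = (fun x => f i x + \sum_(i <- r | P i) f i x)).
  by apply: CkD => //; exact: Hf.
by apply/funext=> x; rewrite big_cons Pi.
Qed.

Lemma CkM k U (f g : V -> R^o) : open U ->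
  Ck k U f -> Ck k U g -> Ck k U (fun x => f x * g x : R^o).
Proof.
move=> oU; elim: k f g => [|k IH] f g.
  by move=> Hf Hg x Ux; apply: continuousM; [exact: Hf|exact: Hg].
move=> Cf Cg; have [f1 f2] := Cf; have [g1 g2] := Cg; split=> [x Ux|v].
  by apply: differentiableM; [exact: f1|exact: g1].
have := CkD oU (IH _ _ (CkW Cf) (g2 v)) (IH _ _ (CkW Cg) (f2 v)).
apply: Ck_ext => // x Ux.
by rewrite -[RHS]/('D_v (f * g) x) deriveM //; apply: diff_derivable; [exact: f1|exact: g1].
Qed.

Lemma CkN k U (f : V -> R^o) : open U -> Ck k U f -> Ck k U (fun x => - f x : R^o).
Proof.
move=> oU Hf; have := CkM oU (Ck_cst k U (-1 : R^o)) Hf.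
by apply: Ck_ext => // x _; rewrite mulN1r.
Qed.

Lemma Ck_prod k U (I : Type) (r : seq I) (f : I -> V -> R^o) : open U ->
  (forall i, Ck k U (f i)) -> Ck k U (fun x => \prod_(i <- r) f i x : R^o).
Proof.
move=> oU Hf; elim: r => [|i r IH].
  by rewrite [X in Ck _ _ X](_ : _ = fun=> 1); [exact: Ck_cst|apply/funext=> x; rewrite big_nil].
rewrite [X in Ck _ _ X](_ : _ = (fun x => f i x * \prod_(i <- r) f i x)).
  by apply: CkM.
by apply/funext=> x; rewrite big_cons.
Qed.

Lemma CkZl (W : normedModType R) k U (f : V -> R^o) (w : W) : open U ->
  Ck k U f -> Ck k U (fun x => f x *: w).
Proof.
move=> oU; elim: k f => [|k IH] f /=.
  by move=> Hf x Ux; apply: continuousZr_tmp; exact: Hf.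
move=> [f1 f2]; split=> [x Ux|v]; first by apply: differentiableZl; exact: f1.
apply: Ck_ext (IH _ (f2 v)) => // x Ux.
have df := f1 x Ux.
rewrite !deriveE //; last exact: differentiableZl.
by rewrite diffZl.
Qed.

Lemma CkV k U (f : V -> R^o) : open U -> (forall x, U x -> f x != 0) ->
  Ck k U f -> Ck k U (fun x => (f x)^-1 : R^o).
Proof.
move=> oU f0; elim: k => [|k IH].
  by move=> Hf x Ux; apply: continuousV; [exact: f0|exact: Hf].
move=> Cf; have [f1 f2] := Cf; split=> [x Ux|v].
  by apply: differentiableV; [exact: f1|exact: f0].
have IHf := IH (CkW Cf).
have := CkN oU (CkM oU (CkM oU IHf IHf) (f2 v)).
apply: Ck_ext => // x Ux.
rewrite deriveV ?f0 //; last by apply: diff_derivable; exact: f1.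
by rewrite /GRing.scale /= -expr2 exprVn mulNr.
Qed.

Lemma Ck_sqrt k U (f : V -> R^o) : open U -> (forall x, U x -> 0 < f x) ->
  Ck k U f -> Ck k U (fun x => Num.sqrt (f x) : R^o).
Proof.
move=> oU f0; elim: k => [|k IH].
  move=> Hf x Ux; apply: (@continuous_comp _ _ _ f) => //; first exact: Hf.
  exact: sqrt_continuous.
move=> Cf; have [f1 f2] := Cf.
have ds x : U x -> is_derive (f x) 1 (Num.sqrt : R^o -> R^o) (2 * Num.sqrt (f x))^-1.
  by move=> Ux; apply: is_derive1_sqrt; exact: f0.
have dfs x : U x -> differentiable (Num.sqrt : R^o -> R^o) (f x).
  by move=> Ux; apply/derivable1_diffP; have [] := ds x Ux.
split=> [x Ux|v].
  by apply: differentiable_comp; [exact: f1|exact: dfs].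
have IHf := IH (CkW Cf).
have n0 x : U x -> 2 * Num.sqrt (f x) != 0.
  by move=> Ux; rewrite mulf_neq0 // ?pnatr_eq0 // gt_eqF // sqrtr_gt0 f0.
have := CkM oU (f2 v) (CkV oU n0 (CkM oU (Ck_cst k U (2 : R^o)) IHf)).
apply: Ck_ext => // x Ux.
have dfx := f1 x Ux.
rewrite -[RHS]/('D_v ((Num.sqrt : R^o -> R^o) \o f) x) (derive_comp _ dfx (dfs x Ux)).
rewrite [RHS]deriveE; last exact: dfs.
rewrite -[in RHS](mulr1 ('D_v f x)) -[X in 'd _ _ X]/('D_v f x *: (1 : R^o)).
rewrite linearZ /= -deriveE; last exact: dfs.
by have [_ ->] := ds x Ux.
Qed.

End Ck.

Section CkColumns.
Variables (R : realType) (X : normedModType R) (N : nat).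

Definition basis_vec (j : 'I_N) : 'cV[R]_N := delta_mx j 0.

Lemma col_basis_sum (v : 'cV[R]_N) : v = \sum_j v j 0 *: basis_vec j.
Proof.
rewrite {1}[v]matrix_sum_delta; apply: eq_bigr => j _.
by rewrite big_ord1.
Qed.

Lemma Ck_col k (U : set X) (r : X -> 'cV[R]_N) : open U ->
  (forall j, Ck k U (fun x => r x j 0 : R^o)) -> Ck k U r.
Proof.
move=> oU Hr.
have := @Ck_sum R X _ k U _ (index_enum _) xpredT
  (fun j x => (r x j 0 : R^o) *: basis_vec j) oU (fun j _ => CkZl _ oU (Hr j)).
by apply: Ck_ext => // x _; rewrite -col_basis_sum.
Qed.

Lemma derive_coord (r : X -> 'cV[R]_N) x v j : differentiable r x ->
  'D_v (fun y => r y j 0 : R^o) x = ('D_v r x) j 0.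
Proof.
by move=> dr; rewrite derive_mx ?mxE //; exact: diff_derivable.
Qed.

Lemma differentiable_coord_of (r : X -> 'cV[R]_N) x j : differentiable r x ->
  differentiable (fun y => r y j 0 : R^o) x.
Proof.
move=> dr; apply: (@differentiable_comp _ _ _ _ r (fun M : 'cV[R]_N => M j 0 : R^o)) => //.
exact: differentiable_coord.
Qed.

Lemma derive_basis_sum (W : normedModType R) (A : 'cV[R]_N -> W) x v :
  differentiable A x -> 'D_v A x = \sum_j v j 0 *: 'D_(basis_vec j) A x.
Proof.
move=> dA; rewrite deriveE // {1}(col_basis_sum v) linear_sum.
by apply: eq_bigr => j _; rewrite linearZ /= deriveE.
Qed.

Lemma Ck_comp k (U : set X) (B : set 'cV[R]_N) (r : X -> 'cV[R]_N)
    (A : 'cV[R]_N -> R^o) : open U -> (forall x, U x -> B (r x)) ->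
  (forall j, Ck k U (fun x => r x j 0 : R^o)) -> Ck k B A ->
  Ck k U (fun x => A (r x)).
Proof.
move=> oU UB; elim: k A => [|k IH] A Hr CA.
  move=> x Ux; apply: (@continuous_comp _ _ _ r A).
    exact: (Ck_continuous (Ck_col oU Hr)).
  exact/CA/UB.
have [A1 A2] := CA; have [r1 r2] := Ck_col oU Hr.
split=> [x Ux|v].
  by apply: (@differentiable_comp _ _ _ _ r A); [exact: r1|exact/A1/UB].
have Hr' j : Ck k U (fun x => r x j 0 : R^o) by exact/CkW/Hr.
have Hs : Ck k U (fun x => \sum_j 'D_v (fun y => r y j 0 : R^o) x * 'D_(basis_vec j) A (r x) : R^o).
  apply: Ck_sum => // j _; apply: CkM => //; first by have [_] := Hr j; apply.
  exact: (IH _ Hr' (A2 _)).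
apply: Ck_ext Hs => // x Ux.
rewrite -[RHS]/('D_v (A \o r) x) derive_comp; [|exact: r1|exact/A1/UB].
rewrite [RHS]derive_basis_sum; last exact/A1/UB.
by apply: eq_bigr => j _; rewrite derive_coord //; exact: r1.
Qed.

End CkColumns.

Section Multilinear.
Variables (R : realType) (N : nat).
Local Notation V := 'cV[R]_N.
Local Notation e := (@basis_vec R N).

Definition fcons (T : Type) n (t : T) (f : 'I_n -> T) (i : 'I_n.+1) : T :=
  if unlift ord0 i is Some i' then f i' else t.

Lemma fcons0 (T : Type) n (t : T) (f : 'I_n -> T) : fcons t f ord0 = t.
Proof. by rewrite /fcons unlift_none. Qed.

Lemma fconsS (T : Type) n (t : T) (f : 'I_n -> T) i : fcons t f (lift ord0 i) = f i.
Proof. by rewrite /fcons liftK. Qed.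

Lemma sum_ffunS (T : finType) n (F : {ffun 'I_n.+1 -> T} -> R) :
  \sum_f F f = \sum_t \sum_(g : {ffun 'I_n -> T}) F [ffun i => fcons t g i].
Proof.
rewrite pair_big /= (reindex (fun p : T * {ffun 'I_n -> T} => [ffun i => fcons p.1 p.2 i])) //.
exists (fun f : {ffun 'I_n.+1 -> T} => (f ord0, [ffun i => f (lift ord0 i)])).
  move=> [t g] _ /=; rewrite ffunE fcons0; congr (_, _).
  by apply/ffunP => i; rewrite !ffunE fconsS.
move=> f _; apply/ffunP => i; rewrite ffunE /=.
case: (unliftP ord0 i) => [i'|] ->; first by rewrite fconsS ffunE.
by rewrite fcons0.
Qed.

Lemma multilinear_sum k (a : kform V k) (i : 'I_k) w (I : Type) (r : seq I)
    (c : I -> R) (u : I -> V) : multilinear a ->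
  a [eta w with i |-> \sum_(j <- r) c j *: u j] =
  \sum_(j <- r) c j * a [eta w with i |-> u j].
Proof.
move=> la; elim: r => [|j r IH].
  rewrite !big_nil; have := la i w 1 0 0; rewrite scaler0 addr0 mul1r => /eqP.
  by rewrite -subr_eq0 opprD addrA subrr sub0r oppr_eq0 => /eqP.
by rewrite !big_cons la IH.
Qed.

Lemma eta_id k (w : 'I_k -> V) i : ([eta w with i |-> w i] : 'I_k -> V) = w.
Proof. by apply/funext => j /=; case: eqP => [->|]. Qed.

Lemma eta_fcons k (u t : V) (w : 'I_k -> V) i :
  fcons u [eta w with i |-> t] =
  ([eta fcons u w with lift ord0 i |-> t] : 'I_k.+1 -> V).
Proof.
apply/funext => j /=; case: (unliftP ord0 j) => [j'|] ->.
  by rewrite !fconsS /= (inj_eq (@lift_inj _ _)).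
by rewrite !fcons0.
Qed.

Lemma multilinear_fcons k (a : kform V k.+1) u : multilinear a ->
  multilinear (fun w => a (fcons u w)).
Proof. by move=> la i w c x y; rewrite !eta_fcons la. Qed.

Lemma multilinear_expand k (a : kform V k) w : multilinear a ->
  a w = \sum_(f : {ffun 'I_k -> 'I_N})
          (\prod_i w i (f i) 0) * a (fun i => e (f i)).
Proof.
elim: k a w => [|k IH] a w la.
  have -> : w = fun i => e ([ffun x : 'I_0 => match x with Ordinal _ l => False_rect _ (notF l)
    end] i).
    by apply/funext => -[].
  set f0 := finfun _.
  rewrite (bigD1 f0) //= big_ord0 mul1r big1 ?addr0 // => f.
  by move=> /eqP []; apply/ffunP => -[].
rewrite sum_ffunS.
have -> : a w = a [eta w with ord0 |-> \sum_j w ord0 j 0 *: e j].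
  by rewrite -col_basis_sum eta_id.
rewrite (multilinear_sum _ _ _ _ _ la); apply: eq_bigr => j _.
have -> : ([eta w with ord0 |-> e j] : 'I_k.+1 -> V) =
   fcons (e j) (fun i => w (lift ord0 i)).
  apply/funext => i /=; case: (unliftP ord0 i) => [i'|] ->; first by rewrite !fconsS.
  by rewrite fcons0.
rewrite (IH _ _ (multilinear_fcons (e j) la)) mulr_sumr; apply: eq_bigr => g _.
rewrite big_ord_recl ffunE fcons0 mulrA; congr (_ * _ * a _).
  by apply: eq_bigr => i _; rewrite ffunE fconsS.
apply/funext => i; case: (unliftP ord0 i) => [i'|] ->; first by rewrite fconsS ffunE fconsS.
by rewrite fcons0 ffunE fcons0.
Qed.

End Multilinear.

Section Leibniz.
Variables (R : realType) (V : normedModType R).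

Lemma is_derive_bigprod n (f : 'I_n -> V -> R^o) (x v : V) (df : 'I_n -> R) :
  (forall i, is_derive x v (f i) (df i)) ->
  is_derive x v (fun y => \prod_i f i y : R^o)
    (\sum_j \prod_i (if i == j then df i else f i x)).
Proof.
elim: n f df => [|n IH] f df Hf.
  rewrite big_ord0 [X in is_derive _ _ X](_ : _ = cst 1); first exact: is_derive_cst.
  by apply/funext => y; rewrite big_ord0.
have H := IH (fun i => f (lift ord0 i)) (fun i => df (lift ord0 i)) (fun i => Hf _).
rewrite [X in is_derive _ _ X](_ : _ = f ord0 * (fun y => \prod_i f (lift ord0 i) y : R^o));
  last first.
  by apply/funext => y; rewrite big_ord_recl.
apply: is_derive_eq; rewrite [RHS]big_ord_recl [RHS]addrC; congr (_ + _).
  rewrite scaler_sumr; apply: eq_bigr => j _.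
  rewrite [RHS]big_ord_recl (negbTE (neq_lift _ _)).
  congr (_ * _); apply: eq_bigr => i _.
rewrite [RHS]big_ord_recl eqxx /GRing.scale /= mulrC; congr (_ * _).
Qed.

Lemma is_derive_fsum (I : Type) (r : seq I) (f : I -> V -> R^o) (x v : V)
    (df : I -> R) : (forall i, is_derive x v (f i) (df i)) ->
  is_derive x v (\sum_(i <- r) f i) (\sum_(i <- r) df i).
Proof.
by move=> ?; elim/big_ind2 : _ => // [|] *; [exact: is_derive_cst|exact: is_deriveD].
Qed.

End Leibniz.

Section MultilinearDerivative.
Variables (R : realType) (X : normedModType R) (N k : nat).
Local Notation V := 'cV[R]_N.
Local Notation e := (@basis_vec R N).
Variables (a : X -> kform V k) (z : 'I_k -> X -> V).

(** Expanding in coordinates reduces smoothness, for arguments that vary with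
   the point, to smoothness for constant arguments. *)
Lemma Ck_multilinear n (U : set X) : open U ->
  (forall x, U x -> multilinear (a x)) ->
  (forall f : {ffun 'I_k -> 'I_N}, Ck n U (fun x => a x (fun i => e (f i)) : R^o)) ->
  (forall i j, Ck n U (fun x => z i x j 0 : R^o)) ->
  Ck n U (fun x => a x (fun i => z i x) : R^o).
Proof.
move=> oU la Ca Cz.
have H : Ck n U (fun x => \sum_(f : {ffun 'I_k -> 'I_N})
          (\prod_i z i x (f i) 0) * a x (fun i => e (f i)) : R^o).
  apply: Ck_sum => // f _; apply: CkM => //.
  exact: (Ck_prod _ oU (fun i => Cz i (f i))).
apply: Ck_ext H => // x Ux.
by rewrite [RHS]multilinear_expand //; exact: la.
Qed.

Lemma derive_multilinear x v :
  (\forall y \near x, multilinear (a y)) ->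
  (forall f : {ffun 'I_k -> 'I_N}, differentiable (fun x => a x (fun i => e (f i)) : R^o) x) ->
  (forall i, differentiable (z i) x) ->
  'D_v (fun y => a y (fun i => z i y) : R^o) x =
  'D_v (fun y => a y (fun i => z i x) : R^o) x +
  \sum_j a x [eta (fun i => z i x) with j |-> 'D_v (z j) x].
Proof.
move=> la da dz.
have lax := nbhs_singleton la.
have dc i (f : {ffun 'I_k -> 'I_N}) :
    is_derive x v (fun y => z i y (f i) 0 : R^o) (('D_v (z i) x) (f i) 0).
  rewrite -derive_coord //; apply: derivableP; apply: diff_derivable.
  exact: differentiable_coord_of.
have dp f := is_derive_bigprod (fun i => dc i f).
have da' (f : {ffun 'I_k -> 'I_N}) : is_derive x v (fun x => a x (fun i => e (f i)) : R^o)
    ('D_v (fun x => a x (fun i => e (f i)) : R^o) x).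
  exact/derivableP/diff_derivable.
have expand (u : 'I_k -> X -> V) : 'D_v (fun y => a y (fun i => u i y) : R^o) x =
    'D_v (\sum_(f : {ffun 'I_k -> 'I_N}) (fun y => (\prod_i u i y (f i) 0) * a y (fun i => e (f
      i)) : R^o)) x.
  apply: near_eq_derive; apply: filterS la => y ly.
  by rewrite [LHS]multilinear_expand // fct_sumE.
rewrite (expand z) (expand (fun i _ => z i x)).
have D1 (f : {ffun 'I_k -> 'I_N}) : is_derive x v (fun y => (\prod_i z i y (f i) 0) * a y (fun i
  => e (f i)) : R^o)
   ((\prod_i z i x (f i) 0) * 'D_v (fun x => a x (fun i => e (f i)) : R^o) x +
    a x (fun i => e (f i)) * (\sum_j \prod_i (if i == j then ('D_v (z i) x) (f i) 0 else z i x (f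
      i) 0))).
  rewrite -[X in is_derive _ _ X]/((fun y => \prod_i z i y (f i) 0) * (fun y => a y (fun i => e
    (f i))) : X -> R^o).
  exact: is_deriveM (dp f) (da' f).
have D2 (f : {ffun 'I_k -> 'I_N}) : is_derive x v (fun y => (\prod_i z i x (f i) 0) * a y (fun i
  => e (f i)) : R^o)
   ((\prod_i z i x (f i) 0) * 'D_v (fun x => a x (fun i => e (f i)) : R^o) x).
  exact: (is_deriveZ _ (da' f)).
have [_ ->] := is_derive_fsum (index_enum _) D1.
have [_ ->] := is_derive_fsum (index_enum _) D2.
rewrite big_split; congr (_ + _) => /=.
under eq_bigr do rewrite mulr_sumr.
rewrite exchange_big /=; apply: eq_bigr => j _.
rewrite [RHS]multilinear_expand //; apply: eq_bigr => f _.
rewrite mulrC; congr (_ * _); apply: eq_bigr => i _ /=.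
by case: eqP => [->|].
Qed.

End MultilinearDerivative.

Section MulNorm.
Variable R : realType.

(** The signed square is of class C^1; adding the square to it gives twice the
   square of the positive part. *)
Lemma is_derive_mulnorm (z : R) :
  is_derive z 1 (fun z => z * `|z| : R^o) (2 * `|z|).
Proof.
have sq (a : R) : is_derive z 1 (fun z : R => a *: (z * z) : R^o) (2 * (a * z)).
  have := is_deriveZ a (is_deriveM (is_derive_id z (1 : R)) (is_derive_id z (1 : R))).
  move=> H; apply: is_derive_eq H _; rewrite /GRing.scale /=; ring.
have [z0|z0|<-] := ltgtP 0 z.
- rewrite gtr0_norm //; have := sq 1; rewrite mul1r.
  apply: near_eq_is_derive.
  have : nbhs z [set y | 0 < y] by apply: open_nbhs_nbhs; split => //; exact: open_gt.
  by apply: filterS => y y0; rewrite scale1r gtr0_norm.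
- rewrite ltr0_norm //; have := sq (-1); rewrite mulN1r.
  apply: near_eq_is_derive.
  have : nbhs z [set y | y < 0] by apply: open_nbhs_nbhs; split => //; exact: open_lt.
  by apply: filterS => y y0; rewrite scaleN1r ltr0_norm // mulrN.
rewrite normr0 mulr0.
have H : (fun h : R => h^-1 *: ((h *: (1 : R) + 0) * `|h *: (1 : R) + 0| - 0 * `|0 : R|)) @ 0^'
  --> (0 : R).
  apply: (@cvg_trans _ ((fun h : R => `|h|) @ 0^')).
    apply: near_eq_cvg; near=> h.
    have h0 : h != 0 by near: h; exact: nbhs_dnbhs_neq.
    by rewrite mul0r subr0 addr0 /GRing.scale /= mulr1 mulrA mulVf ?mul1r.
  have C : (fun h : R => `|h|) @ 0^' --> `|0 : R|.
    by apply: cvg_norm; apply: cvg_within_filter; exact: cvg_id.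
  by rewrite normr0 in C.
split; first by apply/cvg_ex; exists 0.
exact: cvg_lim H.
Unshelve. all: by end_near. Qed.

Lemma differentiable_mulnorm (z : R) : differentiable (fun z : R => z * `|z| : R^o) z.
Proof. by apply/derivable1_diffP; have [] := is_derive_mulnorm z. Qed.

Lemma derive_mulnorm (X : normedModType R) (f : X -> R^o) x v : differentiable f x ->
  is_derive x v (fun y => f y * `|f y| : R^o) (2 * `|f x| * 'D_v f x).
Proof.
move=> df.
have dm := differentiable_mulnorm (f x).
apply: DeriveDef.
  apply: diff_derivable.
  exact: (@differentiable_comp _ _ _ _ f (fun z : R^o => z * `|z| : R^o)).
rewrite [LHS](derive_comp v df dm) deriveE //.
rewrite -[in LHS](mulr1 ('D_v f x)) -[X in 'd _ _ X]/('D_v f x *: (1 : R^o)).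
rewrite linearZ /= -deriveE //; have [_ ->] := is_derive_mulnorm (f x).
by rewrite [LHS]mulrC.
Qed.

Lemma Ck1_mulnorm (X : normedModType R) (U : set X) (f : X -> R^o) : open U ->
  Ck 1 U f -> Ck 1 U (fun y => f y * `|f y| : R^o).
Proof.
move=> oU Cf; have [df cf] := Cf; split=> [x Ux|v].
  apply: (@differentiable_comp _ _ _ _ f (fun z : R^o => z * `|z| : R^o)); first exact: df.
  exact: differentiable_mulnorm.
have Cn : Ck 0 U (fun y => `|f y| : R^o).
  move=> x Ux; apply: (@continuous_comp _ _ _ f) => //; last exact: norm_continuous.
  exact: (Ck_continuous Cf).
have := CkM oU (CkM oU (Ck_cst 0 U (2 : R^o)) Cn) (cf v).
by apply: Ck_ext => // x Ux; have [_ ->] := derive_mulnorm v (df x Ux).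
Qed.

End MulNorm.

(** * A compactly supported vector field cannot have positive divergence *)

Lemma Ck_mx_entry (R : realType) m n k (U : set 'M[R]_(m, n)) i j :
  Ck k U (fun M : 'M[R]_(m, n) => M i j : R^o).
Proof.
case: k => [|k]; first by move=> M _; exact: coord_continuous.
split=> [M _|v]; first exact: differentiable_coord.
rewrite [X in Ck _ _ X](_ : _ = fun=> v i j); first exact: Ck_cst.
apply/funext => M.
have := @derive_mx R _ m n id M v; rewrite derive_id => /(_ _)/matrixP /(_ i j).
by rewrite mxE => ->.
Qed.

Section GridSums.
Variables (R : realType) (N : nat).
Local Notation V := 'cV[R]_N.
Local Notation e := (@basis_vec R N).

Lemma mx_entry_le_norm m n (M : 'M[R]_(m, n)) i j : `|M i j| <= `|M|.
Proof.
rewrite [leRHS]/Num.Def.normr /= mx_normrE.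
exact: (le_bigmax _ (fun ij : 'I_m * 'I_n => `|M ij.1 ij.2|) (i, j)).
Qed.

Lemma mx_norm_le_entry m n (M : 'M[R]_(m, n)) c :
  0 <= c -> (forall i j, `|M i j| <= c) -> `|M| <= c.
Proof.
move=> c0 H; rewrite [leLHS]/Num.Def.normr /= mx_normrE.
by apply: bigmax_le => // -[i j] _ /=.
Qed.

Lemma norm_trmx_le m n (M : 'M[R]_(m, n)) : `|M^T| <= `|M|.
Proof.
by apply: mx_norm_le_entry => // i j; rewrite mxE; exact: mx_entry_le_norm.
Qed.

Lemma closed_ball_compact (L : R) : compact [set v : V | `|v| <= L].
Proof.
have -> : [set v : V | `|v| <= L] = (@trmx R 1 N) @` [set w : 'rV[R]_N | `|w| <= L].
  apply/seteqP; split=> [v /= Hv|v /= [w Hw <-]].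
    exists v^T; rewrite ?trmxK //; exact: le_trans (norm_trmx_le _) Hv.
  exact: le_trans (norm_trmx_le _) Hw.
have ct : continuous (@trmx R 1 N).
  move=> w; apply: differentiable_continuous.
  have [H _] : Ck 1 setT (fun u : 'rV[R]_N => u^T); last exact: H.
  apply: Ck_col => [|j]; first exact: openT.
  have := @Ck_mx_entry R 1 N 1 setT 0 j.
  by apply: Ck_ext => [|u _]; [exact: openT|rewrite mxE].
apply: continuous_compact; first exact: continuous_subspaceT.
apply: bounded_closed_compact.
  exists L; split; first exact: num_real.
  by move=> M LM w /= Hw; apply: le_trans (ltW LM).
apply: (@closed_comp _ _ (fun w : 'rV[R]_N => `|w|) [set x | x <= L]) => [w _|];
  last exact: closed_le.
exact: norm_continuous.
Qed.

Lemma differentiable_line (W : normedModType R) (p v : W) (s : R^o) :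
  differentiable (fun s : R^o => p + s *: v) s.
Proof.
by apply: differentiableD; [exact: differentiable_cst|exact: differentiableZl].
Qed.

Lemma derive_line (W : normedModType R) (p v : W) (s : R^o) :
  'D_1 (fun s : R^o => p + s *: v) s = v.
Proof.
have d2 : differentiable (fun s : R^o => s *: v) s by exact: differentiableZl.
rewrite -[X in 'D_1 X s]/(cst p + (fun s : R^o => s *: v)).
rewrite deriveD; [|exact/diff_derivable/differentiable_cst|exact/diff_derivable].
rewrite derive_cst add0r deriveE //.
have -> : 'd (fun s : R^o => s *: v) s = (fun s : R^o => s *: v) :> (R^o -> W) by rewrite diff_val.
by rewrite scale1r.
Qed.

Lemma dir_MVT (Y : V -> R^o) (p v : V) (t : R) : 0 < t ->
  (forall x, differentiable Y x) ->
  exists2 c, 0 < c < t & Y (p + t *: v) - Y p = t * 'D_v Y (p + c *: v).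
Proof.
move=> t0 dY.
pose f (s : R^o) : R^o := Y (p + s *: v).
pose g (s : R^o) := p + s *: v.
have da (s : R^o) : differentiable g s by exact: differentiable_line.
have Df (s : R^o) : is_derive s (1 : R^o) f ('D_v Y (g s)).
  apply: DeriveDef; first exact/diff_derivable/(@differentiable_comp _ _ _ _ g Y).
  by rewrite [LHS](derive_comp _ (da s) (dY (g s))) derive_line.
have cf : {within `[0, t], continuous f}.
  apply: continuous_subspaceT => s; apply: differentiable_continuous.
  exact: (@differentiable_comp _ _ _ _ g Y).
have [c ct E] := MVT t0 (fun x _ => Df x) cf.
exists c; first by move: ct; rewrite in_itv.
by move: E; rewrite /f scale0r addr0 subr0 mulrC.
Qed.

Lemma near_ball (x : V) (r : R) : 0 < r -> \forall p \near x, `|x - p| < r.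
Proof. by move=> r0; apply/nbhs_normP; exists r. Qed.

Lemma near0_lt (r : R) : 0 < r -> \forall t \near (0 : R), `|t| < r.
Proof.
move=> r0; have /cvgrPdist_lt /(_ _ r0) : (id t : R^o) @[t --> (0 : R)] --> (0 : R^o) by [].
by apply: filterS => t; rewrite /= sub0r normrN.
Qed.

(** The increment is a value of the derivative at a nearby point, by the mean value
   theorem; compactness makes the bound on [t] uniform. *)
Lemma uniform_increment (Y : V -> R^o) (v : V) (d L : R) : 0 < d ->
  (forall x, differentiable Y x) -> continuous ('D_v Y) ->
  \forall t \near (0 : R), 0 < t -> forall p, `|p| <= L ->
    t * ('D_v Y p - d) <= Y (p + t *: v) - Y p.
Proof.
move=> d0 dY cD.
pose P (t : R) (p : V) := 0 < t -> t * ('D_v Y p - d) <= Y (p + t *: v) - Y p.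
suff : \forall t \near (0 : R), [set p : V | `|p| <= L] `<=` P t.
  by apply: filterS => t Ht t0 p Hp; exact: (Ht p Hp t0).
have /compact_near_coveringP K := @closed_ball_compact L.
apply: (K R (nbhs (0 : R)) P _).
move=> x _.
have d20 : 0 < d / 2 by rewrite divr_gt0.
have /cvgrPdist_lt /(_ _ d20) /nbhs_normP [r /= r0 Hr] := cD x.
have r2 : 0 < r / 2 by rewrite divr_gt0.
have vp : 0 < `|v| + 1 by rewrite ltr_wpDl.
near=> p t => t0.
have [c /andP[c0 ct] ->] := dir_MVT p v t0 dY.
rewrite ler_pM2l //.
have px : `|x - p| < r / 2 by near: p; exact: (near_ball x r2).
have tr : `|t| < r / 2 / (`|v| + 1).
  by near: t; exact: (near0_lt (divr_gt0 r2 vp)).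
have cv : `|c *: v| < r / 2.
  rewrite normrZ (gtr0_norm c0); rewrite (gtr0_norm t0) ltr_pdivlMr // in tr.
  apply: le_lt_trans tr; rewrite ler_pM //; first exact: ltW.
    exact: ltW.
  by rewrite lerDl.
have H1 := Hr p _; have H2 := Hr (p + c *: v) _.
have {}H1 : `|'D_v Y x - 'D_v Y p| < d / 2 by apply: H1 => /=; lra.
have {}H2 : `|'D_v Y x - 'D_v Y (p + c *: v)| < d / 2.
  apply: H2 => /=; rewrite opprD addrA; apply: le_lt_trans (ler_normB _ _) _; lra.
move: H1 H2; rewrite !ltr_norml.
move: ('D_v Y x) ('D_v Y p) ('D_v Y _) => a b b' /andP[? ?] /andP[? ?]; lra.
Unshelve. all: by end_near. Qed.

Section Grid.
Variables (K : nat) (L : R).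

Definition grid_point (f : {ffun 'I_N -> 'I_K}) : V :=
  \col_j (- L + 2 * L / K%:R * (f j)%:R).

Definition grid_shift (j : 'I_N) (f : {ffun 'I_N -> 'I_K}) : {ffun 'I_N -> 'I_K} :=
  [ffun i => if i == j then ordS (f i) else f i].

Lemma grid_shift_inj j : injective (grid_shift j).
Proof.
move=> f g /ffunP fg; apply/ffunP => i; have := fg i.
by rewrite !ffunE; case: eqP => // _ /ordS_inj.
Qed.

Lemma grid_point_norm f : 0 < L -> `|grid_point f| <= L.
Proof.
move=> L0; apply: mx_norm_le_entry; first exact: ltW.
move=> j k; rewrite mxE ler_norml.
have K0 : 0 < K%:R :> R by rewrite ltr0n; exact: leq_ltn_trans (ltn_ord (f j)).
have fK : (f j)%:R <= K%:R :> R by rewrite ler_nat ltnW.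
have f0 : 0 <= (f j)%:R :> R by [].
have E : 2 * L / K%:R * (f j)%:R <= 2 * L.
  by rewrite mulrAC ler_pdivrMr // ler_pM2l // mulr_gt0.
have E0 : 0 <= 2 * L / K%:R * (f j)%:R.
  by rewrite !mulr_ge0 // ?invr_ge0 ltW.
by apply/andP; split; lra.
Qed.

(** Walking one step beyond the last grid point leaves the support just as
   wrapping around to the opposite face does, so that the sum of the increments
   of a function over the cyclic grid telescopes. *)
Lemma grid_telescope (Y : V -> R^o) j : 0 < L ->
  (forall p : V, L <= `|p| -> Y p = 0) ->
  \sum_f (Y (grid_point f + (2 * L / K%:R) *: e j) - Y (grid_point f)) = 0.
Proof.
move=> L0 Y0.
rewrite big_split /= sumrN; apply/eqP; rewrite subr_eq0; apply/eqP.
rewrite [RHS](reindex_inj (@grid_shift_inj j)) /=; apply: eq_bigr => f _.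
have K0 : (0 < K)%N by exact: leq_ltn_trans (ltn_ord (f j)).
have K0' : K%:R != 0 :> R by rewrite pnatr_eq0 -lt0n.
have big (p : V) : `|p j 0| = L -> Y p = 0.
  by move=> pL; apply: Y0; rewrite -pL; exact: mx_entry_le_norm.
have [fK|fK] := eqVneq (f j).+1 K.
  rewrite !big //.
    rewrite mxE /= ffunE eqxx /= fK modnn mulr0 addr0 normrN gtr0_norm //.
  rewrite !mxE eqxx mulr1 -addrA -[X in _ * _ + X]mulr1 -mulrDr -(natrD _ _ 1) addn1 fK.
  rewrite divfK // gtr0_norm; lra.
congr Y; apply/matrixP => i k; rewrite !mxE ffunE.
case: eqP => [->|_]; last by rewrite andFb mulr0 addr0.
rewrite ord1 eqxx mulr1 /= modn_small; last by have := ltn_ord (f j); move: fK => /eqP; lia.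
by rewrite -natr1; ring.
Qed.

End Grid.

(** Over a cyclic grid the increments of each [Y j] sum to zero, and by uniform
   convergence of the difference quotients they are almost the derivatives times
   the mesh; so the sum of the divergence over the grid is small compared with
   the number of grid points. But the points near [x0], a fixed proportion of
   all, each contribute at least half the divergence at [x0]. *)
Theorem no_positive_divergence (Y : 'I_N -> V -> R^o) B (x0 : V) :
  (forall j x, differentiable (Y j) x) ->
  (forall j, continuous ('D_(e j) (Y j))) ->
  (forall j (x : V), B < `|x| -> Y j x = 0) ->
  (forall x, 0 <= \sum_j 'D_(e j) (Y j) x) ->
  ~ 0 < \sum_j 'D_(e j) (Y j) x0.
Proof.
move=> dY cD Ysupp div_ge0.
pose G x : R := \sum_j 'D_(e j) (Y j) x.
rewrite -/(G x0) => c0; set c := G x0 in c0.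
have cG : {for x0, continuous (G : V -> R^o)}.
  apply: (@Ck_continuous _ _ _ 0 setT) => //.
  by apply: Ck_sum => [|j _]; [exact: openT|move=> x _; exact: cD].
have c20 : 0 < c / 2 by rewrite divr_gt0.
have /cvgrPdist_lt /(_ _ c20) /nbhs_normP [rho /= rho0 Hrho] := cG.
pose L := Num.max `|B| `|x0| + 1.
have LB : `|B| < L by rewrite /L ltr_pwDr // le_max lexx.
have Lx : `|x0| < L by rewrite /L ltr_pwDr // le_max lexx orbT.
have L0 : 0 < L by exact: le_lt_trans Lx.
have Ysupp' j (p : V) : L <= `|p| -> Y j p = 0.
  by move=> Lp; apply: Ysupp; rewrite (le_lt_trans (ler_norm _)) // (lt_le_trans LB).
(* The coarse mesh [s] is small enough for the divergence to stay above [c / 2]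
   in the coarse cell of [x0]. *)
pose m := (Num.truncn (2 * L / rho)).+1.
have m0 : 0 < m%:R :> R by rewrite ltr0n.
pose s := 2 * L / m%:R.
have s0 : 0 < s by rewrite !mulr_gt0 // invr_gt0.
have s_rho : s < rho.
  by rewrite /s ltr_pdivrMr // [rho * _]mulrC -ltr_pdivrMr // truncnS_gt.
(* The error [d] allowed in the difference quotients depends on the coarse mesh
   only; the fine mesh [t] is chosen after it. *)
pose d := c / (4 * (m ^ N)%N%:R * N.+1%:R).
have mN0 : 0 < (m ^ N)%N%:R :> R by rewrite ltr0n expn_gt0.
have N0 : 0 < N.+1%:R :> R by rewrite ltr0n.
have d0 : 0 < d by rewrite divr_gt0 // !mulr_gt0.
have [t0 t00 Ht] : exists2 t0, 0 < t0 & forall t, 0 < t < t0 -> forall p : V, `|p| <= L ->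
    forall j, t * ('D_(e j) (Y j) p - d) <= Y j (p + t *: e j) - Y j p.
  have H : \forall t \near (0 : R), forall j, 0 < t -> forall p : V, `|p| <= L ->
      t * ('D_(e j) (Y j) p - d) <= Y j (p + t *: e j) - Y j p.
    apply: (@filter_forall R 'I_N _ (nbhs (0 : R))) => j.
    exact: uniform_increment.
  have /nbhs_normP [t0 /= t00 Ht] := H.
  exists t0 => // t /andP[tp tt] p Hp j.
  by apply: Ht => //=; rewrite sub0r normrN gtr0_norm.
pose k := (Num.truncn (s / t0)).+1.
have k0 : 0 < k%:R :> R by rewrite ltr0n.
pose t := 2 * L / (m * k)%:R.
have ts : t = s / k%:R by rewrite /t /s natrM; field; rewrite !gt_eqF.
have tp : 0 < t by rewrite ts divr_gt0.
have tt : t < t0 by rewrite ts ltr_pdivrMr // [t0 * _]mulrC -ltr_pdivrMr // truncnS_gt.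
pose gp := @grid_point (m * k) L.
have S0 : \sum_f \sum_j (Y j (gp f + t *: e j) - Y j (gp f)) = 0.
  rewrite exchange_big big1 //= => j _.
  by rewrite grid_telescope // => p; exact: Ysupp'.
have S1 : \sum_f (G (gp f) - N%:R * d) <= 0.
  rewrite -(pmulr_rle0 _ tp) mulr_sumr -[leRHS]S0; apply: ler_sum => f _.
  rewrite mulrBr /G /= mulr_sumr.
  have -> : t * (N%:R * d) = \sum_(j < N) t * d.
    by rewrite sumr_const card_ord -[RHS]mulr_natl; ring.
  rewrite -sumrB; apply: ler_sum => j _; rewrite -mulrBr.
  by apply: Ht; [rewrite tp tt|exact: grid_point_norm].
(* The fine grid points in the coarse cell of [x0]. *)
have cell j : exists a : 'I_m, a%:R * s <= x0 j 0 + L < a.+1%:R * s.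
  have xj := mx_entry_le_norm x0 j 0.
  have y0 : 0 <= (x0 j 0 + L) / s.
    rewrite divr_ge0 ?(ltW s0) //; move: (le_lt_trans xj Lx); rewrite ltr_norml => /andP[]; lra.
  have am : (Num.truncn ((x0 j 0 + L) / s)%R < m)%N.
    rewrite truncn_lt_nat // ltr_pdivrMr // /s mulrC divfK ?gt_eqF //.
    move: (le_lt_trans xj Lx); rewrite ltr_norml => /andP[]; lra.
  exists (Ordinal am) => /=.
  by rewrite -ler_pdivlMr // -ltr_pdivrMr // truncn_itv.
have [a Ha] := choice cell.
have fineP j (b : 'I_k) : (a j * k + b < m * k)%N.
  rewrite (@leq_trans ((a j).+1 * k)) ?leq_mul2r ?ltn_ord ?orbT //.
  by rewrite mulSn addnC ltn_add2r.
pose h (b : {ffun 'I_N -> 'I_k}) : {ffun 'I_N -> 'I_(m * k)} :=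
  [ffun j => Ordinal (fineP j (b j))].
have h_inj : injective h.
  move=> b b' /ffunP bb; apply/ffunP => j; apply: val_inj.
  by have /(congr1 val) := bb j; rewrite !ffunE /= => /addnI.
have Gh b : c / 2 <= G (gp (h b)).
  have hx : `|x0 - gp (h b)| <= s.
    apply: mx_norm_le_entry; first exact: ltW.
    move=> j i; rewrite !mxE ord1 ffunE /= -/t ts natrD natrM.
    have -> : x0 j 0 - (- L + s / k%:R * ((a j)%:R * k%:R + (b j)%:R)) =
       (x0 j 0 + L - (a j)%:R * s) - s * ((b j)%:R / k%:R).
      by field; rewrite gt_eqF.
    have /andP[A1 A2] := Ha j.
    have b1 : s * ((b j)%:R / k%:R) <= s.
      by rewrite ler_piMr ?(ltW s0) // ler_pdivrMr // mul1r ler_nat ltnW.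
    have b2 : 0 <= s * ((b j)%:R / k%:R) by rewrite !mulr_ge0 // ?invr_ge0 ltW.
    move: A2; rewrite -natr1 mulrDl mul1r => A2.
    by rewrite ler_norml; apply/andP; split; lra.
  have := Hrho _ (le_lt_trans hx s_rho).
  by rewrite -/c => /= /(le_lt_trans (ler_norm _)); lra.
have S2 : (k ^ N)%:R * (c / 2) <= \sum_f G (gp f).
  rewrite (bigID (mem (h @: [set: {ffun 'I_N -> 'I_k}]%SET))) /=.
  rewrite -[leLHS]addr0 lerD //; last first.
    by apply: sumr_ge0 => f _; exact: div_ge0.
  rewrite big_imset /=; last by move=> ? ? _ _; exact: h_inj.
  have -> : (k ^ N)%:R * (c / 2) = \sum_(b in [set: {ffun 'I_N -> 'I_k}]%SET) (c / 2).
    by rewrite sumr_const cardsT card_ffun !card_ord mulr_natl.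
  by apply: ler_sum.
move: S1; rewrite sumrB sumr_const card_ffun !card_ord -[_ *+ _]mulr_natl subr_le0 => S1.
have E : ((m * k) ^ N)%N%:R = (m ^ N)%N%:R * (k ^ N)%N%:R :> R.
  by rewrite expnMn natrM.
have := le_trans S2 S1; rewrite E.
have -> : (m ^ N)%:R * (k ^ N)%:R * (N%:R * d) = (k ^ N)%:R * ((m ^ N)%:R * N%:R * d) by ring.
rewrite ler_pM2l; last by rewrite ltr0n expn_gt0.
rewrite /d.
have -> : (m ^ N)%:R * N%:R * (c / (4 * (m ^ N)%:R * N.+1%:R)) = c / 4 * (N%:R / N.+1%:R).
  by field; rewrite !gt_eqF.
have : N%:R / N.+1%:R <= 1 :> R by rewrite ler_pdivrMr // mul1r ler_nat.
move=> q1 cq; have : c / 4 * (N%:R / N.+1%:R) <= c / 4 by rewrite ler_piMr // divr_ge0 // ltW.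
by move=> /(le_trans cq); rewrite ler_pM2l // lef_pV2 ?posrE // ler_nat.
Qed.
End GridSums.

(** * Clifford systems and the focal submanifold *)

Section DotProduct.
Variables (R : realType) (N : nat).
Local Notation V := 'cV[R]_N.
Implicit Types (x y z : V) (A : 'M[R]_N).

Lemma dotE x y : dot x y = (x^T *m y) 0 0.
Proof. by rewrite mxE; apply: eq_bigr => i _; rewrite mxE. Qed.

Lemma dotC x y : dot x y = dot y x.
Proof. by apply: eq_bigr => i _; rewrite mulrC. Qed.

Lemma dotDl x y z : dot (x + y) z = dot x z + dot y z.
Proof. by rewrite !dotE linearD mulmxDl mxE. Qed.

Lemma dotZl c x y : dot (c *: x) y = c * dot x y.
Proof. by rewrite !dotE linearZ -scalemxAl mxE. Qed.

Lemma dotNl x y : dot (- x) y = - dot x y.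
Proof. by rewrite -scaleN1r dotZl mulN1r. Qed.

Lemma dotDr x y z : dot x (y + z) = dot x y + dot x z.
Proof. by rewrite !(dotC x) dotDl. Qed.

Lemma dotZr c x y : dot x (c *: y) = c * dot x y.
Proof. by rewrite !(dotC x) dotZl. Qed.

Lemma dotNr x y : dot x (- y) = - dot x y.
Proof. by rewrite !(dotC x) dotNl. Qed.

Lemma dot0l x : dot 0 x = 0.
Proof. by rewrite -(scale0r 0) dotZl mul0r. Qed.

Lemma dot0r x : dot x 0 = 0.
Proof. by rewrite dotC dot0l. Qed.

Lemma dot_suml I (r : seq I) (P : pred I) (F : I -> V) y :
  dot (\sum_(i <- r | P i) F i) y = \sum_(i <- r | P i) dot (F i) y.
Proof. by elim/big_rec2: _ => [|i s t _ <-]; rewrite ?dot0l ?dotDl. Qed.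

Lemma dot_sumr I (r : seq I) (P : pred I) (F : I -> V) y :
  dot y (\sum_(i <- r | P i) F i) = \sum_(i <- r | P i) dot y (F i).
Proof. by rewrite dotC dot_suml; apply: eq_bigr => i _; rewrite dotC. Qed.

Lemma dot_mull A x y : dot (A *m x) y = dot x (A^T *m y).
Proof. by rewrite !dotE trmx_mul mulmxA. Qed.

Lemma dot_ge0 x : 0 <= dot x x.
Proof. by apply: sumr_ge0 => i _; rewrite -expr2 sqr_ge0. Qed.

Lemma dot_eq0 x : (dot x x == 0) = (x == 0).
Proof.
apply/idP/eqP => [|->]; last by rewrite dot0l.
rewrite psumr_eq0; last by move=> i _; rewrite -expr2 sqr_ge0.
move=> /allP H; apply/matrixP => i j; rewrite ord1 mxE.
have := H i; rewrite mem_index_enum => /(_ isT).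
by rewrite -expr2 sqrf_eq0 => /eqP.
Qed.

Lemma dot_gt0 x : x != 0 -> 0 < dot x x.
Proof. by move=> x0; rewrite lt_neqAle dot_ge0 eq_sym dot_eq0 x0. Qed.

End DotProduct.

Section CkDot.
Variables (R : realType) (N : nat) (X : normedModType R) (k : nat) (U : set X).
Hypothesis oU : open U.
Implicit Types (Y Z : X -> 'cV[R]_N).

Definition Ck_entries Y := forall j, Ck k U (fun x => Y x j 0 : R^o).

Lemma Ck_mulmx (A : 'M[R]_N) Y : Ck_entries Y -> Ck_entries (fun x => A *m Y x).
Proof.
move=> CY j.
have : Ck k U (fun x => \sum_i A j i * Y x i 0 : R^o).
  by apply: Ck_sum => // i _; apply: CkM => //; exact: Ck_cst.
by apply: Ck_ext => // x _; rewrite mxE.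
Qed.

Lemma Ck_dot Y Z : Ck_entries Y -> Ck_entries Z -> Ck k U (fun x => dot (Y x) (Z x) : R^o).
Proof.
by move=> CY CZ; apply: Ck_sum => // i _; exact: CkM.
Qed.

Lemma Ck_entriesD Y Z : Ck_entries Y -> Ck_entries Z -> Ck_entries (fun x => Y x + Z x).
Proof.
move=> CY CZ j; have := CkD oU (CY j) (CZ j).
by apply: Ck_ext => // x _; rewrite mxE.
Qed.

Lemma Ck_entriesZ (f : X -> R^o) Y : Ck k U f -> Ck_entries Y ->
  Ck_entries (fun x => f x *: Y x).
Proof.
move=> Cf CY j; have := CkM oU Cf (CY j).
by apply: Ck_ext => // x _; rewrite mxE.
Qed.

Lemma Ck_entries_cst v : Ck_entries (fun=> v).
Proof. by move=> j; exact: Ck_cst. Qed.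

Lemma Ck_entries_sum (I : Type) (r : seq I) (F : I -> X -> 'cV[R]_N) :
  (forall i, Ck_entries (F i)) -> Ck_entries (fun x => \sum_(i <- r) F i x).
Proof.
move=> CF j.
have : Ck k U (fun x => \sum_(i <- r) F i x j 0 : R^o).
  by apply: Ck_sum => // i _; exact: CF.
by apply: Ck_ext => // x _; rewrite summxE.
Qed.

End CkDot.

Section DerivativeOfForms.
Variables (R : realType) (N : nat) (A : 'M[R]_N) (y v : 'cV[R]_N).

Lemma is_derive_coord (j : 'I_N) :
  is_derive y v (fun y : 'cV[R]_N => y j 0 : R^o) (v j 0).
Proof.
apply: DeriveDef; first exact/diff_derivable/differentiable_coord.
by rewrite (@derive_coord _ _ _ id) // derive_id.
Qed.

Lemma is_derive_mulmx (j : 'I_N) :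
  is_derive y v (fun y : 'cV[R]_N => (A *m y) j 0 : R^o) ((A *m v) j 0).
Proof.
rewrite [X in is_derive _ _ X](_ : _ = \sum_i (A j i *: (fun y : 'cV[R]_N => y i 0 : R^o)));
  last first.
  by apply/funext => z; rewrite mxE fct_sumE.
rewrite mxE; apply: is_derive_fsum => i.
exact: is_deriveZ (is_derive_coord i).
Qed.

Lemma is_derive_linear_form (w : 'cV[R]_N) :
  is_derive y v (fun y => dot (A *m y) w : R^o) (dot (A *m v) w).
Proof.
rewrite [X in is_derive _ _ X](_ : _ = \sum_i (w i 0 *: (fun y : 'cV[R]_N => (A *m y) i 0 :
  R^o))); last first.
  by apply/funext => z; rewrite fct_sumE; apply: eq_bigr => i _; rewrite mulrC.
rewrite /dot; under [X in is_derive _ _ _ X]eq_bigr do rewrite mulrC.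
apply: is_derive_fsum => i.
exact: is_deriveZ (is_derive_mulmx i).
Qed.

Lemma is_derive_quadratic_form : A^T = A ->
  is_derive y v (fun y => dot (A *m y) y : R^o) (2 * dot (A *m y) v).
Proof.
move=> sA.
rewrite [X in is_derive _ _ X](_ : _ = \sum_i ((fun y : 'cV[R]_N => (A *m y) i 0 : R^o) * (fun y
  : 'cV[R]_N => y i 0 : R^o))); last first.
  by apply/funext => z; rewrite fct_sumE.
have -> : 2 * dot (A *m y) v = \sum_i ((A *m y) i 0 *: v i 0 + y i 0 *: (A *m v) i 0).
  rewrite big_split /= -/(dot (A *m y) v) -/(dot y (A *m v)).
  by rewrite -[in dot y _]sA -dot_mull mulr_natl.
apply: is_derive_fsum => i.
exact: is_deriveM (is_derive_mulmx i) (is_derive_coord i).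
Qed.

End DerivativeOfForms.

Lemma mx_double_inj (R : realType) (m n : nat) (A B : 'M[R]_(m, n)) :
  A + A = B + B -> A = B.
Proof.
move=> AB; have n2 : 2%:R != 0 :> R by rewrite pnatr_eq0.
by apply: (scalerI n2); rewrite !scaler_nat !mulr2n.
Qed.

Section Clifford.
Variables (R : realType) (N m : nat) (P : 'I_m.+1 -> 'M[R]_N).
Local Notation V := 'cV[R]_N.

(** Systems of matrices in any dimension [N], which can then be split into the
   codimension and the dimension of the focal submanifold. *)
Definition clifford := (forall i, (P i)^T = P i) /\
  (forall i j, P i *m P j + P j *m P i = (2 * (i == j)%:R)%:M).

Definition focal : set V := [set x | dot x x = 1 /\ forall i, dot (P i *m x) x = 0].

Hypothesis cP : clifford.

Lemma clifford_sym i : (P i)^T = P i. Proof. exact: cP.1. Qed.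

Lemma dot_clifford i x y : dot (P i *m x) y = dot x (P i *m y).
Proof. by rewrite dot_mull clifford_sym. Qed.

Lemma clifford_sq i : P i *m P i = 1%:M.
Proof.
apply: mx_double_inj; rewrite cP.2 eqxx mulr1 -raddfD /=; congr (_%:M); ring.
Qed.

Lemma clifford_anti i j : i != j -> P i *m P j = - (P j *m P i).
Proof.
move=> /negbTE ij; have := cP.2 i j; rewrite ij mulr0 => /eqP.
by rewrite raddf0 addr_eq0 => /eqP.
Qed.

Lemma clifford_dot i j x : dot (P i *m x) (P j *m x) = (i == j)%:R * dot x x.
Proof.
have [->|ij] := eqVneq i j; first by rewrite -dot_clifford mulmxA clifford_sq mul1mx mul1r.
apply/eqP; rewrite mul0r; have : dot (P i *m x) (P j *m x) = - dot (P i *m x) (P j *m x).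
  rewrite -{1}dot_clifford mulmxA clifford_anti 1?eq_sym // mulNmx dotNl -mulmxA.
  by rewrite dot_clifford dotC.
by move=> /eqP; rewrite -addr_eq0 -mulr2n mulrn_eq0.
Qed.

Section Combination.
Variable c : 'I_m.+1 -> R.
Local Notation H := (\sum_i c i *: P i).

Lemma clifford_comb_sym x y : dot (H *m x) y = dot x (H *m y).
Proof.
rewrite dot_mull; congr (dot x (_ *m y)); rewrite linear_sum /=.
by apply: eq_bigr => i _; rewrite linearZ /= clifford_sym.
Qed.

Lemma clifford_comb_anti j : H *m P j + P j *m H = (2 * c j)%:M.
Proof.
rewrite mulmx_suml mulmx_sumr -big_split /= (bigD1 j) //= big1 ?addr0.
  rewrite -scalemxAl -scalemxAr -scalerDr cP.2 eqxx mulr1 scale_scalar_mx; congr (_%:M); ring.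
move=> i ij; rewrite -scalemxAl -scalemxAr -scalerDr cP.2 (negbTE ij) mulr0.
by rewrite raddf0 scaler0.
Qed.

Lemma clifford_comb_sq : H *m H = (\sum_i c i ^+ 2)%:M.
Proof.
apply: mx_double_inj; rewrite {1 4}[H]lock {1}mulmx_sumr mulmx_suml -big_split /=.
rewrite -raddfD -big_split raddf_sum /=; apply: eq_bigr => j _.
rewrite -scalemxAr -scalemxAl -scalerDr -lock clifford_comb_anti scale_scalar_mx.
congr (_%:M); ring.
Qed.

End Combination.

Definition quad i (y : V) : R := dot (P i *m y) y.
Definition disc (y : V) : R := (dot y y) ^+ 2 - \sum_i quad i y ^+ 2.

(** For the linear maps [a - H], [H] in the span of the Clifford system, the
   values of the quadratic forms [dot y y] and [quad i y] transform, up to a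
   factor, by a Lorentz transformation; this choice of [a] and [H] takes a
   vector with time-like value to the focal submanifold. *)
Definition retraction (y : V) : V :=
  (Num.sqrt (2 * (dot y y + Num.sqrt (disc y)) * disc y))^-1 *:
  ((dot y y + Num.sqrt (disc y)) *: y - (\sum_i quad i y *: P i) *m y).

Lemma dot_comb y : dot ((\sum_i quad i y *: P i) *m y) y = \sum_i quad i y ^+ 2.
Proof.
rewrite mulmx_suml dot_suml; apply: eq_bigr => i _.
by rewrite -scalemxAl dotZl expr2.
Qed.

Lemma retraction_pos y : 0 < disc y -> 0 < dot y y /\
  0 < 2 * (dot y y + Num.sqrt (disc y)) * disc y.
Proof.
move=> D0.
have y0 : 0 < dot y y.
  rewrite lt_neqAle dot_ge0 andbT eq_sym; apply: contraL D0 => /eqP y0.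
  rewrite /disc y0 expr0n /= sub0r -leNgt oppr_le0.
  by apply: sumr_ge0 => i _; exact: sqr_ge0.
by split => //; rewrite !mulr_gt0 // addr_gt0 // sqrtr_gt0.
Qed.

Lemma focal_retraction y : 0 < disc y -> focal (retraction y).
Proof.
move=> D0; have [y0 T0] := retraction_pos D0.
rewrite /retraction; pose a := dot y y + Num.sqrt (disc y).
pose T := 2 * a * disc y; rewrite -/a -/T; rewrite -/a -/T in T0.
set H := \sum_i _ *: _; set z := a *: y - H *m y.
pose s := \sum_i quad i y ^+ 2.
have HH : H *m H = s%:M by exact: clifford_comb_sq.
have Hs x w : dot (H *m x) w = dot x (H *m w) by exact: clifford_comb_sym.
have Hy : dot (H *m y) y = s by exact: dot_comb.
have aE : a ^+ 2 - 2 * a * dot y y + s = 0.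
  have := sqr_sqrtr (ltW D0); rewrite /a; move: (Num.sqrt _) => d dE.
  have -> : s = dot y y ^+ 2 - d ^+ 2 by rewrite dE /disc /s; ring.
  ring.
have DE : disc y = dot y y ^+ 2 - s by [].
have sT : Num.sqrt T ^+ 2 = T by rewrite sqr_sqrtr // ltW.
have sT0 : Num.sqrt T != 0 by rewrite gt_eqF // sqrtr_gt0.
have zz : dot z z = T.
  rewrite /z dotDl !dotDr !dotNl !dotNr !dotZl !dotZr opprK.
  rewrite (dotC y (H *m y)) Hy Hs mulmxA HH mul_scalar_mx dotZr.
  have -> : T = a * (2 * dot y y ^+ 2 - 2 * s) by rewrite /T DE; ring.
  have -> : a * (a * dot y y) = a ^+ 2 * dot y y by ring.
  have -> : a ^+ 2 = 2 * a * dot y y - s by rewrite -[LHS]subr0 -aE; ring.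
  ring.
have sq (w : V) : dot ((Num.sqrt T)^-1 *: w) ((Num.sqrt T)^-1 *: w) = T^-1 * dot w w.
  by rewrite dotZl dotZr mulrA -invfM -expr2 sT.
split; first by rewrite sq zz mulVf // gt_eqF.
move=> j; rewrite -scalemxAr dotZl dotZr mulrA -invfM -expr2 sT.
suff -> : dot (P j *m z) z = 0 by rewrite mulr0.
have PjH : dot (P j *m (H *m y)) y = quad j y * dot y y.
  rewrite dot_clifford /H mulmx_suml dot_suml (bigD1 j) //= big1 ?addr0.
    by rewrite -scalemxAl dotZl clifford_dot eqxx mul1r.
  by move=> i /negbTE ij; rewrite -scalemxAl dotZl clifford_dot ij mul0r mulr0.
have HPH : dot (P j *m (H *m y)) (H *m y) = s * quad j y.
  rewrite -Hs !mulmxA.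
  have -> : H *m P j = (2 * quad j y)%:M - P j *m H.
    by rewrite -[X in X - _](clifford_comb_anti (fun i => quad i y) j) addrK.
  rewrite mulmxBl mulmxBl mul_scalar_mx -!mulmxA [H *m (H *m y)]mulmxA HH mul_scalar_mx.
  rewrite -!scalemxAl -scalemxAr dotDl dotNl !dotZl Hy -/(quad j y); ring.
rewrite /z mulmxBr dotDl !dotDr !dotNl !dotNr -!scalemxAr !dotZl !dotZr opprK.
rewrite -/(quad j y) HPH PjH (dotC _ (H *m y)) -dot_clifford (dotC (P j *m _)).
rewrite (dotC y) PjH.
have -> : a * (a * quad j y) = a ^+ 2 * quad j y by ring.
have -> : a ^+ 2 = 2 * a * dot y y - s by rewrite -[LHS]subr0 -aE; ring.
ring.
Qed.

End Clifford.

Section CliffordAction.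
Variables (R : realType) (N m : nat) (P : 'I_m.+1 -> 'M[R]_N).
Hypothesis cP : clifford P.

Lemma clifford_sqv i (v : 'cV[R]_N) : P i *m (P i *m v) = v.
Proof. by rewrite mulmxA clifford_sq // mul1mx. Qed.

Lemma clifford_antiv i j (v : 'cV[R]_N) : i != j ->
  P i *m (P j *m v) = - (P j *m (P i *m v)).
Proof. by move=> ij; rewrite mulmxA clifford_anti // mulNmx mulmxA. Qed.

Lemma clifford_mul_skew i j : i != j -> (P i *m P j)^T = - (P i *m P j).
Proof. by move=> ij; rewrite trmx_mul !(clifford_sym cP) (clifford_anti cP ij) opprK. Qed.

End CliffordAction.

Section Retraction.
Variables (R : realType) (N m : nat) (P : 'I_m.+1 -> 'M[R]_N).
Local Notation V := 'cV[R]_N.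
Hypothesis cP : clifford P.

Lemma focal_disc x : focal P x -> disc P x = 1.
Proof.
move=> [x1 Px]; rewrite /disc x1 expr1n big1 ?subr0 // => i _.
by rewrite /quad Px expr0n.
Qed.

Lemma retraction_id x : focal P x -> retraction P x = x.
Proof.
move=> fx; have [x1 Px] := fx; rewrite /retraction focal_disc // x1 sqrtr1 mulr1.
rewrite big1 ?mul0mx ?subr0; last by move=> i _; rewrite /quad Px scale0r.
have -> : 2 * (1 + 1) = 2 ^+ 2 :> R by ring.
rewrite sqrtr_sqr ger0_norm // scalerA -[1 + 1]/(2 : R) mulVf ?scale1r //.
Qed.

Lemma Ck_disc (X : normedModType R) k (U : set X) (Y : X -> V) : open U ->
  Ck_entries k U Y -> Ck k U (fun x => disc P (Y x) : R^o).
Proof.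
move=> oU CY; apply: CkD => //.
  by apply: CkM => //; exact: Ck_dot.
apply: CkN => //; apply: Ck_sum => // i _; apply: CkM => //.
all: by apply: Ck_dot => //; exact: Ck_mulmx.
Qed.

Lemma Ck_retraction (X : normedModType R) k (U : set X) (Y : X -> V) : open U ->
  Ck_entries k U Y -> (forall x, U x -> 0 < disc P (Y x)) ->
  Ck_entries k U (fun x => retraction P (Y x)).
Proof.
move=> oU CY D0.
have Cd := Ck_disc oU CY.
have Ca : Ck k U (fun x => dot (Y x) (Y x) + Num.sqrt (disc P (Y x)) : R^o).
  by apply: CkD => //; [exact: Ck_dot|exact: Ck_sqrt].
apply: Ck_entriesZ => //.
  apply: CkV => //; first by move=> x /D0/retraction_pos[_ ?]; rewrite gt_eqF // sqrtr_gt0.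
  apply: Ck_sqrt => //; first by move=> x /D0/retraction_pos[_ ?].
  by apply: CkM => //; apply: CkM => //; exact: Ck_cst.
apply: Ck_entriesD => //; first exact: Ck_entriesZ.
have : Ck_entries k U (fun x => \sum_i (- quad P i (Y x)) *: (P i *m Y x)).
  apply: Ck_entries_sum => // i; apply: Ck_entriesZ => //; last exact: Ck_mulmx.
  by apply: CkN => //; apply: Ck_dot => //; exact: Ck_mulmx.
move=> H j; apply: Ck_ext (H j) => // x _; congr (fun_of_matrix _ j 0).
rewrite mulmx_suml -sumrN; apply: eq_bigr => i _.
by rewrite -scalemxAl scaleNr.
Qed.

Lemma open_Ck_pos (X : normedModType R) (f : X -> R^o) :
  Ck 0 setT f -> open [set x | 0 < f x].
Proof.
move=> Cf; apply: (@open_comp _ _ f [set y | 0 < y]); last exact: open_gt.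
by move=> x _; exact: Cf.
Qed.

Lemma Ck_entries_id k (U : set V) : Ck_entries k U id.
Proof. by move=> j; exact: Ck_mx_entry. Qed.

Lemma open_disc_pos : open [set y : V | 0 < disc P y].
Proof. by apply: open_Ck_pos; apply: Ck_disc; [exact: openT|exact: Ck_entries_id]. Qed.

Lemma is_derive0_sqrt (X : normedModType R) (f : X -> R^o) x v :
  differentiable f x -> 0 < f x -> is_derive x v f 0 ->
  is_derive x v (fun y => Num.sqrt (f y) : R^o) 0.
Proof.
move=> df f0 [_ D0].
have ds : differentiable (Num.sqrt : R^o -> R^o) (f x).
  by apply/derivable1_diffP; have [] := is_derive1_sqrt f0.
apply: DeriveDef; first by apply: diff_derivable; exact: differentiable_comp.
by rewrite [LHS](derive_comp _ df ds) D0 derive0.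
Qed.

Lemma is_derive_dot (y v : V) :
  is_derive y v (fun y => dot y y : R^o) (2 * dot y v).
Proof.
have := is_derive_quadratic_form y v (trmx1 R N); rewrite mul1mx.
by rewrite [X in is_derive _ _ X](_ : _ = (fun y => dot y y : R^o)) //; apply/funext => z;
  rewrite mul1mx.
Qed.

(** The retraction is tangentially the identity: the quadratic forms, hence all
   scalar coefficients of the retraction, are stationary at a focal point. *)
Lemma is_derive_retraction x v j : focal P x -> dot x v = 0 ->
  (forall i, dot (P i *m x) v = 0) ->
  is_derive x v (fun y => retraction P y j 0 : R^o) (v j 0).
Proof.
move=> fx xv Pxv; have [x1 Px] := fx.
have Dn : is_derive x v (fun y => dot y y : R^o) 0.
  by have := is_derive_dot x v; rewrite xv mulr0.
have Dq i : is_derive x v (fun y => quad P i y : R^o) 0.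
  have := is_derive_quadratic_form x v (clifford_sym cP i).
  by rewrite Pxv mulr0.
have DM (f g : V -> R^o) : is_derive x v f 0 -> is_derive x v g 0 ->
    is_derive x v (fun y => f y * g y : R^o) 0.
  move=> Df Dg; rewrite -[X in is_derive _ _ X]/(f * g).
  by apply: is_derive_eq; rewrite !scaler0 addr0.
have Dd : is_derive x v (fun y => disc P y : R^o) 0.
  have D2 : is_derive x v (fun y => \sum_i quad P i y ^+ 2 : R^o) 0.
    rewrite [X in is_derive _ _ X](_ : _ = \sum_i (fun y => quad P i y * quad P i y : R^o)).
      by have := is_derive_fsum (index_enum _) (fun i => DM _ _ (Dq i) (Dq i));
        rewrite [X in is_derive _ _ _ X]big1.
    by apply/funext => y; rewrite fct_sumE.
  have D1 := DM _ _ Dn Dn.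
  rewrite -[X in is_derive _ _ X]/((fun y => dot y y * dot y y : R^o) - (fun y => \sum_i quad P i
    y ^+ 2 : R^o)).
  by apply: is_derive_eq; rewrite subr0.
have d1 : disc P x = 1 by exact: focal_disc.
have dd : differentiable (fun y => disc P y : R^o) x.
  by have [H _] := @Ck_disc _ 1 setT id openT (@Ck_entries_id 1 setT); exact: H.
have Ds : is_derive x v (fun y => Num.sqrt (disc P y) : R^o) 0.
  by apply: is_derive0_sqrt => //; rewrite d1.
have Da : is_derive x v (fun y => dot y y + Num.sqrt (disc P y) : R^o) 0.
  rewrite -[X in is_derive _ _ X]/((fun y => dot y y : R^o) + (fun y => Num.sqrt (disc P y) : R^o)).
  by have := is_deriveD Dn Ds; rewrite addr0.
pose T y := 2 * (dot y y + Num.sqrt (disc P y)) * disc P y.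
have DT : is_derive x v (T : V -> R^o) 0.
  exact: DM (DM (cst (2 : R^o)) _ (is_derive_cst _ _ _) Da) Dd.
have Cs : Ck 1 [set y : V | 0 < disc P y] (fun y => disc P y : R^o).
  by apply: Ck_disc; [exact: open_disc_pos|exact: Ck_entries_id].
have dT : differentiable (T : V -> R^o) x.
  have oD := open_disc_pos.
  have Cn : Ck 1 [set y : V | 0 < disc P y] (fun y => dot y y : R^o).
    exact: (Ck_dot oD (@Ck_entries_id 1 _) (@Ck_entries_id 1 _)).
  have Ca := CkD oD Cn (Ck_sqrt oD (fun x => id) Cs).
  have [H _] := CkM oD (CkM oD (Ck_cst 1 _ (2 : R^o)) Ca) Cs.
  by apply: H; rewrite /= d1.
have Tx : T x = 4 by rewrite /T d1 x1 sqrtr1; ring.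
have sx : Num.sqrt (T x) = 2.
  have -> : T x = 2 ^+ 2 by rewrite Tx; ring.
  by rewrite sqrtr_sqr ger0_norm.
have DsT : is_derive x v (fun y => (Num.sqrt (T y))^-1 : R^o) 0.
  have H : is_derive x v (fun y => Num.sqrt (T y) : R^o) 0.
    by apply: is_derive0_sqrt => //; rewrite Tx.
  have n0 : Num.sqrt (T x) != 0 by rewrite sx pnatr_eq0.
  apply: DeriveDef; first exact: derivableV.
  by rewrite deriveV // derive_val scaler0.
have Db : is_derive x v (fun y => (dot y y + Num.sqrt (disc P y)) * y j 0
     - \sum_i quad P i y * (P i *m y) j 0 : R^o) (2 * v j 0).
  have D1 : is_derive x v (fun y => (dot y y + Num.sqrt (disc P y)) * y j 0 : R^o) (2 * v j 0).
    have := is_deriveM Da (is_derive_coord x v j).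
    rewrite scaler0 addr0 x1 d1 sqrtr1.
    exact.
  have D2 : is_derive x v (fun y => \sum_i quad P i y * (P i *m y) j 0 : R^o) 0.
    rewrite [X in is_derive _ _ X](_ : _ = \sum_i (fun y => quad P i y * (P i *m y) j 0 : R^o));
      last first.
      by apply/funext => y; rewrite fct_sumE.
    have H i : is_derive x v (fun y => quad P i y * (P i *m y) j 0 : R^o) 0.
      have := is_deriveM (Dq i) (is_derive_mulmx (P i) x v j).
      by rewrite scaler0 addr0 [quad P i x]Px scale0r.
    by have := is_derive_fsum (index_enum _) H; rewrite [X in is_derive _ _ _ X]big1.
  have := is_deriveB D1 D2; rewrite subr0; exact.
have := is_deriveM DsT Db; rewrite scaler0 addr0 sx.
rewrite [_ *: _](_ : _ = v j 0); last first.
  by rewrite /GRing.scale /= mulrA mulVf ?mul1r // pnatr_eq0.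
congr (is_derive _ _ _ _); apply/funext => y.
rewrite /retraction [RHS]mxE [X in _ = _ * X]mxE [X in _ = _ * (X + _)]mxE.
rewrite [X in _ = _ * (_ + X)]mxE mulmx_suml summxE.
rewrite (_ : \sum_i (quad P i y *: P i *m y) j 0 = \sum_i quad P i y * (P i *m y) j 0) //.
by apply: eq_bigr => i _; rewrite -scalemxAl mxE.
Qed.

End Retraction.

Lemma exists_ker_orth (R : realType) (N k : nat) (A : 'M[R]_N) (a : 'I_k -> 'cV[R]_N) :
  (\rank A + k < N)%N ->
  exists v, [/\ v != 0, A *m v = 0 & forall i, dot (a i) v = 0].
Proof.
move=> rk; pose B := col_mx A (\matrix_(i < k) (a i)^T).
have rB : (\rank B < N)%N.
  apply: leq_ltn_trans rk; rewrite /B -addsmxE.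
  apply: leq_trans (mxrank_adds_leqif _ _) _.
  by rewrite leq_add2l rank_leq_row.
have kB : kermx B^T != 0.
  by rewrite -mxrank_eq0 mxrank_ker mxrank_tr subn_eq0 -ltnNge.
have [i /= ki] : exists i, row i (kermx B^T) != 0.
  apply/existsP; rewrite -negb_forall; apply: contra kB => /forallP H.
  by apply/eqP/row_matrixP => i; rewrite row0; apply/eqP.
set u := row i _ in ki.
have uB : u *m B^T = 0 by apply/sub_kermxP; exact: row_sub.
have Bu : B *m u^T = 0 by rewrite -[B]trmxK -trmx_mul uB trmx0.
move: Bu; rewrite /B mul_col_mx => /eqP; rewrite col_mx_eq0 => /andP[/eqP Au /eqP au].
exists u^T; split => //.
  by apply: contra ki => /eqP u0; rewrite -[u]trmxK u0 trmx0.
move=> j; have /matrixP /(_ j 0) := au; rewrite !mxE => <-.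
by apply: eq_bigr => c _; rewrite !mxE.
Qed.

Lemma exists_orth (R : realType) (N k : nat) (a : 'I_k -> 'cV[R]_N) :
  (k < N)%N -> exists2 v, v != 0 & forall i, dot (a i) v = 0.
Proof.
move=> kN; have [|v [v0 _ va]] := @exists_ker_orth R N k 0 a; last by exists v.
by rewrite mxrank0.
Qed.

Section Tangent.
Variables (R : realType) (N m : nat) (P : 'I_m.+1 -> 'M[R]_N).
Local Notation V := 'cV[R]_N.
Hypothesis cP : clifford P.

(** A solution [v] of the linearized equations is the velocity of the retraction
   of the line [x + t *: v]. *)
Lemma tangent_focalP x v : focal P x ->
  tangent (focal P) x v <-> dot x v = 0 /\ forall i, dot (P i *m x) v = 0.
Proof.
move=> fx; split.
  move=> [c [U [oU sc Uf c0 cv]]].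
  have U0 : nbhs (0 : R^o) U by exact: open_nbhs_nbhs.
  have dc : differentiable c 0.
    by have [H _] := sc 1; apply: H; exact: nbhs_singleton.
  have D (f : V -> R^o) (k : R) : Ck 1 setT f ->
      (forall y, focal P y -> f y = k) -> 'D_v f x = 0.
    move=> [df _] fk.
    have df0 : differentiable f (c 0) by exact: df.
    rewrite -cv -c0 -(derive_comp _ dc df0).
    rewrite (@near_eq_derive _ _ _ _ (cst (k : R^o))) ?derive_cst //.
    by apply: filterS U0 => t Ut; rewrite /= fk //; exact: Uf.
  have Cid k : Ck_entries k [set: V] id by exact: Ck_entries_id.
  have n2 (z : R) : 2 * z = 0 -> z = 0 by lra.
  split=> [|i]; apply: n2.
    have [_ <-] := is_derive_dot x v.
    by apply: (D _ 1) => [|y [->]//]; apply: Ck_dot => //; exact: openT.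
  have [_ <-] := is_derive_quadratic_form x v (clifford_sym cP i).
  apply: (D _ 0) => [|y [_ ->]//]; apply: (Ck_dot openT _ (Cid 1)).
  exact: (Ck_mulmx openT (P i) (Cid 1)).
move=> [xv Pxv].
pose l (t : R^o) := x + t *: v.
pose U := [set t : R^o | 0 < disc P (l t)].
have Cl k (W : set R^o) : Ck_entries k W l.
  move=> j; apply: (@Ck_subset _ _ _ _ setT) => //.
  have C1 : Ck k [set: R^o] (fun t : R^o => t : R^o).
    case: k => [|k]; first by move=> t _; exact: cvg_id.
    split=> [t _|w]; first exact: ex_diff.
    rewrite [X in Ck _ _ X](_ : _ = fun=> w); first exact: Ck_cst.
    by apply/funext => t; rewrite derive_id.
  have := CkD openT (Ck_cst k _ (x j 0 : R^o)) (CkM openT C1 (Ck_cst k _ (v j 0 : R^o))).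
  by apply: Ck_ext => [|t _]; [exact: openT|rewrite !mxE].
have oU : open U.
  by apply: open_Ck_pos; apply: Ck_disc => //; exact: openT.
have l0 : l 0 = x by rewrite /l scale0r addr0.
have U0 : U 0 by rewrite /U /= l0 focal_disc.
exists (fun t => retraction P (l t)), U; split => //.
- move=> k; apply: Ck_col => //; apply: Ck_retraction => //.
- by move=> t Ut; apply: focal_retraction.
- by rewrite l0 retraction_id.
have CR : Ck_entries 1 [set y | 0 < disc P y] (retraction P).
  apply: (Ck_retraction (Y := id)) => //; first exact: open_disc_pos.
  exact: Ck_entries_id.
have [dR _] := Ck_col (@open_disc_pos _ _ _ P) CR.
have dl : differentiable l 0 by exact: differentiable_line.
have dRx : differentiable (retraction P) (l 0) by apply: dR; rewrite /= l0 focal_disc.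
rewrite -[LHS]/('D_1 (retraction P \o l) 0) (derive_comp _ dl dRx) derive_line l0.
apply/matrixP => j k; rewrite ord1 -derive_coord -?l0 // l0.
by have [_ ->] := is_derive_retraction cP j fx xv Pxv.
Qed.

Hypothesis mN : (m.*2 < N)%N.

(** The matrix [P j] exchanges the two eigenspaces of [P i]. *)
Lemma rank_projector_le (i j : 'I_m.+1) : i != j -> ((\rank (1%:M + P i)%R).*2 <= N)%N /\
  ((\rank (1%:M - P i)%R).*2 <= N)%N.
Proof.
move=> ij.
have E : P j *m (1%:M + P i) *m P j = 1%:M - P i.
  rewrite mulmxDr mulmx1 mulmxDl clifford_sq // clifford_anti // 1?eq_sym //.
  by rewrite mulNmx -mulmxA clifford_sq // mulmx1.
have rle (M : 'M[R]_N) : (\rank (P j *m M *m P j) <= \rank M)%N.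
  exact: leq_trans (mxrankM_maxl _ _) (mxrankM_maxr _ _).
have E' : P j *m (1%:M - P i) *m P j = 1%:M + P i.
  by rewrite -E !mulmxA clifford_sq // mul1mx -mulmxA clifford_sq // mulmx1.
have r1 := rle (1%:M + P i); rewrite E in r1.
have r2 := rle (1%:M - P i); rewrite E' in r2.
have : (1%:M + P i) *m (1%:M - P i) = 0.
  rewrite mulmxDl !mulmxBr !mulmx1 mul1mx clifford_sq //.
  by rewrite addrC addrA subrK subrr.
move=> /mulmx0_rank_max; lia.
Qed.

(** Take eigenvectors [z] and [w] of the first matrix for the eigenvalues 1 and
   -1, with [w] orthogonal to the images of [z] under the other matrices: on
   [z + w] only the first quadratic form survives, and it is smaller than the
   square of the norm, so that the retraction applies. *)
Lemma focal_nonempty : (0 < m)%N -> exists x, focal P x.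
Proof.
move=> m0.
have ij : ord0 != Ordinal (n := m.+1) (m := 1) m0 by [].
have [r1 r2] := rank_projector_le ij.
have rk2 : (\rank (1%:M - P ord0)%R + 0 < N)%N by lia.
have [z [z0 Pz _]] := @exists_ker_orth _ _ _ _ (fun i : 'I_0 => 0) rk2.
have {}Pz : P ord0 *m z = z.
  by move: Pz; rewrite mulmxBl mul1mx => /eqP; rewrite subr_eq0 => /eqP.
have rk1 : (\rank (1%:M + P ord0)%R + m < N)%N by lia.
have [w [w0 Pw zw]] := @exists_ker_orth _ _ _ _ (fun i : 'I_m => P (lift ord0 i) *m z) rk1.
have {}Pw : P ord0 *m w = - w.
  by move: Pw; rewrite mulmxDl mul1mx addrC => /eqP; rewrite addr_eq0 => /eqP.
have self0 (t : R) : t = - t -> t = 0 by lra.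
have zw0 : dot z w = 0.
  by apply: self0; rewrite -{1}Pz dot_clifford // Pw dotNr.
have eig (u : V) c i : c * c = 1 -> P ord0 *m u = c *: u -> dot (P (lift ord0 i) *m u) u = 0.
  move=> cc Pu; apply: self0.
  have : dot (P (lift ord0 i) *m u) u = c * dot (P (lift ord0 i) *m (P ord0 *m u)) u.
    by rewrite Pu -scalemxAr dotZl mulrA cc mul1r.
  rewrite mulmxA clifford_anti // 1?eq_sym ?neq_lift // mulNmx dotNl -mulmxA.
  by rewrite [dot (P ord0 *m _) u]dot_clifford // Pu dotZr mulrN mulrA cc mul1r => {1}->.
exists (retraction P (z + w)); apply: focal_retraction => //.
have D : disc P (z + w) = 4 * dot z z * dot w w.
  rewrite /disc big_ord_recl big1 ?addr0.
    rewrite /quad mulmxDr Pz Pw !dotDl !dotDr !dotNl (dotC w z) zw0; ring.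
  move=> i _; rewrite /quad mulmxDr !dotDl !dotDr zw.
  rewrite (eig z 1) ?mul1r ?scale1r // (eig w (-1)) ?scaleN1r ?mulrNN ?mul1r //.
  by rewrite [dot _ z]dot_clifford // dotC zw !addr0 expr0n.
by rewrite D !mulr_gt0 // dot_gt0.
Qed.

End Tangent.

(** * Unitary frames *)

Section LinearOn.
Variables (R : realType) (V : normedModType R) (W : lmodType R).
Variables (T : set V) (f : V -> W).
Hypothesis lf : linear_on T f.

Lemma linear_on0 : T 0 -> f 0 = 0.
Proof.
move=> T0; have := lf 1 T0 T0; rewrite scaler0 addr0 scale1r => /eqP.
by rewrite -subr_eq0 opprD addrA subrr sub0r oppr_eq0 => /eqP.
Qed.

Lemma linear_onZ c u : T 0 -> T u -> f (c *: u) = c *: f u.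
Proof. by move=> T0 Tu; have := lf c Tu T0; rewrite linear_on0 // !addr0. Qed.

Lemma linear_onN u : T 0 -> T u -> f (- u) = - f u.
Proof. by move=> T0 Tu; rewrite -(scaleN1r u) linear_onZ // scaleN1r. Qed.

End LinearOn.

Section UnitaryFrame.
Variables (R : realType) (N q : nat) (nu : 'I_q -> 'cV[R]_N).
Local Notation V := 'cV[R]_N.
Definition orth_space : set V := [set v | forall a, dot (nu a) v = 0].
Local Notation T := orth_space.

Lemma orth_space_lin c u v : T u -> T v -> T (c *: u + v).
Proof. by move=> Tu Tv a; rewrite dotDr dotZr Tu Tv mulr0 addr0. Qed.

Lemma orth_space0 : T 0. Proof. by move=> a; rewrite dot0r. Qed.

Lemma orth_spaceZ c u : T u -> T (c *: u).
Proof. by move=> Tu; rewrite -[_ *: _]addr0; apply: orth_space_lin => //; exact: orth_space0. Qed.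

Variables (g : V -> V -> R) (J : V -> V).
Hypothesis lg : forall u, T u -> linear_on T (g u : V -> R^o).
Hypothesis gC : forall u v, T u -> T v -> g u v = g v u.
Hypothesis g_gt0 : forall u, T u -> u != 0 -> 0 < g u u.
Hypothesis JT : forall u, T u -> T (J u).
Hypothesis JJ : forall u, T u -> J (J u) = - u.
Hypothesis gJ : forall u v, T u -> T v -> g (J u) (J v) = g u v.
Variable proj : 'M[R]_N.
Hypothesis projT : forall v, T (proj *m v).
Hypothesis proj_id : forall v, T v -> proj *m v = v.

Lemma gNr u v : T u -> T v -> g u (- v) = - g u v.
Proof. by move=> Tu Tv; rewrite (linear_onN (lg Tu)) //; exact: orth_space0. Qed.

Lemma gZr c u v : T u -> T v -> g u (c *: v) = c * g u v.
Proof. by move=> Tu Tv; rewrite (linear_onZ (lg Tu)) //; exact: orth_space0. Qed.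

Lemma gJl u v : T u -> T v -> g (J u) v = - g u (J v).
Proof.
move=> Tu Tv; rewrite -[in RHS]gJ ?JJ ?gNr ?opprK //; try exact: JT.
Qed.

Lemma gJ_self u : T u -> g (J u) u = 0.
Proof.
move=> Tu; have : g (J u) u = - g (J u) u by rewrite {1}gJl // [in RHS]gC //; exact: JT.
lra.
Qed.

(** The functional [g u] on the orthogonal space as a scalar product. As [g u] has
   no meaning elsewhere, the basis vectors are projected first. *)
Definition functional_vec u : V := \col_j g u (proj *m basis_vec R j).

Lemma functional_vecE u v : T u -> T v -> dot (functional_vec u) v = g u v.
Proof.
move=> Tu Tv; rewrite -[in RHS](proj_id Tv) {2}(col_basis_sum v) mulmx_sumr.
have -> : dot (functional_vec u) v = \sum_j v j 0 * g u (proj *m basis_vec R j).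
  by apply: eq_bigr => j _; rewrite mxE mulrC.
have H (r : seq 'I_N) : T (\sum_(j <- r) proj *m (v j 0 *: basis_vec R j)) /\
    \sum_(j <- r) v j 0 * g u (proj *m basis_vec R j) =
    g u (\sum_(j <- r) proj *m (v j 0 *: basis_vec R j)).
  elim: r => [|j r [IH1 IH2]].
    by rewrite !big_nil (linear_on0 (lg Tu) orth_space0); split=> [|//]; exact: orth_space0.
  rewrite !big_cons IH2 -scalemxAr; split; first exact: orth_space_lin.
  by rewrite (lg Tu).
exact: (H _).2.
Qed.

Definition unitary_seq k (u : nat -> V) := forall i, (i < k)%N ->
  T (u i) /\ forall j, (j < k)%N ->
    g (u i) (u j) = (i == j)%:R /\ g (J (u i)) (u j) = 0.

(** Gram-Schmidt orthogonalization: a vector orthogonal to the normal vectors and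
   to the functional vectors of the [u i] and [J (u i)] found so far exists by
   counting dimensions. *)
Lemma unitary_seq_exists u0 n : N = (q + n.*2)%N -> T u0 -> u0 != 0 ->
  forall k, (0 < k <= n)%N -> exists u c, [/\ unitary_seq k u, 0 < c & u 0%N = c *: u0].
Proof.
move=> NE Tu0 u00.
have normalize v : T v -> v != 0 -> exists c, [/\ 0 < c, T (c *: v) & g (c *: v) (c *: v) = 1].
  move=> Tv v0; have gv := g_gt0 Tv v0.
  exists (Num.sqrt (g v v))^-1; have Tc := orth_spaceZ (Num.sqrt (g v v))^-1 Tv.
  split => //; first by rewrite invr_gt0 sqrtr_gt0.
  rewrite gZr // gC // gZr // mulrA -invfM -expr2 sqr_sqrtr ?ltW // mulVf // gt_eqF //.
elim=> // -[_ _|k IH /andP[_ kn]].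
  have [c [c0 Tc gc]] := normalize _ Tu0 u00.
  exists (fun=> c *: u0), c; split=> [[|//] _|//|//]; split=> [//|[|//] _].
  by rewrite gc gJ_self.
have [|u [c [Hu c0 uc]]] := IH; first by rewrite /= ltnW.
pose a (i : 'I_(q + (k.+1 + k.+1))) : V :=
  match fintype.split i with
  | inl b => nu b
  | inr b => match fintype.split b with inl d => functional_vec (u d) | inr d => functional_vec
    (J (u d)) end
  end.
have [|v v0 Hv] := @exists_orth R N _ a; first by rewrite NE; move: kn; lia.
have Tv : T v by move=> b; have := Hv (lshift _ b); rewrite /a (unsplitK (inl b)).
have Hu1 d : (d < k.+1)%N -> g (u d) v = 0.
  move=> dk; rewrite -functional_vecE //; last by have [] := Hu d dk.
  have := Hv (rshift q (lshift _ (Ordinal dk))).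
  by rewrite /a (unsplitK (inr _)) (unsplitK (inl _)).
have Hu2 d : (d < k.+1)%N -> g (J (u d)) v = 0.
  move=> dk; rewrite -functional_vecE //; last by apply: JT; have [] := Hu d dk.
  have := Hv (rshift q (rshift _ (Ordinal dk))).
  by rewrite /a (unsplitK (inr _)) (unsplitK (inr _)).
have [e [e0 Te ge]] := normalize _ Tv v0.
exists (fun i => if (i < k.+1)%N then u i else e *: v), c; split => //.
move=> i ik; case: ifPn => ik1.
  have [Tui Hui] := Hu i ik1; split=> [//|j jk]; case: ifPn => jk1; first exact: Hui.
  rewrite !gZr ?Hu1 ?Hu2 ?mulr0 //; try exact: JT.
  by split => //; case: eqP => // ij; move: jk1; rewrite -ij ik1.
split=> [//|j jk]; case: ifPn => jk1.
  have [Tuj _] := Hu j jk1.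
  rewrite (gC Te Tuj) gZr // Hu1 // mulr0 gJl // gC //; last exact: JT.
  rewrite gZr ?Hu2 ?mulr0 ?oppr0 //; try exact: JT.
  by split => //; case: eqP => // ij; move: ik1; rewrite ij jk1.
rewrite ge gJ_self //; split => //.
by rewrite (_ : i == j) //; apply/eqP; lia.
Qed.

Lemma unitary_frame_exists u0 n : N = (q + n.*2)%N -> (0 < n)%N -> T u0 -> u0 != 0 ->
  exists (w : 'I_(n.*2) -> V) c,
    [/\ forall i, T (w i),
        symplectic_frame (fun u v => g (J u) v) w,
        forall i j : 'I_(n.*2), i./2 = j./2 -> (i < j)%N -> w j = J (w i),
        0 < c & forall i : 'I_(n.*2), i = 0%N :> nat -> w i = c *: u0].
Proof.
move=> NE n0 Tu0 u00.
have [|u [c [Hu c0 uc]]] := unitary_seq_exists NE Tu0 u00 (k := n); first by rewrite n0 leqnn.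
have half_lt (i : 'I_(n.*2)) : (i./2 < n)%N by have := ltn_ord i; lia.
exists (fun i => if odd i then J (u i./2) else u i./2), c; split => //.
- by move=> i; have [Tu _] := Hu _ (half_lt i); case: ifP => // _; exact: JT.
- move=> i j; have [Ti Hi] := Hu _ (half_lt i); have [Tj _] := Hu _ (half_lt j).
  have [Hij1 Hij2] := Hi _ (half_lt j).
  have -> : sympl_entry R i j = (i./2 == j./2)%:R * ((odd j)%:R - (odd i)%:R).
    rewrite /sympl_entry; case: eqP => ij; last by rewrite mul0r.
    have -> : (i < j)%N = ~~ odd i && odd j by lia.
    have -> : (j < i)%N = odd i && ~~ odd j by lia.
    by rewrite mul1r; case: (odd i); case: (odd j); rewrite /= ?subrr.
  case: ifP => oi; case: ifP => oj.
  + rewrite JJ // gC ?gNr //; try exact: JT; last by rewrite -scaleN1r; exact: orth_spaceZ.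
    have [_ /(_ _ (half_lt i)) [_ ->]] := Hu _ (half_lt j).
    by rewrite subrr mulr0 oppr0.
  + rewrite JJ // gC ?gNr //; last by rewrite -scaleN1r; exact: orth_spaceZ.
    by rewrite gC // Hij1 sub0r mulrN1.
  + by rewrite gJ // Hij1 subr0 mulr1.
  + by rewrite Hij2 subrr mulr0.
- move=> i j ij lt; have -> : odd j by lia.
  have -> : odd i = false by lia.
  by rewrite ij.
- by move=> i i0; rewrite i0 /= uc.
Qed.

End UnitaryFrame.

(** * Signed sums of multilinear forms *)

Section SignedMultilinear.
Variables (R : realType) (N : nat).
Local Notation V := 'cV[R]_N.
Local Notation e := (@basis_vec R N).

Lemma eta_perm (w : 'I_N -> V) (s : 'S_N) i u :
  ([eta w with i |-> u] : 'I_N -> V) \o s = [eta w \o s with (s^-1)%g i |-> u].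
Proof.
apply/funext => k /=; congr (if _ then _ else _).
by apply/eqP/eqP => [<-|->]; rewrite ?permK ?permKV.
Qed.

(** A signed sum of a multilinear form over all arrangements of as many vectors
   as there are dimensions is a multiple of the determinant. *)
Lemma signed_multilinear_eq0 (Z : kform V N) (w : 'I_N -> V) : multilinear Z ->
  \sum_(s : 'S_N) (-1) ^+ s * Z (e \o s) = 0 ->
  \sum_(s : 'S_N) (-1) ^+ s * Z (w \o s) = 0.
Proof.
move=> lZ Ze.
pose A : kform V N := fun w => \sum_(s : 'S_N) (-1) ^+ s * Z (w \o s).
have lA : multilinear A.
  move=> i v c x y; rewrite /A mulr_sumr -big_split /=; apply: eq_bigr => s _.
  by rewrite !eta_perm lZ mulrDr mulrCA.
rewrite -[LHS]/(A w) (multilinear_expand _ lA) big1 // => f _.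
rewrite [X in _ * X](_ : _ = 0) ?mulr0 //.
have [/injectiveP fi|] := boolP (injectiveb f).
  pose s0 : 'S_N := perm fi.
  have -> : A (fun i => e (f i)) = (-1) ^+ s0 * \sum_(s : 'S_N) (-1) ^+ s * Z (e \o s).
    rewrite /A mulr_sumr [RHS](reindex_inj (mulIg s0)) /=; apply: eq_bigr => s _.
    rewrite odd_permM [RHS]mulrA -signr_addb addbCA addbb addbF.
    by congr (_ * Z _); apply/funext => i /=; rewrite permM permE.
  by rewrite Ze mulr0.
move=> /injectivePn [i [j ij fij]].
apply: (signed_sum_symr ij) => s; congr Z; apply/funext => k /=; rewrite permM.
by case: tpermP => [->|->|]; rewrite ?fij.
Qed.
End SignedMultilinear.

(** * Stokes' theorem on the focal submanifold *)

Section Stokes.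
Variables (R : realType) (m p : nat).
Local Notation q := m.+2.
Local Notation N := (q + (2 + p.*2))%N.
Local Notation V := 'cV[R]_N.
Local Notation k := p.*2.
Local Notation e := (@basis_vec R N).
Variables (P : 'I_m.+1 -> 'M[R]_N).
Hypothesis cP : clifford P.
Local Notation M := (focal P).
Local Notation Dom := [set y : V | 0 < disc P y].
Local Notation r := (retraction P).

(** The gradients of the functions that define the focal submanifold are twice
   the vectors [normal_vec a x]. *)
Definition normal_mx : 'I_q -> 'M[R]_N := fcons 1%:M P.
Definition normal_vec a (x : V) : V := normal_mx a *m x.

Lemma normal_mx_sym a : (normal_mx a)^T = normal_mx a.
Proof.
rewrite /normal_mx; case: (unliftP ord0 a) => [i|] ->; last by rewrite fcons0 trmx1.
by rewrite fconsS (clifford_sym cP).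
Qed.

Lemma normal_dot x a b : M x -> dot (normal_vec a x) (normal_vec b x) = (a == b)%:R.
Proof.
move=> [x1 Px]; rewrite /normal_vec /normal_mx.
case: (unliftP ord0 a) => [i|] ->; case: (unliftP ord0 b) => [j|] ->;
  rewrite ?fcons0 ?fconsS ?mul1mx.
- by rewrite clifford_dot // x1 mulr1 (inj_eq (@lift_inj _ _)).
- by rewrite Px eq_sym (negbTE (neq_lift _ _)).
- by rewrite dotC Px (negbTE (neq_lift _ _)).
- by rewrite x1 eqxx.
Qed.

Lemma tangent_normalP x v : M x ->
  tangent M x v <-> orth_space (fun a => normal_vec a x) v.
Proof.
move=> Mx; rewrite tangent_focalP //; split=> [[xv Pv] a|H].
  rewrite /normal_vec /normal_mx; case: (unliftP ord0 a) => [i|] ->; first by rewrite fconsS.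
  by rewrite fcons0 mul1mx.
split=> [|i]; first by have := H ord0; rewrite /normal_vec /normal_mx fcons0 mul1mx.
by have := H (lift ord0 i); rewrite /normal_vec /normal_mx fconsS.
Qed.

Definition tproj x (w : V) : V := w - \sum_a dot (normal_vec a x) w *: normal_vec a x.

Lemma tproj_tangent x w : M x -> tangent M x (tproj x w).
Proof.
move=> Mx; apply/tangent_normalP => // b.
rewrite /tproj dotDr dotNr dot_sumr (bigD1 b) //= big1 ?addr0.
  by rewrite dotZr normal_dot // eqxx mulr1 subrr.
by move=> a ab; rewrite dotZr normal_dot // eq_sym (negbTE ab) mulr0.
Qed.

Lemma tproj_id x w : M x -> tangent M x w -> tproj x w = w.
Proof.
move=> Mx /(tangent_normalP _ Mx) H; rewrite /tproj big1 ?subr0 // => a _.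
by rewrite H scale0r.
Qed.

Lemma tproj_lin x c u v : tproj x (c *: u + v) = c *: tproj x u + tproj x v.
Proof.
rewrite /tproj scalerBr scaler_sumr addrACA -opprD -big_split /=.
congr (_ - _); apply: eq_bigr => a _.
by rewrite dotDr dotZr scalerDl scalerA.
Qed.

Variables (Om : V -> kform V k) (S : 'M[R]_N).
Hypothesis closed_Om : is_ext_deriv M Om (fun _ _ => 0).

(** The form [Om], which is meaningful on tangent vectors of the focal submanifold
   only, is extended to a neighbourhood of it by the retraction and the
   projection onto tangent spaces. *)
Definition tform (y : V) : kform V k := fun w => Om (r y) (fun j => tproj (r y) (w j)).

Lemma open_preim_retraction (U : set V) : open U -> open (Dom `&` r @^-1` U).
Proof.
move=> oU; rewrite openE => y [Dy Uy].
have oD := @open_disc_pos _ _ _ P.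
apply: filterI; first exact: open_nbhs_nbhs.
have C : Ck 0 Dom r.
  apply: Ck_col => //; apply: (Ck_retraction (Y := id)) => //.
  exact: Ck_entries_id.
by apply: (C y Dy); exact: open_nbhs_nbhs.
Qed.

Lemma Ck_retraction_id n (U : set V) : open U -> U `<=` Dom -> Ck_entries n U r.
Proof.
by move=> oU UD; apply: (Ck_retraction (Y := id)) => //; exact: Ck_entries_id.
Qed.

Lemma Ck_tproj n (U : set V) w : open U -> U `<=` Dom ->
  Ck_entries n U (fun y => tproj (r y) w).
Proof.
move=> oU UD; have Cr := Ck_retraction_id n oU UD.
have Cn a : Ck_entries n U (fun y => normal_vec a (r y)) by exact: Ck_mulmx.
have Cw : Ck_entries n U (fun=> w) by exact: Ck_entries_cst.
have : Ck_entries n U (fun y => w + \sum_a (- dot (normal_vec a (r y)) w) *: normal_vec a (r y)).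
  apply: Ck_entriesD => //; apply: Ck_entries_sum => // a.
  apply: Ck_entriesZ => //; apply: CkN => //; exact: Ck_dot.
move=> H j; apply: Ck_ext (H j) => // y _; congr (fun_of_matrix (w + _) j 0).
by rewrite -sumrN; apply: eq_bigr => a _; rewrite scaleNr.
Qed.

(** The retraction takes values in the focal submanifold, where [Om] has local
   extensions, so that [tform] inherits their smoothness. *)
Lemma tform_local y0 : Dom y0 -> exists (U : set V) (A : V -> kform V k),
  [/\ open U, U (r y0), smooth_kform U A,
     (forall y w, Dom y -> U (r y) -> tform y w = A (r y) (fun j => tproj (r y) (w j))) &
     forall (w : 'I_k.+1 -> V), (forall i, tangent M (r y0) (w i)) -> ext_deriv A (r y0) w = 0].
Proof.
move=> D0; have Mr0 := focal_retraction cP D0.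
have [U [A [[oU Ur] sA AOm dA]]] := closed_Om Mr0.
exists U, A; split => //; last by move=> w Tw; exact: dA.
move=> y w Dy Ury; have Mr := focal_retraction cP Dy.
by rewrite AOm // => i; exact: tproj_tangent.
Qed.

Lemma Ck_tform n w : Ck n Dom (fun y => tform y w : R^o).
Proof.
apply: Ck_local => y0 D0.
have [U [A [oU Ur [lA _ sA] E _]]] := tform_local D0.
pose O := Dom `&` r @^-1` U.
have oO : open O by exact: open_preim_retraction.
have OD : O `<=` Dom by move=> y [].
exists O; split => //.
have : Ck n O (fun y => A (r y) (fun j => tproj (r y) (w j)) : R^o).
  apply: (Ck_multilinear (a := fun y => A (r y)) (z := fun j y => tproj (r y) (w j))) => //.
  - by move=> y [_ Uy]; exact: lA.
  - move=> f; apply: (Ck_comp (B := U) (A := fun y => A y (fun i => e (f i)))) => //.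
    + by move=> y [].
    + exact: Ck_retraction_id.
    + exact: sA.
  - by move=> i j; exact: Ck_tproj.
by apply: Ck_ext => // y [Dy Uy]; rewrite E.
Qed.

(** The positions among the [N] arguments of the conormal 1-forms, of the 1-form
   [alpha], of the direction of derivation and of the arguments of [Om]. *)
Definition normal_slot (a : 'I_q) : 'I_N := lshift (2 + k) a.
Definition alpha_slot : 'I_N := rshift q (lshift k (0 : 'I_2)).
Definition deriv_slot : 'I_N := rshift q (lshift k (1 : 'I_2)).
Definition form_slot (j : 'I_k) : 'I_N := rshift q (rshift 2 j).

Definition conormal y (w : 'I_N -> V) : R := \prod_a dot (normal_vec a y) (w (normal_slot a)).
Definition alpha y (u : V) : R := dot y (S *m u).

(** The product of the defining 1-forms, of the 1-form [alpha] and of the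
   extended form; the slot [deriv_slot] is reserved for the derivative. *)
Definition prodform y (w : 'I_N -> V) : R :=
  conormal y w * alpha y (w alpha_slot) * tform y (fun j => w (form_slot j)).

Lemma Ck_prodform n w : Ck n Dom (fun y => prodform y w : R^o).
Proof.
have oD := @open_disc_pos _ _ _ P.
have Cid := @Ck_entries_id R N n Dom.
apply: CkM => //; last exact: Ck_tform.
apply: CkM => //.
  apply: Ck_prod => // a; apply: Ck_dot => //; last exact: Ck_entries_cst.
  exact: (Ck_mulmx oD (normal_mx a) Cid).
by apply: (Ck_dot oD Cid); exact: Ck_entries_cst.
Qed.

(** Up to a constant factor, [density x] is the exterior derivative at [x] of the
   exterior product of the 1-forms and the form that make up [prodform]. *)
Definition density_term x (w : 'I_N -> V) : R :=
  'D_(w deriv_slot) (fun y => prodform y w : R^o) x.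
Definition density x (w : 'I_N -> V) : R :=
  \sum_(s : 'S_N) (-1) ^+ s * density_term x (w \o s).

Lemma density_continuous w y : Dom y ->
  {for y, continuous (fun y => density y w : R^o)}.
Proof.
move=> Dy; have oD := @open_disc_pos _ _ _ P.
apply: (@Ck_continuous _ _ _ 0 Dom) => //.
apply: Ck_sum => // s _; apply: CkM => //; first exact: Ck_cst.
by have [_ H] := Ck_prodform 1 (w \o s); exact: H.
Qed.

Lemma slotP (i : 'I_N) :
  [\/ exists a, i = normal_slot a, i = alpha_slot, i = deriv_slot | exists j, i = form_slot j].
Proof.
case: (split_ordP i) => [a ->|b ->]; first by constructor 1; exists a.
case: (split_ordP b) => [c ->|j ->]; last by constructor 4; exists j.
have [->|->] : c = 0 \/ c = 1.
  by case: c => [[|[|//]]] ?; [left|right]; apply: val_inj.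
all: by [constructor 2|constructor 3].
Qed.

Lemma normal_slot_inj : injective normal_slot. Proof. exact: lshift_inj. Qed.
Lemma form_slot_inj : injective form_slot. Proof. by move=> i j /rshift_inj /rshift_inj. Qed.
Lemma normal_alpha_slot a : (normal_slot a == alpha_slot) = false.
Proof. by apply/negbTE; rewrite -val_eqE /= addn0 ltn_eqF. Qed.
Lemma normal_deriv_slot a : (normal_slot a == deriv_slot) = false.
Proof. by apply/negbTE; rewrite -val_eqE /=; have := ltn_ord a; lia. Qed.
Lemma normal_form_slot a j : (normal_slot a == form_slot j) = false.
Proof. by apply/negbTE; rewrite -val_eqE /=; have := ltn_ord a; lia. Qed.
Lemma alpha_deriv_slot : (alpha_slot == deriv_slot) = false.
Proof. by apply/negbTE; rewrite -val_eqE /=; lia. Qed.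
Lemma alpha_form_slot j : (alpha_slot == form_slot j) = false.
Proof. by apply/negbTE; rewrite -val_eqE /=; lia. Qed.
Lemma deriv_form_slot j : (deriv_slot == form_slot j) = false.
Proof. by apply/negbTE; rewrite -val_eqE /=; lia. Qed.

Lemma tform_multilinear y : Dom y -> multilinear (tform y).
Proof.
move=> Dy i w c u v; have [U [A [_ Ur [lA _ _] E _]]] := tform_local Dy.
have etaE (t : V) : (fun j => tproj (r y) ([eta w with i |-> t] j)) =
    [eta (fun j => tproj (r y) (w j)) with i |-> tproj (r y) t].
  by apply/funext => j /=; case: eqP.
by rewrite !E // !etaE tproj_lin lA.
Qed.

Lemma prodform_id y w u : prodform y [eta w with deriv_slot |-> u] = prodform y w.
Proof.
rewrite /prodform /= alpha_deriv_slot; congr (_ * _ * tform y _).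
  by apply: eq_bigr => a _ /=; rewrite normal_deriv_slot.
by apply/funext => j /=; rewrite eq_sym deriv_form_slot.
Qed.

Lemma prodform_lin y i w c u v : Dom y -> i != deriv_slot ->
  prodform y [eta w with i |-> c *: u + v] =
  c * prodform y [eta w with i |-> u] + prodform y [eta w with i |-> v].
Proof.
move=> Dy; case: (slotP i) => [[a ->]|->|->|[j ->]] ii; last 2 first.
- by rewrite eqxx in ii.
- have E (t : V) : prodform y [eta w with form_slot j |-> t] =
     conormal y w * alpha y (w alpha_slot) * tform y [eta (fun j => w (form_slot j)) with j |-> t].
    rewrite /prodform /= alpha_form_slot; congr (_ * _ * tform y _).
      by apply: eq_bigr => a _ /=; rewrite normal_form_slot.
    by apply/funext => j' /=; rewrite (inj_eq form_slot_inj).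
  by rewrite !E tform_multilinear //; ring.
- have E (t : V) : prodform y [eta w with normal_slot a |-> t] =
     (dot (normal_vec a y) t * \prod_(b | b != a) dot (normal_vec b y) (w (normal_slot b))) *
     alpha y (w alpha_slot) * tform y (fun j => w (form_slot j)).
    rewrite /prodform /= eq_sym normal_alpha_slot; congr (_ * _ * tform y _).
      rewrite /conormal (bigD1 a) //= eqxx; congr (_ * _).
      by apply: eq_bigr => b /negbTE ba; rewrite (inj_eq normal_slot_inj) ba.
    by apply/funext => j /=; rewrite eq_sym normal_form_slot.
  by rewrite !E dotDr dotZr; ring.
- have E (t : V) : prodform y [eta w with alpha_slot |-> t] =
     conormal y w * alpha y t * tform y (fun j => w (form_slot j)).
    rewrite /prodform /= eqxx; congr (_ * _ * tform y _).
      by apply: eq_bigr => a _ /=; rewrite normal_alpha_slot.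
    by apply/funext => j /=; rewrite eq_sym alpha_form_slot.
  by rewrite !E /alpha mulmxDr dotDr -scalemxAr dotZr; ring.
Qed.

Lemma differentiable_prodform x w : Dom x ->
  differentiable (fun y => prodform y w : R^o) x.
Proof. by move=> Dx; have [H _] := Ck_prodform 1 w; exact: H. Qed.

Lemma density_term_multilinear x : Dom x -> multilinear (density_term x).
Proof.
move=> Dx i w c u v; rewrite /density_term.
have dX w' := differentiable_prodform w' Dx.
have [->|ii] := eqVneq i deriv_slot.
  rewrite /= eqxx.
  have E t : (fun y => prodform y [eta w with deriv_slot |-> t]) = (fun y => prodform y w).
    by apply/funext => y; rewrite prodform_id.
  by rewrite !E !deriveE // linearP.
rewrite /= [deriv_slot == i]eq_sym (negbTE ii).
set d := w deriv_slot.
have := @near_eq_derive _ _ _ (fun y => prodform y [eta w with i |-> c *: u + v] : R^o)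
  (c *: (fun y => prodform y [eta w with i |-> u] : R^o) + (fun y => prodform y [eta w with i |->
    v] : R^o)) x d.
move=> ->; last first.
  have : nbhs x Dom by apply: open_nbhs_nbhs; split => //; exact: open_disc_pos.
  by apply: filterS => y Dy; rewrite prodform_lin.
rewrite deriveD; [|exact/derivableZ/diff_derivable|exact/diff_derivable].
by rewrite deriveZ //; exact: diff_derivable.
Qed.

Section AtFocalPoint.
Variable x : V.
Hypothesis Mx : M x.

Lemma focal_Dom : Dom x. Proof. by rewrite /= focal_disc. Qed.

(** The second fundamental form; by [derive_tproj] it is the derivative in the
   direction [v] of the projection of [w] onto the tangent spaces. *)
Definition shape v w : V := - \sum_a dot (normal_vec a v) w *: normal_vec a x.

Lemma shapeC v w : shape v w = shape w v.
Proof.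
congr (- _); apply: eq_bigr => a _.
by rewrite /normal_vec dot_mull normal_mx_sym dotC.
Qed.

Lemma differentiable_retraction : differentiable r x.
Proof.
have oD := @open_disc_pos _ _ _ P.
have [H _] := Ck_col oD (Ck_retraction_id 1 oD (@subset_refl _ _)).
exact/H/focal_Dom.
Qed.

Lemma derive_retraction v : tangent M x v -> 'D_v r x = v.
Proof.
move=> /(tangent_focalP cP _ Mx)[xv Pv].
apply/matrixP => j i; rewrite ord1 -derive_coord; last exact: differentiable_retraction.
by have [_ ->] := is_derive_retraction cP j Mx xv Pv.
Qed.

Lemma derive_tproj v w : tangent M x v -> tangent M x w ->
  differentiable (fun y => tproj (r y) w) x /\
  'D_v (fun y => tproj (r y) w) x = shape v w.
Proof.
move=> Tv Tw; have oD := @open_disc_pos _ _ _ P.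
have [H _] := Ck_col oD (Ck_tproj 1 w oD (@subset_refl _ _)).
split; first exact/H/focal_Dom.
have dz : differentiable (fun y => tproj y w) x.
  have Cn a : Ck_entries 1 [set: V] (fun y => normal_vec a y).
    exact: (Ck_mulmx openT (normal_mx a) (@Ck_entries_id _ _ 1 setT)).
  have Cz : Ck_entries 1 [set: V] (fun y => w + \sum_a (- dot (normal_vec a y) w) *: normal_vec a
    y).
    apply: Ck_entriesD; [exact: openT|exact: Ck_entries_cst|].
    apply: Ck_entries_sum => [|a]; first exact: openT.
    apply: Ck_entriesZ; [exact: openT| |exact: Cn].
    apply: CkN; [exact: openT|].
    exact: (Ck_dot openT (Cn a) (@Ck_entries_cst _ _ _ _ _ w)).
  have [Hz _] := Ck_col openT Cz.
  rewrite (_ : (fun y => tproj y w) = (fun y => w + \sum_a (- dot (normal_vec a y) w) *: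
    normal_vec a y)); first exact: Hz.
  apply/funext => y; rewrite /tproj -sumrN; congr (w + _).
  by apply: eq_bigr => a _; rewrite scaleNr.
have dzr : differentiable (fun y => tproj y w) (r x) by rewrite retraction_id.
rewrite -[LHS]/('D_v ((fun y => tproj y w) \o r) x) (derive_comp _ differentiable_retraction dzr).
rewrite derive_retraction // retraction_id //.
apply/matrixP => j i; rewrite ord1 -derive_coord //.
have D a : is_derive x v (fun y => dot (normal_vec a y) w * (normal_vec a y) j 0 : R^o)
    (dot (normal_vec a v) w * (normal_vec a x) j 0).
  have D0 := is_deriveM (is_derive_linear_form (normal_mx a) x v w) (is_derive_mulmx (normal_mx
    a) x v j).
  apply: is_derive_eq D0 _.
  have /(tangent_normalP _ Mx) /(_ a) := Tw; rewrite /normal_vec => ->.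
  by rewrite scale0r add0r [LHS]mulrC.
have := is_deriveB (is_derive_cst (w j 0 : R^o) x v) (is_derive_fsum (index_enum _) D).
rewrite sub0r => H2.
have -> : shape v w j 0 = - \sum_a dot (normal_vec a v) w * (normal_vec a x) j 0.
  by rewrite /shape mxE summxE; congr (- _); apply: eq_bigr => a _; rewrite mxE.
have [_ <-] := H2; congr ('D_v _ x); apply/funext => y.
rewrite /tproj mxE [X in _ + X]mxE summxE; congr (_ - _).
by rewrite fct_sumE; apply: eq_bigr => a _; rewrite mxE.
Qed.

(** Since the second fundamental form is symmetric, the derivative of [tform] in a
   tangent direction is that of a local extension of [Om], up to terms symmetric
   in the direction and one of the arguments. *)
Lemma derive_tform : exists A : V -> kform V k,
  [/\ forall u w, tangent M x u -> (forall j, tangent M x (w j)) ->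
       'D_u (fun y => tform y w : R^o) x =
       'D_u (fun y => A y w : R^o) x + \sum_j A x [eta w with j |-> shape u (w j)] &
     forall (w : 'I_k.+1 -> V), (forall i, tangent M x (w i)) -> ext_deriv A x w = 0].
Proof.
have Dx := focal_Dom.
have [U [A [oU Ur [lA _ sA] E dA]]] := tform_local Dx.
exists A; rewrite retraction_id // in Ur dA; split => // u w Tu Tw.
pose O := Dom `&` r @^-1` U.
have oO : open O by exact: open_preim_retraction.
have Ox : O x by split => //; rewrite /= retraction_id.
have nO : nbhs x O by exact: open_nbhs_nbhs.
have rx := retraction_id Mx.
rewrite (@near_eq_derive _ _ _ _ (fun y => A (r y) (fun j => tproj (r y) (w j)) : R^o)); last first.
  by apply: filterS nO => y [Dy Uy]; exact: E.
have dAf (w' : 'I_k -> V) : differentiable (fun y => A y w' : R^o) x.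
  by have [H _] := sA w' 1; exact: H.
have dAfr (w' : 'I_k -> V) : differentiable (fun y => A y w' : R^o) (r x) by rewrite rx.
rewrite (derive_multilinear (a := fun y => A (r y)) (z := fun j y => tproj (r y) (w j))).
- rewrite rx; congr (_ + _).
    rewrite (_ : (fun i => tproj x (w i)) = w); last by apply/funext => i; rewrite tproj_id.
    rewrite -[LHS]/('D_u ((fun y => A y w) \o r) x).
    rewrite (derive_comp _ differentiable_retraction (dAfr w)).
    by rewrite derive_retraction // rx.
  apply: eq_bigr => j _; congr (A x _); apply/funext => i /=.
  case: eqP => [_|_]; last by rewrite tproj_id.
  by have [_ ->] := derive_tproj Tu (Tw j).
- by apply: filterS nO => y [_ Uy]; exact: lA.
- move=> f; apply: (@differentiable_comp _ _ _ _ r (fun y => A y (fun i => e (f i)) : R^o)).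
    exact: differentiable_retraction.
  exact: dAfr.
- by move=> i; have [] := derive_tproj Tu (Tw i).
Qed.

End AtFocalPoint.

Section DensityAtFocalPoint.
Variable x : V.
Hypothesis Mx : M x.
Variable fr : 'I_(2 + k) -> V.
Hypothesis Tfr : forall i, tangent M x (fr i).

Definition full_frame (i : 'I_N) : V :=
  match fintype.split i with inl a => normal_vec a x | inr b => fr b end.
Local Notation w := full_frame.

Lemma full_frame_normal a : w (normal_slot a) = normal_vec a x.
Proof. by rewrite /w /normal_slot (unsplitK (inl a)). Qed.

Lemma full_frame_tangent b : w (rshift q b) = fr b.
Proof. by rewrite /w (unsplitK (inr b)). Qed.

(** On tangent vectors the conormal 1-forms vanish, so that they only see the
   arrangements that leave the normal vectors in place. *)
Lemma conormal_frame (s : 'S_N) : conormal x (w \o s) != 0 ->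
  (forall a, s (normal_slot a) = normal_slot a) /\ forall b, tangent M x (w (s (rshift q b))).
Proof.
move=> H.
have fix_ia a : s (normal_slot a) = normal_slot a.
  move: H; rewrite /conormal => /prodf_neq0 /(_ a isT) /=.
  case: (split_ordP (s (normal_slot a))) => [b ->|b ->].
    rewrite full_frame_normal normal_dot //; have [->//|_] := eqVneq a b.
    by rewrite eqxx.
  rewrite full_frame_tangent.
  by have /(tangent_normalP _ Mx) -> := Tfr b; rewrite eqxx.
split => // b; case: (split_ordP (s (rshift q b))) => [a sb|c ->].
  have : rshift q b = normal_slot a by apply: (@perm_inj _ s); rewrite fix_ia.
  by move=> /eqP; rewrite eq_sym eq_lrshift.
by rewrite full_frame_tangent.
Qed.

Lemma density_term_expand (v : 'I_N -> V) : density_term x v =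
  (\sum_a \prod_b (if b == a then dot (normal_vec b (v deriv_slot)) (v (normal_slot b))
                   else dot (normal_vec b x) (v (normal_slot b)))) *
    (alpha x (v alpha_slot) * tform x (fun j => v (form_slot j))) +
  conormal x v * alpha (v deriv_slot) (v alpha_slot) * tform x (fun j => v (form_slot j)) +
  conormal x v * alpha x (v alpha_slot) * 'D_(v deriv_slot) (fun y => tform y (fun j => v
    (form_slot j)) : R^o) x.
Proof.
have D1 : is_derive x (v deriv_slot) (fun y => conormal y v : R^o) _ :=
  is_derive_bigprod (fun a => is_derive_linear_form (normal_mx a) x (v deriv_slot) (v
    (normal_slot a))).
have D2 : is_derive x (v deriv_slot) (fun y => alpha y (v alpha_slot) : R^o) (alpha (v
  deriv_slot) (v alpha_slot)).
  have := is_derive_linear_form 1%:M x (v deriv_slot) (S *m v alpha_slot).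
  rewrite mul1mx (_ : (fun y => dot (1%:M *m y) (S *m v alpha_slot)) = fun y => alpha y (v
    alpha_slot)) //.
  by apply/funext => y; rewrite mul1mx.
have D3 : is_derive x (v deriv_slot) (fun y => tform y (fun j => v (form_slot j)) : R^o)
    ('D_(v deriv_slot) (fun y => tform y (fun j => v (form_slot j)) : R^o) x).
  apply/derivableP/diff_derivable.
  by have [H _] := Ck_tform 1 (fun j => v (form_slot j)); apply: H; exact: focal_Dom.
have [_ E] := is_deriveM (is_deriveM D1 D2) D3.
rewrite [LHS]E /GRing.scale /=.
rewrite -/(conormal x v).
set d1 := \sum_a _; set d3 := 'D_(_) _ x.
set t := tform x _; set a1 := alpha x _; set a2 := alpha _ _; set c := conormal x v.
rewrite -[X in X * d3]/(c * a1); ring.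
Qed.

(** The conormal 1-forms are closed: the matrices [normal_mx a] are symmetric. *)
Lemma sum_conormal_derivative : \sum_(s : 'S_N) (-1) ^+ s *
  ((\sum_a \prod_b (if b == a then dot (normal_vec b (w (s deriv_slot))) (w (s (normal_slot b)))
                   else dot (normal_vec b x) (w (s (normal_slot b))))) *
    (alpha x (w (s alpha_slot)) * tform x (fun j => w (s (form_slot j))))) = 0.
Proof.
under eq_bigr do rewrite mulr_suml mulr_sumr.
rewrite exchange_big big1 //= => a _.
have aid : normal_slot a != deriv_slot by rewrite normal_deriv_slot.
apply: (signed_sum_sym aid) => s; rewrite !permM.
have T i : normal_slot a != i -> deriv_slot != i -> tperm (normal_slot a) deriv_slot i = i by
  exact: tpermD.
rewrite (T alpha_slot) ?normal_alpha_slot // 1?eq_sym ?alpha_deriv_slot // tpermR.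
congr (_ * (_ * tform x _)).
  apply: eq_bigr => b _; rewrite !permM; case: eqP => [->|/eqP ba].
    by rewrite tpermL /normal_vec dot_mull normal_mx_sym dotC.
  by rewrite (T (normal_slot b)) // ?(inj_eq normal_slot_inj) // eq_sym // normal_deriv_slot.
by apply/funext => j; rewrite permM (T (form_slot j)) ?normal_form_slot ?deriv_form_slot.
Qed.

(** Summing over all arrangements, the derivatives of the extended form only
   contribute through its exterior derivative, which vanishes. *)
Lemma sum_tform_derivative : \sum_(s : 'S_N) (-1) ^+ s *
  (conormal x (w \o s) * alpha x (w (s alpha_slot)) *
   'D_(w (s deriv_slot)) (fun y => tform y (fun j => w (s (form_slot j))) : R^o) x) = 0.
Proof.
have [A [DA dA]] := derive_tform Mx.
pose f (s : 'S_N) := conormal x (w \o s) * alpha x (w (s alpha_slot)) *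
  'D_(w (s deriv_slot)) (fun y => A y (fun j => w (s (form_slot j))) : R^o) x.
pose h j (s : 'S_N) := conormal x (w \o s) * alpha x (w (s alpha_slot)) *
  A x [eta (fun j => w (s (form_slot j))) with j |-> shape x (w (s deriv_slot)) (w (s (form_slot
    j)))].
have E (s : 'S_N) : conormal x (w \o s) * alpha x (w (s alpha_slot)) *
   'D_(w (s deriv_slot)) (fun y => tform y (fun j => w (s (form_slot j))) : R^o) x = f s + \sum_j
     h j s.
  rewrite /f /h; have [c0|c0] := eqVneq (conormal x (w \o s)) 0.
    by rewrite c0 !mul0r big1 ?addr0 // => j _; rewrite !mul0r.
  have [_ Tw] := conormal_frame c0.
  rewrite (DA _ (fun j => w (s (form_slot j)))); [|exact: Tw|by move=> j; exact: Tw].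
  by rewrite mulrDr; congr (_ + _); exact: mulr_sumr.
under eq_bigr do rewrite E mulrDr mulr_sumr.
rewrite big_split /= [X in _ + X]exchange_big /= [X in _ + X]big1 ?addr0; last first.
  move=> j _; have jid : form_slot j != deriv_slot by rewrite eq_sym deriv_form_slot.
  apply: (signed_sum_sym jid) => s.
  have T i : form_slot j != i -> deriv_slot != i -> tperm (form_slot j) deriv_slot i = i by
    exact: tpermD.
  rewrite /h !permM tpermR tpermL (T alpha_slot) 1?eq_sym ?alpha_form_slot ?alpha_deriv_slot //.
  congr (_ * _ * A x _).
    by apply: eq_bigr => a _ /=; rewrite permM (T (normal_slot a)) // 1?eq_sym ?normal_form_slot
      ?normal_deriv_slot.
  apply/funext => i /=; rewrite shapeC; case: eqP => // /eqP ij.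
  by rewrite permM (T (form_slot i)) ?deriv_form_slot // (inj_eq form_slot_inj) eq_sym.
(* Average over the cyclic rearrangements of the derivative and its arguments. *)
pose gam (i : 'I_k.+1) : 'S_N := shift_perm q (shift_perm 1 (lift_perm ord0 i 1%g)).
have gam_ia i a : gam i (normal_slot a) = normal_slot a by exact: shift_perm_lshift.
have ibE : alpha_slot = rshift q (lshift k.+1 (ord0 : 'I_1)) by apply: val_inj.
have idE : deriv_slot = rshift q (rshift 1 (ord0 : 'I_k.+1)) by apply: val_inj.
have icE j : form_slot j = rshift q (rshift 1 (lift ord0 j : 'I_k.+1)) by apply: val_inj.
have gam_ib i : gam i alpha_slot = alpha_slot.
  by rewrite /gam ibE (shift_perm_rshift q (k := 1 + k.+1)) (shift_perm_lshift (q := 1)).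
have gam_id i : gam i deriv_slot = rshift q (rshift 1 i).
  by rewrite /gam idE (shift_perm_rshift q (k := 1 + k.+1)) (shift_perm_rshift 1) lift_perm_id.
have gam_ic i j : gam i (form_slot j) = rshift q (rshift 1 (lift i j)).
  by rewrite /gam icE (shift_perm_rshift q (k := 1 + k.+1)) (shift_perm_rshift 1) lift_perm_lift
    perm1.
have gam_odd i : (-1) ^+ gam i = (-1) ^+ i :> R.
  by rewrite /gam !odd_shift_perm !odd_lift_perm odd_perm1 /= addbF signr_odd.
have shuffle (a b c d f' : R) : a * b * (c * d * f') = b * (c * d) * (a * f').
  by ring.
have k0 : k.+1%:R != 0 :> R by rewrite pnatr_eq0.
apply: (mulfI k0); rewrite mulr0 mulr_natl -[k.+1]card_ord -sumr_const.
rewrite (eq_bigr (fun i => \sum_(s : 'S_N) (-1) ^+ (gam i * s)%g * f (gam i * s)%g)); last first.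
  by move=> i _; exact: (reindex_inj (mulgI (gam i))).
rewrite exchange_big big1 //= => s _.
rewrite (eq_bigr (fun i : 'I_k.+1 => (-1) ^+ s * (conormal x (w \o s) * alpha x (w (s
  alpha_slot))) *
   ((-1) ^+ i * 'D_(w (s (rshift q (rshift 1 i))))
      (fun y => A y (fun j => w (s (rshift q (rshift 1 (lift i j))))) : R^o) x))); last first.
  move=> i _; rewrite odd_permM signr_addb gam_odd /f !permM gam_ib gam_id.
  have -> : conormal x (w \o (gam i * s)%g) = conormal x (w \o s).
    by apply: eq_bigr => a _ /=; rewrite permM gam_ia.
  have -> : (fun y => A y (fun j => w ((gam i * s)%g (form_slot j)))) =
      (fun y => A y (fun j => w (s (rshift q (rshift 1 (lift i j)))))).
    by apply/funext => y; congr (A y _); apply/funext => j; rewrite permM gam_ic.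
  exact: shuffle.
rewrite -mulr_sumr.
have [c0|c0] := eqVneq (conormal x (w \o s)) 0; first by rewrite c0 mul0r mulr0 mul0r.
have [_ Tw] := conormal_frame c0.
rewrite [X in _ * X](_ : _ = ext_deriv A x (fun i => w (s (rshift q (rshift 1 i))))) //.
by rewrite dA ?mulr0 // => i; exact: Tw.
Qed.

End DensityAtFocalPoint.

Section PositiveDensity.
Variable x : V.
Hypothesis Mx : M x.
Variable fr : 'I_(2 + k) -> V.
Hypothesis Tfr : forall i, tangent M x (fr i).
Local Notation w := (full_frame x fr).

Lemma density_frame : density x w =
  \sum_(s : 'S_N) (-1) ^+ s * (conormal x (w \o s) * alpha (w (s deriv_slot)) (w (s alpha_slot)) *
     tform x (fun j => w (s (form_slot j)))).
Proof.
rewrite /density; under eq_bigr do rewrite density_term_expand // !mulrDr.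
rewrite !big_split /= sum_tform_derivative // addr0.
by rewrite [X in X + _](sum_conormal_derivative x fr) add0r.
Qed.

(** The terms of the product of the differential of [alpha] with [Om] on the
   tangent frame. *)
Definition arrangement (s : 'S_(2 + k)) : R := (-1) ^+ s *
  (dot (fr (s (lshift k 1))) (S *m fr (s (lshift k 0))) *
   Om x (fun a => fr (s (rshift 2 a)))).

Lemma arrangement_term (t : 'S_(2 + k)) : let s := shift_perm q t in
  (-1) ^+ s * (conormal x (w \o s) * alpha (w (s deriv_slot)) (w (s alpha_slot)) *
     tform x (fun j => w (s (form_slot j)))) = arrangement t.
Proof.
cbv zeta; rewrite odd_shift_perm /deriv_slot /alpha_slot !shift_perm_rshift !full_frame_tangent.
rewrite /conormal big1 ?mul1r.
  rewrite /arrangement /alpha; congr (_ * (_ * _)).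
  rewrite /tform retraction_id //; congr (Om x _); apply/funext => j.
  by rewrite /form_slot shift_perm_rshift full_frame_tangent tproj_id.
by move=> a _; rewrite /= /normal_slot shift_perm_lshift full_frame_normal normal_dot // eqxx.
Qed.

Lemma density_gt0 : (forall s, 0 <= arrangement s) ->
  (exists s, 0 < arrangement s) -> 0 < density x w.
Proof.
move=> ge0 [t0 gt0]; rewrite density_frame (bigD1 (shift_perm q t0)) //=.
rewrite arrangement_term ltr_pwDl //; apply: sumr_ge0 => s _.
have [c0|c0] := eqVneq (conormal x (w \o s)) 0; first by rewrite c0 !mul0r mulr0.
have [fix_ia _] := conormal_frame Mx Tfr c0.
have [t ->] := shift_permP fix_ia.
by rewrite arrangement_term.
Qed.

(** The density is alternating and multilinear, so that its values on the standard
   basis and on the frame differ by a determinant. *)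
Lemma density_basis_neq0 : (forall s, 0 <= arrangement s) ->
  (exists s, 0 < arrangement s) -> density x e != 0.
Proof.
move=> ge0 gt0; have := density_gt0 ge0 gt0.
apply: contraL => /eqP D0.
by rewrite -leNgt /density (signed_multilinear_eq0 w (density_term_multilinear (focal_Dom Mx)) D0).
Qed.

End PositiveDensity.

Section Cutoff.

(** The failure of the equations that define the focal submanifold. *)
Definition gap a (y : V) : R := dot (normal_vec a y) y - (a == ord0)%:R.
Definition defect (y : V) : R := \sum_a gap a y ^+ 2.

Lemma lift_eq0 n (i : 'I_n) : (lift ord0 i == ord0) = false.
Proof. by rewrite eq_sym (negbTE (neq_lift _ _)). Qed.

Lemma gap_focal y : (forall a, gap a y = 0) -> M y.
Proof.
move=> H; split.
  by have /eqP := H ord0; rewrite /gap eqxx /normal_vec /normal_mx fcons0 mul1mx subr_eq0 => /eqP.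
move=> i; have /eqP := H (lift ord0 i).
by rewrite /gap lift_eq0 subr0 /normal_vec /normal_mx fconsS => /eqP.
Qed.

Lemma focal_gap y a : M y -> gap a y = 0.
Proof.
move=> [y1 Py]; rewrite /gap /normal_vec /normal_mx.
case: (unliftP ord0 a) => [i|] ->.
  by rewrite fconsS Py lift_eq0 subr0.
by rewrite fcons0 mul1mx y1 eqxx subrr.
Qed.

Lemma is_derive_gap a y v :
  is_derive y v (fun y => gap a y : R^o) (2 * dot (normal_vec a y) v).
Proof.
have := is_deriveB (is_derive_quadratic_form y v (normal_mx_sym a))
  (is_derive_cst ((a == ord0)%:R : R^o) y v).
by rewrite subr0.
Qed.

Lemma Ck_gap n a (U : set V) : open U -> Ck n U (fun y => gap a y : R^o).
Proof.
move=> oU; apply: CkD => //; last exact: Ck_cst.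
exact: (Ck_dot oU (Ck_mulmx oU (normal_mx a) (@Ck_entries_id _ _ n U)) (@Ck_entries_id _ _ n U)).
Qed.

Lemma Ck_defect n (U : set V) : open U -> Ck n U (fun y => defect y : R^o).
Proof.
by move=> oU; apply: Ck_sum => // a _; apply: CkM => //; exact: Ck_gap.
Qed.

Lemma defect_ge0 y : 0 <= defect y.
Proof. by apply: sumr_ge0 => a _; exact: sqr_ge0. Qed.

Lemma defect_eq0 y : defect y = 0 -> M y.
Proof.
move=> /eqP; rewrite psumr_eq0 => [/allP H|a _]; last exact: sqr_ge0.
by apply: gap_focal => a; have := H a; rewrite mem_index_enum sqrf_eq0 => /(_ isT) /eqP.
Qed.

Lemma focal_defect y : M y -> defect y = 0.
Proof. by move=> My; rewrite /defect big1 // => a _; rewrite focal_gap // expr0n. Qed.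

Lemma is_derive_defect y v : is_derive y v (fun y => defect y : R^o)
  (\sum_a 4 * gap a y * dot (normal_vec a y) v).
Proof.
rewrite [X in is_derive _ _ X](_ : _ = \sum_a (fun y => gap a y * gap a y : R^o)); last first.
  by apply/funext => z; rewrite fct_sumE; apply: eq_bigr.
apply: is_derive_fsum => a.
have D := is_derive_gap a y v.
apply: is_derive_eq (is_deriveM D D) _; rewrite /GRing.scale /=; ring.
Qed.

Lemma defect_bounded y : defect y < 1 -> `|y| <= 2.
Proof.
move=> Dy.
have g1 : gap ord0 y ^+ 2 < 1.
  apply: le_lt_trans Dy; rewrite /defect (bigD1 ord0) //= lerDl.
  by apply: sumr_ge0 => a _; exact: sqr_ge0.
have : dot y y < 2.
  move: g1; rewrite /gap eqxx /normal_vec /normal_mx fcons0 mul1mx -[true%:R]/(1 : R).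
  move: (dot y y) => t t1; nra.
move=> yy; apply: mx_norm_le_entry => // j i; rewrite ord1.
have : y j 0 ^+ 2 <= dot y y.
  rewrite /dot (bigD1 j) //= -expr2 lerDl.
  by apply: sumr_ge0 => l _; rewrite -expr2; exact: sqr_ge0.
move=> yj; rewrite ler_norml; apply/andP; split; nra.
Qed.

Variable eps : R.
Hypothesis eps0 : 0 < eps.

(** Twice the square of the positive part of [eps - defect y]. *)
Definition cutoff y : R := (eps - defect y) * `|eps - defect y| + (eps - defect y) ^+ 2.

Lemma cutoff_ge0 y : 0 <= cutoff y.
Proof.
rewrite /cutoff; move: (eps - defect y) => z; have [z0|z0] := lerP 0 z.
  by rewrite ger0_norm // addr_ge0 ?sqr_ge0 // mulr_ge0.
by rewrite ltr0_norm // mulrN -expr2 addNr.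
Qed.

Lemma cutoff_out y : eps <= defect y -> cutoff y = 0.
Proof.
move=> H; rewrite /cutoff ler0_norm; last by rewrite subr_le0.
ring.
Qed.

Lemma cutoff_focal y : M y -> 0 < cutoff y.
Proof.
move=> My; rewrite /cutoff focal_defect // subr0 gtr0_norm //.
by rewrite addr_gt0 // ?exprn_gt0 // mulr_gt0.
Qed.

Lemma Ck_cutoff (U : set V) : open U -> Ck 1 U (fun y => cutoff y : R^o).
Proof.
move=> oU.
have Cz : Ck 1 U (fun y => eps - defect y : R^o).
  by apply: CkD => //; [exact: Ck_cst|apply: CkN => //; exact: Ck_defect].
exact: (CkD oU (Ck1_mulnorm oU Cz) (CkM oU Cz Cz)).
Qed.

(** The cutoff is a function of the defining functions, so that its differential
   is killed by the product of the conormal 1-forms. *)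
Lemma is_derive_cutoff y : exists c : 'I_q -> R, forall v,
  is_derive y v (fun y => cutoff y : R^o) (\sum_a c a * dot (normal_vec a y) v).
Proof.
pose z := eps - defect y.
exists (fun a => - (2 * `|z| + 2 * z) * (4 * gap a y)) => v.
have Dd := is_derive_defect y v.
have Dz : is_derive y v (fun y => eps - defect y : R^o) (0 - (\sum_a 4 * gap a y * dot
  (normal_vec a y) v)).
  exact: is_deriveB (is_derive_cst (eps : R^o) y v) Dd.
have dz : differentiable (fun y => eps - defect y : R^o) y.
  have [H _] : Ck 1 setT (fun y => eps - defect y : R^o); last exact: H.
  apply: CkD; [exact: openT|exact: Ck_cst|].
  by apply: CkN; [exact: openT|apply: Ck_defect; exact: openT].
have D1 := derive_mulnorm v dz.
have [_ E] := Dz; rewrite E in D1.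
apply: is_derive_eq (is_deriveD D1 (is_deriveM Dz Dz)) _.
rewrite -/z /GRing.scale /=.
have -> : \sum_a - (2 * `|z| + 2 * z) * (4 * gap a y) * dot (normal_vec a y) v =
   - (2 * `|z| + 2 * z) * \sum_a 4 * gap a y * dot (normal_vec a y) v.
  by rewrite mulr_sumr; apply: eq_bigr => a _; rewrite !mulrA.
ring.
Qed.

Lemma sum_cutoff_derivative y (w : 'I_N -> V) :
  \sum_(s : 'S_N) (-1) ^+ s *
    ('D_(w (s deriv_slot)) (fun y => cutoff y : R^o) y * prodform y (w \o s)) = 0.
Proof.
have [c Dc] := is_derive_cutoff y.
have E (s : 'S_N) : 'D_(w (s deriv_slot)) (fun y => cutoff y : R^o) y * prodform y (w \o s) =
   \sum_a c a * dot (normal_vec a y) (w (s deriv_slot)) * prodform y (w \o s).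
  by have [_ ->] := Dc (w (s deriv_slot)); rewrite mulr_suml.
under eq_bigr do rewrite E mulr_sumr.
rewrite exchange_big big1 //= => a _.
have aid : normal_slot a != deriv_slot by rewrite normal_deriv_slot.
apply: (signed_sum_sym aid) => s; rewrite !permM tpermR.
have T i : normal_slot a != i -> deriv_slot != i -> tperm (normal_slot a) deriv_slot i = i by
  exact: tpermD.
rewrite /prodform /= permM (T alpha_slot) ?normal_alpha_slot // 1?eq_sym ?alpha_deriv_slot //.
have -> : (fun j => (w \o (tperm (normal_slot a) deriv_slot * s)%g) (form_slot j)) = (fun j => (w
  \o s) (form_slot j)).
  by apply/funext => j /=; rewrite permM (T (form_slot j)) ?normal_form_slot ?deriv_form_slot.
have CE (s' : 'S_N) : conormal y (w \o s') = dot (normal_vec a y) (w (s' (normal_slot a))) *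
    \prod_(b | b != a) dot (normal_vec b y) (w (s' (normal_slot b))).
  by rewrite /conormal (bigD1 a).
rewrite !CE permM tpermL.
have -> : \prod_(b | b != a) dot (normal_vec b y) (w ((tperm (normal_slot a) deriv_slot * s)%g
  (normal_slot b))) =
   \prod_(b | b != a) dot (normal_vec b y) (w (s (normal_slot b))).
  apply: eq_bigr => b ba; rewrite permM (T (normal_slot b)) // ?(inj_eq normal_slot_inj) //
    eq_sym //.
  by rewrite normal_deriv_slot.
set f1 := alpha _ _; set f2 := tform _ _; set f3 := \prod_(_ | _) _.
set d1 := dot _ _; set d2 := dot _ _.
have shuffle (c0 x1 x2 x3 x4 x5 : R) : c0 * x1 * (x2 * x3 * x4 * x5) = c0 * x2 * (x1 * x3 * x4 *
  x5) by ring.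
exact: shuffle.
Qed.

End Cutoff.

(** Stokes' theorem. If the density had no zero on the focal submanifold, it would
   have none where the cutoff is positive, for [eps] small. Then the product of
   [prodform], the cutoff and the sign of the density yields a compactly
   supported vector field with divergence the cutoff times the absolute value of
   the density, against [no_positive_divergence]. *)
Theorem density_vanishes : (exists x, M x) -> exists2 x, M x & density x e = 0.
Proof.
move=> [x0 Mx0]; apply: contrapT => noz.
have dens0 x : M x -> density x e != 0.
  by move=> Mx; apply/eqP => d0; apply: noz; exists x.
have oD := @open_disc_pos _ _ _ P.
pose W := [set y | Dom y /\ density y e != 0].
have oW : open W.
  rewrite openE => y [Dy dy].
  apply: filterI; first exact: open_nbhs_nbhs.
  have C := density_continuous (w := e) Dy.
  apply: (C [set z : R^o | z != 0]).
  by apply: open_nbhs_nbhs; split => //; exact: open_neq.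
have MW x : M x -> W x by move=> Mx; split; [exact: focal_Dom|exact: dens0].
(* A neighbourhood of the focal submanifold on which the density has no zero. *)
have [eps /andP[eps0 eps1] Heps] : exists2 eps, 0 < eps < 1 & forall y, defect y <= eps -> W y.
  pose K := [set y : V | `|y| <= 2] `&` ~` W.
  have cK : compact K.
    apply: (subclosed_compact _ (@closed_ball_compact R N 2)); last by move=> y [].
    apply: closedI; last exact: open_closedC.
    apply: (@closed_comp _ _ (fun y : V => `|y|) [set x | x <= 2]) => [y _|]; last exact: closed_le.
    exact: norm_continuous.
  have small y : defect y <= 2^-1 -> ~ W y -> K y.
    by move=> dy nW; split => //; apply: defect_bounded; lra.
  have [K0|/set0P K0] := eqVneq K set0.
    exists 2^-1 => [|y dy]; first by apply/andP; split; lra.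
    apply: contrapT => nW.
    by have := small y dy nW; rewrite K0.
  have cf : {within K, continuous (fun y => defect y : R^o)}.
    apply: continuous_subspaceT => y.
    exact: (Ck_continuous (Ck_defect 0 openT)).
  have [y0 y0K ymin] := compact_EVT_min K0 cK cf.
  have d0 : 0 < defect y0.
    rewrite lt_neqAle defect_ge0 andbT eq_sym; apply/eqP => dy0.
    by move: y0K; rewrite inE => -[_]; apply; apply: MW; exact: defect_eq0.
  exists (Num.min 2^-1 (defect y0 / 2)); first by rewrite lt_min divr_gt0 // gt_min andbT;
    apply/andP; split => //; lra.
  move=> y; rewrite le_min => /andP[y1 y2]; apply: contrapT => nW.
  have := ymin y; rewrite inE => /(_ (small y y1 nW)) => /le_trans /(_ y2).
  by rewrite ler_pdivlMr // mulr_natr mulr2n -subr_le0 addrK leNgt d0.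
pose kap y : R := Num.sg (density y e).
pose H (s : 'S_N) y : R := kap y * (cutoff eps y * prodform y (e \o s)).
(* Near a point of [W] the sign is constant; away from [W] the cutoff is zero. *)
have near_kap y : W y -> exists U : set V, [/\ open U, U y, U `<=` W & forall y', U y' -> kap y'
  = kap y].
  move=> [Dy dy].
  have Wy : W y by split.
  pose U := [set y' | W y' /\ 0 < density y e * density y' e].
  exists U; split.
  - rewrite openE => y' [Wy' cy']; apply: filterI; first exact: open_nbhs_nbhs.
    have cd : {for y', continuous (fun z => density y e * density z e : R^o)}.
      by apply: continuousM; [exact: cst_continuous|apply: density_continuous; exact: Wy'.1].
    by apply: (cd [set z : R^o | 0 < z]); apply: open_nbhs_nbhs; split => //; exact: open_gt.
  - by split => //; rewrite -expr2 exprn_even_gt0.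
  - by move=> y' [].
  move=> y' [_ /gtr0_sg]; rewrite sgrM => E; rewrite /kap.
  by rewrite -[RHS]mulr1 -E mulrA -expr2 sqr_sg dy mul1r.
have H_W (s : 'S_N) y : W y -> exists U : set V, [/\ open U, U y, U `<=` W &
    forall y', U y' -> kap y * (cutoff eps y' * prodform y' (e \o s)) = H s y'].
  move=> /near_kap [U [oU Uy UW kU]]; exists U; split;
    [exact: oU|exact: Uy|exact: UW|move=> y' Uy'].
  by rewrite /H kU.
have H_out (s : 'S_N) y : ~ W y -> exists U : set V, [/\ open U, U y & forall y', U y' -> 0 = H s
  y'].
  move=> nW; exists [set y | 0 < defect y - eps]; split.
  - apply: (open_Ck_pos (f := fun y => defect y - eps : R^o)).
    exact: (CkD openT (Ck_defect 0 openT) (Ck_cst 0 _ (- eps : R^o))).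
  - by rewrite /= subr_gt0 ltNge; apply/negP => /Heps.
  - by move=> y' /= y'e; rewrite /H cutoff_out ?mul0r ?mulr0 // ltW // -subr_gt0.
have Cprod (s : 'S_N) (U : set V) : open U -> U `<=` W -> Ck 1 U (fun y => cutoff eps y *
  prodform y (e \o s) : R^o).
  move=> oU UW; apply: (CkM oU); first exact: Ck_cutoff.
  by apply: Ck_subset (Ck_prodform 1 (e \o s)) => y /UW [].
have CH (s : 'S_N) : Ck 1 setT (fun y => H s y : R^o).
  apply: Ck_local => y _; have [Wy|nW] := pselect (W y).
    have [U [oU Uy UW EU]] := H_W s y Wy; exists U; split => //.
    exact: Ck_ext (CkM oU (Ck_cst 1 U (kap y : R^o)) (Cprod s U oU UW)).
  have [U [oU Uy EU]] := H_out s y nW; exists U; split => //.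
  exact: Ck_ext (Ck_cst 1 U (0 : R^o)).
pose Y (i : 'I_N) y : R^o := \sum_(s : 'S_N | s deriv_slot == i) (-1) ^+ s * H s y.
have CY i : Ck 1 setT (Y i).
  apply: Ck_sum; first exact: openT.
  by move=> s _; apply: CkM; [exact: openT|exact: Ck_cst|exact: CH].
have divY y : \sum_i 'D_(e i) (Y i) y = if `[< W y >] then cutoff eps y * `|density y e| else 0.
  have dH (s : 'S_N) : differentiable (fun y => H s y : R^o) y by have [D _] := CH s; exact: D.
  have DY i : 'D_(e i) (Y i) y = \sum_(s : 'S_N | s deriv_slot == i) (-1) ^+ s * 'D_(e i) (fun y
    => H s y : R^o) y.
    have DHs (s : 'S_N) : is_derive y (e i) ((-1) ^+ s *: (fun y => H s y : R^o))
        ((-1) ^+ s *: 'D_(e i) (fun y => H s y : R^o) y).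
      exact/is_deriveZ/derivableP/diff_derivable.
    have := is_derive_fsum [seq s : 'S_N <- index_enum {perm 'I_N} | s deriv_slot == i] DHs.
    rewrite !big_filter => -[_ <-]; congr ('D_(e i) _ y); apply/funext => z.
    by rewrite fct_sumE.
  under eq_bigr do rewrite DY.
  rewrite (eq_bigr (fun i => \sum_(s : 'S_N | s deriv_slot == i)
     (-1) ^+ s * 'D_(e (s deriv_slot)) (fun y => H s y : R^o) y)); last first.
    by move=> i _; apply: eq_bigr => s /eqP ->.
  rewrite [LHS](_ : _ = \sum_(s : 'S_N) (-1) ^+ s * 'D_(e (s deriv_slot)) (fun y => H s y : R^o)
    y); last first.
    by rewrite [RHS](partition_big (fun s : 'S_N => s deriv_slot) xpredT).
  case: asboolP => [Wy|nW]; last first.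
    rewrite big1 // => s _; have [U [oU Uy EU]] := H_out s y nW.
    rewrite (@near_eq_derive _ _ _ _ (cst (0 : R^o))) ?derive_cst ?mulr0 //.
    by apply: filterS (open_nbhs_nbhs (conj oU Uy)) => z Uz; rewrite -EU.
  have E (s : 'S_N) : 'D_(e (s deriv_slot)) (fun y => H s y : R^o) y =
      kap y * ('D_(e (s deriv_slot)) (fun y => cutoff eps y : R^o) y * prodform y (e \o s)) +
      kap y * cutoff eps y * density_term y (e \o s).
    have [U [oU Uy _ EU]] := H_W s y Wy.
    rewrite -(@near_eq_derive _ _ _ (kap y *: ((fun y => cutoff eps y : R^o) * (fun y => prodform
      y (e \o s) : R^o)))); last first.
      by apply: filterS (open_nbhs_nbhs (conj oU Uy)) => z Uz; rewrite -EU.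
    have dc : differentiable (fun y => cutoff eps y : R^o) y.
      by have [D _] := Ck_cutoff eps openT; exact: D.
    have dp : differentiable (fun y => prodform y (e \o s) : R^o) y.
      exact/differentiable_prodform/Wy.1.
    rewrite deriveZ; last exact/derivableM/diff_derivable/dp/diff_derivable.
    rewrite deriveM; [|exact: diff_derivable|exact: diff_derivable].
    have shuffle (a b c d f : R) : a * (b * c + d * f) = a * (f * d) + a * b * c by ring.
    exact: shuffle.
  under eq_bigr do rewrite E mulrDr.
  rewrite big_split /= [X in X + _](_ : _ = 0) ?add0r.
    rewrite /= normrEsg mulrA [_ * kap y]mulrC.
    rewrite /density mulr_sumr; apply: eq_bigr => s _.
    by rewrite mulrCA.
  have S0 := congr1 (fun t => kap y * t) (sum_cutoff_derivative eps y e).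
  rewrite mulr0 in S0; rewrite -[RHS]S0 [RHS]mulr_sumr.
  by apply: eq_bigr => s _; rewrite mulrCA.
apply: (@no_positive_divergence R N Y 2 x0).
- by move=> i y; have [D _] := CY i; exact: D.
- by move=> i y; have [_ D] := CY i; exact: D.
- move=> i y y2; rewrite /Y big1 // => s _.
  rewrite /H cutoff_out ?mul0r ?mulr0 //.
  have [dy|//] := ltP (defect y) eps.
  by have := defect_bounded (lt_trans dy eps1); rewrite leNgt y2.
- move=> y; rewrite divY; case: asboolP => // _; rewrite mulr_ge0 //; exact: cutoff_ge0.
rewrite divY; case: asboolP => [_|]; last by have := MW _ Mx0.
by rewrite mulr_gt0 ?cutoff_focal // normr_gt0 dens0.
Qed.

End Stokes.

(** * The obstruction to balanced metrics *)

Section Obstruction.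
Variables (R : realType) (m p : nat).
Local Notation N := (m.+2 + (2 + p.*2))%N.
Local Notation V := 'cV[R]_N.
Variables (P : 'I_m.+1 -> 'M[R]_N) (J : V -> V -> V) (S : 'M[R]_N).
Local Notation M := (focal P).

(** At a zero of the density given by Stokes' theorem, choose a frame that is
   unitary for [g] and starts with a multiple of the vector on which [S] is
   positive. All terms of the differential of [alpha] times the power of the
   Kahler form have the same sign on it, and the first one is not zero. *)
Theorem no_closed_kahler_power (g : V -> V -> V -> R) :
  clifford P -> (0 < m)%N -> (m.*2 < N)%N -> S^T = - S ->
  (forall x, M x -> linear_on (tangent M x) (J x)) ->
  (forall x u, M x -> tangent M x u ->
     [/\ tangent M x (J x u), J x (J x u) = - u & 0 <= dot (S *m u) (J x u)]) ->
  (forall x, M x -> exists2 u, tangent M x u & 0 < dot (S *m u) (J x u)) ->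
  hermitian_metric M J g ->
  ~ is_ext_deriv M (fun x => wedge_pow (kahler_form J g x) (p := p)) (fun _ _ => 0).
Proof.
move=> cP m0 mN Sskew lJ HJ HJ0 [[_ lg gC g_gt0] gJ] closed.
have [x Mx] : exists2 x, M x & density P (fun x => wedge_pow (kahler_form J g x) (p := p)) S x
  (@basis_vec R N) = 0.
  exact: (density_vanishes cP S closed (focal_nonempty cP mN m0)).
apply/eqP.
have TE : tangent M x = orth_space (fun a => normal_vec P a x).
  by apply/seteqP; split=> v /tangent_normalP; apply.
have [u0 Tu0 u0pos] := HJ0 x Mx.
have u00 : u0 != 0.
  by apply: contraTneq u0pos => ->; rewrite mulmx0 dot0l ltxx.
pose proj : 'M[R]_N := 1%:M - \sum_a normal_vec P a x *m (normal_vec P a x)^T.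
have projE v : proj *m v = tproj P x v.
  rewrite /proj mulmxBl mul1mx /tproj; congr (_ - _).
  rewrite mulmx_suml; apply: eq_bigr => a _.
  by rewrite -mulmxA [_^T *m v]mx11_scalar mul_mx_scalar -dotE.
have projT v : orth_space (fun a => normal_vec P a x) (proj *m v).
  by rewrite projE -TE; exact: tproj_tangent.
have proj_id v : orth_space (fun a => normal_vec P a x) v -> proj *m v = v.
  by rewrite -TE projE => Tv; exact: tproj_id.
have NE : N = (m.+2 + p.+1.*2)%N by [].
have [w [c [Tw sw Jw c0 w0]]] :
   exists (w : 'I_(p.+1.*2) -> V) c,
    [/\ forall i, tangent M x (w i),
        symplectic_frame (fun u v => g x (J x u) v) w,
        forall i j : 'I_(p.+1.*2), i./2 = j./2 -> (i < j)%N -> w j = J x (w i),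
        0 < c & forall i : 'I_(p.+1.*2), i = 0%N :> nat -> w i = c *: u0].
  have lgT u : tangent M x u -> linear_on (tangent M x) (g x u : V -> R^o) by exact: lg.
  have gCT u v : tangent M x u -> tangent M x v -> g x u v = g x v u by exact: gC.
  have gT u : tangent M x u -> u != 0 -> 0 < g x u u by exact: g_gt0.
  have JT u : tangent M x u -> tangent M x (J x u) by move=> /(HJ _ _ Mx)[].
  have JJT u : tangent M x u -> J x (J x u) = - u by move=> /(HJ _ _ Mx)[].
  have gJT u v : tangent M x u -> tangent M x v -> g x (J x u) (J x v) = g x u v by exact: gJ.
  rewrite TE in lgT gCT gT JT JJT gJT Tu0 *.
  exact: (unitary_frame_exists lgT gCT gT JT JJT gJT projT proj_id NE).
have SC u v : dot u (S *m v) = - dot (S *m u) v.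
  by rewrite dot_mull Sskew mulNmx dotNr opprK.
pose sg (u v : V) := dot v (S *m u).
have sg_ge0 (i j : 'I_(2 + p.*2)) : 0 <= sympl_entry R i j * sg (w i) (w j).
  rewrite /sympl_entry; case: eqP => [ij|_]; last by rewrite mul0r.
  have [lt_ij|lt_ji|_] := ltngtP i j; last by rewrite subrr mul0r.
    have [_ _] := HJ _ _ Mx (Tw i).
    by rewrite (Jw i j ij lt_ij) subr0 mul1r /sg dotC.
  have [_ _] := HJ _ _ Mx (Tw j).
  by rewrite (Jw j i (esym ij) lt_ji) sub0r mulN1r /sg SC opprK.
have T := wedge_term (@wedge_pow_sign_gt0 R V (fun u v => g x (J x u) v) p) sw sg_ge0.
apply: (density_basis_neq0 cP closed Mx Tw).
  by move=> s; exact: (T s).1.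
exists 1%g; apply: (T 1%g).2; rewrite !perm1.
pose i0 : 'I_(2 + p.*2) := lshift p.*2 (0 : 'I_2).
pose i1 : 'I_(2 + p.*2) := lshift p.*2 (1 : 'I_2).
rewrite -/i0 -/i1.
have w1 : w i1 = c *: J x u0.
  rewrite (Jw i0 i1) // (w0 i0) //.
  rewrite (linear_onZ (lJ x Mx)) //.
  by rewrite TE; exact: orth_space0.
rewrite /sg w1 (w0 i0) // -scalemxAr dotZl dotZr dotC.
by rewrite /sympl_entry /= subr0 mul1r !mulr_gt0.
Qed.

End Obstruction.

(** The dimension is split up to an equation only, so as to apply to matrices of
   size [2 * l]. *)
Theorem no_closed_kahler_power_dim (R : realType) (N m p : nat)
    (P : 'I_m.+1 -> 'M[R]_N) (J : 'cV[R]_N -> 'cV[R]_N -> 'cV[R]_N)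
    (S : 'M[R]_N) (g : 'cV[R]_N -> 'cV[R]_N -> 'cV[R]_N -> R) :
  N = (m.+2 + (2 + p.*2))%N ->
  clifford P -> (0 < m)%N -> (m.*2 < N)%N -> S^T = - S ->
  (forall x, focal P x -> linear_on (tangent (focal P) x) (J x)) ->
  (forall x u, focal P x -> tangent (focal P) x u ->
     [/\ tangent (focal P) x (J x u), J x (J x u) = - u & 0 <= dot (S *m u) (J x u)]) ->
  (forall x, focal P x ->
     exists2 u, tangent (focal P) x u & 0 < dot (S *m u) (J x u)) ->
  hermitian_metric (focal P) J g ->
  ~ is_ext_deriv (focal P) (fun x => wedge_pow (kahler_form J g x) (p := p)) (fun _ _ => 0).
Proof. by move=> NE; subst N; exact: no_closed_kahler_power. Qed.

(** * The case of three matrices *)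

Section ThreeMatrices.
Variables (R : realType) (N : nat) (P : 'I_3 -> 'M[R]_N).
Local Notation V := 'cV[R]_N.
Hypothesis cP : clifford P.
Local Notation a := (P 0).
Local Notation b := (P 1).
Local Notation c := (P 2).
Local Notation M := (focal P).

Lemma ord3P (Q : 'I_3 -> Prop) : Q 0 -> Q 1 -> Q 2 -> forall i, Q i.
Proof.
move=> Q0 Q1 Q2 [[|[|[|//]]] ilt].
- by rewrite (_ : Ordinal ilt = 0) //; exact: val_inj.
- by rewrite (_ : Ordinal ilt = 1) //; exact: val_inj.
- by rewrite (_ : Ordinal ilt = 2) //; exact: val_inj.
Qed.

Let sqv i (v : V) : P i *m (P i *m v) = v. Proof. exact: clifford_sqv. Qed.
Let ba (v : V) : b *m (a *m v) = - (a *m (b *m v)). Proof. exact: clifford_antiv. Qed.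
Let ca (v : V) : c *m (a *m v) = - (a *m (c *m v)). Proof. exact: clifford_antiv. Qed.
Let cb (v : V) : c *m (b *m v) = - (b *m (c *m v)). Proof. exact: clifford_antiv. Qed.
Let da (u v : V) : dot (a *m u) v = dot u (a *m v). Proof. exact: dot_clifford. Qed.
Let db (u v : V) : dot (b *m u) v = dot u (b *m v). Proof. exact: dot_clifford. Qed.
Let dc (u v : V) : dot (c *m u) v = dot u (c *m v). Proof. exact: dot_clifford. Qed.

Let self0 (t : R) : t = - t -> t = 0. Proof. lra. Qed.

(* Normal form of a product of matrices applied to a vector: sorted letters. *)
Let sort3 := (ba, ca, cb, sqv, @mulmxN, @opprK).

Lemma skew3 (v : V) : [/\ dot v (a *m (b *m v)) = 0, dot v (a *m (c *m v)) = 0,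
  dot v (b *m (c *m v)) = 0 & dot v (a *m (b *m (c *m v))) = 0].
Proof.
split; apply: self0; rewrite {1}dotC ?(da, db, dc) ?sort3 ?dotNr ?opprK //.
Qed.

Variable J : V -> V -> V.
Hypothesis HJ : forall x, M x ->
    let T := tangent M x in
    let e1 := P 0 *m P 1 *m x in
    let e2 := P 0 *m P 1 *m P 2 *m x in
    [/\ linear_on T (J x), J x e1 = e2, J x e2 = - e1 &
        forall X, orth_compl T [:: e1; e2] X -> J x X = P 0 *m P 1 *m X].

Section AtPoint.
Variable x : V.
Hypothesis Mx : M x.
Local Notation T := (tangent M x).
Local Notation e1 := (a *m (b *m x)).
Local Notation e2 := (a *m (b *m (c *m x))).

Lemma tangent3P v : T v <->
  [/\ dot x v = 0, dot x (a *m v) = 0, dot x (b *m v) = 0 & dot x (c *m v) = 0].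
Proof.
rewrite tangent_focalP // -!(da, db, dc); split=> [[? H]|[? ? ? ?]]; first by split.
by split => //; exact: ord3P.
Qed.

Let xx : dot x x = 1. Proof. by have [] := Mx. Qed.
Let xa : dot x (a *m x) = 0. Proof. by rewrite dotC; have [_] := Mx. Qed.
Let xb : dot x (b *m x) = 0. Proof. by rewrite dotC; have [_] := Mx. Qed.
Let xc : dot x (c *m x) = 0. Proof. by rewrite dotC; have [_] := Mx. Qed.
Let xab : dot x (a *m (b *m x)) = 0. Proof. by have [] := skew3 x. Qed.
Let xac : dot x (a *m (c *m x)) = 0. Proof. by have [] := skew3 x. Qed.
Let xbc : dot x (b *m (c *m x)) = 0. Proof. by have [] := skew3 x. Qed.
Let xabc : dot x (a *m (b *m (c *m x))) = 0. Proof. by have [] := skew3 x. Qed.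
Let table := (xx, xa, xb, xc, xab, xac, xbc, xabc, @dotNr R N, @oppr0 R).

(** The complement of [e1] and [e2] in the tangent space, on which [J] is the
   product of the first two matrices. *)
Definition complex3 X := [/\ T X, dot x (a *m (b *m X)) = 0 & dot x (a *m (b *m (c *m X))) = 0].

Lemma complex3P X : complex3 X <-> orth_compl T [:: P 0 *m P 1 *m x; P 0 *m P 1 *m P 2 *m x] X.
Proof.
rewrite /complex3; split.
  move=> [TX X1 X2]; split => // e; rewrite !inE => /orP[/eqP->|/eqP->].
    by rewrite -!mulmxA !(da, db, dc) ?sort3 dotNr X1 oppr0.
  by rewrite -!mulmxA !(da, db, dc) ?sort3 dotNr X2 oppr0.
move=> [TX H]; split => //.
  have := H (P 0 *m P 1 *m x); rewrite !inE eqxx => /(_ isT).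
  by rewrite -!mulmxA !(da, db, dc) ?sort3 dotNr => /eqP; rewrite oppr_eq0 => /eqP.
have := H (P 0 *m P 1 *m P 2 *m x); rewrite !inE eqxx orbT => /(_ isT).
by rewrite -!mulmxA !(da, db, dc) ?sort3 dotNr => /eqP; rewrite oppr_eq0 => /eqP.
Qed.

Lemma tangent3_e : T e1 /\ T e2.
Proof. by split; apply/tangent3P; split; rewrite ?sort3 ?table. Qed.

Lemma complex3_I X : complex3 X -> complex3 (a *m (b *m X)).
Proof.
move=> [/tangent3P[Xx Xa Xb Xc] X1 X2]; split; first apply/tangent3P.
  by split; rewrite ?sort3 ?dotNr ?X1 ?X2 ?Xa ?Xb ?oppr0.
all: by rewrite ?sort3 ?dotNr ?Xx ?Xc ?oppr0.
Qed.

Lemma tangent_lin k u v : T u -> T v -> T (k *: u + v).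
Proof.
move=> /tangent3P[u1 u2 u3 u4] /tangent3P[v1 v2 v3 v4]; apply/tangent3P.
by split; rewrite ?mulmxDr -?scalemxAr dotDr dotZr ?(u1,u2,u3,u4,v1,v2,v3,v4) mulr0 addr0.
Qed.

Lemma decompose3 u : T u -> exists k1 k2 X, complex3 X /\ u = k1 *: e1 + (k2 *: e2 + X).
Proof.
move=> Tu; have [Te1 Te2] := tangent3_e.
pose k1 := dot e1 u; pose k2 := dot e2 u.
exists k1, k2, (- k1 *: e1 + (- k2 *: e2 + u)); split; last first.
  by rewrite !scaleNr [k2 *: _ + (_ + _)]addrCA !addNKr.
split; first by apply: tangent_lin => //; exact: tangent_lin.
  rewrite !(mulmxDr, =^~ scalemxAr) ?sort3 !(dotDr, dotZr) ?table.
  rewrite /k1 !(da, db, dc) ?sort3 ?table; ring.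
rewrite !(mulmxDr, =^~ scalemxAr) ?sort3 !(dotDr, dotZr) ?table.
rewrite /k2 !(da, db, dc) ?sort3 ?table; ring.
Qed.

Lemma J3E k1 k2 X : complex3 X ->
  J x (k1 *: e1 + (k2 *: e2 + X)) = k1 *: e2 + (- k2 *: e1 + a *m (b *m X)).
Proof.
move=> cX; have [lJ J1 J2 JX] := HJ Mx; have [Te1 Te2] := tangent3_e; have [TX _ _] := cX.
rewrite lJ //; last exact: tangent_lin.
have JXE := JX X ((complex3P X).1 cX).
rewrite lJ // JXE; move: J1 J2; rewrite -!mulmxA => -> ->.
by rewrite scalerN scaleNr.
Qed.

(** On [e1] and [e2] the product of the first two matrices takes values normal to
   the focal submanifold; on their complement it is [J] itself. So the scalar
   product is the square of the norm of the component in the complement. *)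
Lemma J3_tangent u : T u ->
  [/\ T (J x u), J x (J x u) = - u & 0 <= dot ((a *m b) *m u) (J x u)].
Proof.
move=> Tu; have [Te1 Te2] := tangent3_e.
have [k1 [k2 [X [cX ->]]]] := decompose3 Tu.
have cIX := complex3_I cX; have [TIX _ _] := cIX.
rewrite J3E // [k1 *: e2 + _]addrCA J3E //.
have TJ : T (- k2 *: e1 + (k1 *: e2 + a *m (b *m X))).
  by apply: tangent_lin => //; apply: tangent_lin.
split => //.
  by rewrite ?sort3 !opprD -!scaleNr addrCA.
set Ju := _ + _ in TJ *.
have -> : a *m b *m (k1 *: e1 + (k2 *: e2 + X)) =
    - k1 *: x + (- k2 *: (c *m x) + a *m (b *m X)).
  by rewrite -!mulmxA !(mulmxDr, =^~ scalemxAr) ?sort3 !(scaleNr, scalerN).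
have [J0 _ _ Jc] := (tangent3P Ju).1 TJ.
have [/(tangent3P X).1 [X0 Xa Xb Xc] X1 X2] := cX.
rewrite 2!dotDl 2!dotZl dc J0 Jc !mulr0 !add0r dotC /Ju.
rewrite !(dotDl, dotDr, dotZl) ?(da, db, dc) ?sort3 ?dotNr X0 Xc.
by rewrite !(oppr0, mulr0, add0r, opprK) dot_ge0.
Qed.

Lemma J3_positive : T (a *m (c *m x)) /\
  0 < dot ((a *m b) *m (a *m (c *m x))) (J x (a *m (c *m x))).
Proof.
have cX : complex3 (a *m (c *m x)).
  by split; [apply/tangent3P; split| |]; rewrite ?sort3 ?table.
have [TX _ _] := cX; split => //.
have [_ _ _ JX] := HJ Mx; rewrite (JX _ ((complex3P _).1 cX)).
by rewrite -!mulmxA !(da, db, dc) ?sort3 ?table ltr01.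
Qed.

End AtPoint.

Theorem no_closed_kahler_power3 p (g : V -> V -> V -> R) :
  N = (4 + (2 + p.*2))%N -> hermitian_metric M J g ->
  ~ is_ext_deriv M (fun x => wedge_pow (kahler_form J g x) (p := p)) (fun _ _ => 0).
Proof.
move=> NE; apply: (no_closed_kahler_power_dim NE cP _ _ (clifford_mul_skew cP (_ : 0 != 1))) => //.
- by rewrite NE.
- by move=> x Mx; have [] := HJ Mx.
- by move=> x u Mx Tu; exact: J3_tangent.
by move=> x Mx; exists (a *m (c *m x)); have [] := J3_positive Mx.
Qed.

End ThreeMatrices.

(** * The definite case of five matrices *)

Section FiveMatrices.
Variables (R : realType) (N : nat) (P : 'I_5 -> 'M[R]_N) (eps : R).
Local Notation V := 'cV[R]_N.
Hypothesis cP : clifford P.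
Local Notation a := (P 0).
Local Notation b := (P 1).
Local Notation c := (P 2).
Local Notation d := (P 3).
Local Notation M := (focal P).
Hypothesis eps1 : eps = 1 \/ eps = -1.
Hypothesis definite : P 0 *m P 1 *m P 2 *m P 3 *m P 4 = eps%:M.

Lemma ord5P (Q : 'I_5 -> Prop) : Q 0 -> Q 1 -> Q 2 -> Q 3 -> Q 4 -> forall i, Q i.
Proof.
move=> Q0 Q1 Q2 Q3 Q4 [[|[|[|[|[|//]]]]] ilt].
- by rewrite (_ : Ordinal ilt = 0) //; exact: val_inj.
- by rewrite (_ : Ordinal ilt = 1) //; exact: val_inj.
- by rewrite (_ : Ordinal ilt = 2) //; exact: val_inj.
- by rewrite (_ : Ordinal ilt = 3) //; exact: val_inj.
- by rewrite (_ : Ordinal ilt = 4) //; exact: val_inj.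
Qed.

Let eps_sq : eps * eps = 1. Proof. by case: eps1 => ->; ring. Qed.
Let sqv (i : 'I_5) (v : V) : P i *m (P i *m v) = v. Proof. exact: clifford_sqv. Qed.
Let ba (v : V) : b *m (a *m v) = - (a *m (b *m v)). Proof. exact: clifford_antiv. Qed.
Let ca (v : V) : c *m (a *m v) = - (a *m (c *m v)). Proof. exact: clifford_antiv. Qed.
Let da (v : V) : d *m (a *m v) = - (a *m (d *m v)). Proof. exact: clifford_antiv. Qed.
Let cb (v : V) : c *m (b *m v) = - (b *m (c *m v)). Proof. exact: clifford_antiv. Qed.
Let db (v : V) : d *m (b *m v) = - (b *m (d *m v)). Proof. exact: clifford_antiv. Qed.
Let dc (v : V) : d *m (c *m v) = - (c *m (d *m v)). Proof. exact: clifford_antiv. Qed.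
Let dota (u v : V) : dot (a *m u) v = dot u (a *m v). Proof. exact: dot_clifford. Qed.
Let dotb (u v : V) : dot (b *m u) v = dot u (b *m v). Proof. exact: dot_clifford. Qed.
Let dotc (u v : V) : dot (c *m u) v = dot u (c *m v). Proof. exact: dot_clifford. Qed.
Let dotd (u v : V) : dot (d *m u) v = dot u (d *m v). Proof. exact: dot_clifford. Qed.
Let move_left := (dota, dotb, dotc, dotd).

Let self0 (t : R) : t = - t -> t = 0. Proof. lra. Qed.
Let mulmxZ (i : 'I_5) k (v : V) : P i *m (k *: v) = k *: (P i *m v).
Proof. by rewrite -scalemxAr. Qed.

Let sort4 := (ba, ca, da, cb, db, dc, sqv, @mulmxN, @opprK, mulmxZ).

(** In the definite case the fifth matrix is, up to sign, the product of the other
   four: words in the first four matrices suffice. *)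
Lemma fifthE (v : V) : P 4 *m v = eps *: (a *m (b *m (c *m (d *m v)))).
Proof.
have : P 0 *m P 1 *m P 2 *m P 3 *m P 4 *m (P 4 *m v) = eps *: (P 4 *m v).
  by rewrite definite mul_scalar_mx.
rewrite -!mulmxA sqv => E.
by rewrite E scalerA eps_sq scale1r.
Qed.

Lemma skew4 (v : V) : [/\ dot v (a *m (b *m v)) = 0, dot v (a *m (c *m v)) = 0,
  dot v (a *m (d *m v)) = 0, dot v (b *m (c *m v)) = 0 & dot v (b *m (d *m v)) = 0] /\
  [/\ dot v (c *m (d *m v)) = 0, dot v (a *m (b *m (c *m v))) = 0,
  dot v (a *m (b *m (d *m v))) = 0, dot v (a *m (c *m (d *m v))) = 0 &
  dot v (b *m (c *m (d *m v))) = 0].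
Proof.
by split; split; apply: self0; rewrite {1}dotC ?move_left ?sort4 ?dotNr ?opprK.
Qed.

Variable J : V -> V -> V.
Hypothesis HJ : forall x, M x ->
    let T := tangent M x in
    let e01 := P 0 *m P 1 *m x in
    let e23 := P 2 *m P 3 *m x in
    let e24 := P 2 *m P 4 *m x in
    let e34 := P 3 *m P 4 *m x in
    [/\ linear_on T (J x),
        J x e01 = e34 /\ J x e34 = - e01,
        J x e23 = e24 /\ J x e24 = - e23 &
        forall X, orth_compl T [:: e01; e23; e24; e34] X ->
          J x X = P 0 *m P 1 *m X].

Section AtPoint.
Variable x : V.
Hypothesis Mx : M x.
Local Notation T := (tangent M x).
Local Notation v1 := (a *m (b *m x)).
Local Notation v2 := ((- eps) *: (a *m (b *m (c *m x)))).
Local Notation v3 := (c *m (d *m x)).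
Local Notation v4 := (eps *: (a *m (b *m (d *m x)))).

Lemma e24E : P 2 *m (P 4 *m x) = v4.
Proof. by rewrite fifthE ?sort4. Qed.

Lemma e34E : P 3 *m (P 4 *m x) = v2.
Proof. by rewrite fifthE ?sort4 scalerN scaleNr. Qed.

Lemma tangent5P v : T v <->
  [/\ dot x v = 0, dot x (a *m v) = 0, dot x (b *m v) = 0 & dot x (c *m v) = 0] /\
  dot x (d *m v) = 0 /\ dot x (a *m (b *m (c *m (d *m v)))) = 0.
Proof.
rewrite tangent_focalP // -!move_left.
have E : dot (d *m (c *m (b *m (a *m x)))) v = eps * dot (P 4 *m x) v.
  by rewrite fifthE dotZl mulrA eps_sq mul1r ?sort4 ?dotNl ?opprK.
rewrite E; split=> [[? H]|[[? ? ? ?] [? H]]]; first by rewrite !H mulr0.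
split => //; apply: ord5P => //.
by move: H => /(congr1 (fun t => eps * t)); rewrite mulrA eps_sq mul1r mulr0.
Qed.

Let xx : dot x x = 1. Proof. by have [] := Mx. Qed.
Let xa : dot x (a *m x) = 0. Proof. by rewrite dotC; have [_] := Mx. Qed.
Let xb : dot x (b *m x) = 0. Proof. by rewrite dotC; have [_] := Mx. Qed.
Let xc : dot x (c *m x) = 0. Proof. by rewrite dotC; have [_] := Mx. Qed.
Let xd : dot x (d *m x) = 0. Proof. by rewrite dotC; have [_] := Mx. Qed.
Let xab : dot x (a *m (b *m x)) = 0. Proof. by have [[]] := skew4 x. Qed.
Let xac : dot x (a *m (c *m x)) = 0. Proof. by have [[]] := skew4 x. Qed.
Let xad : dot x (a *m (d *m x)) = 0. Proof. by have [[]] := skew4 x. Qed.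
Let xbc : dot x (b *m (c *m x)) = 0. Proof. by have [[]] := skew4 x. Qed.
Let xbd : dot x (b *m (d *m x)) = 0. Proof. by have [[]] := skew4 x. Qed.
Let xcd : dot x (c *m (d *m x)) = 0. Proof. by have [_ []] := skew4 x. Qed.
Let xabc : dot x (a *m (b *m (c *m x))) = 0. Proof. by have [_ []] := skew4 x. Qed.
Let xabd : dot x (a *m (b *m (d *m x))) = 0. Proof. by have [_ []] := skew4 x. Qed.
Let xacd : dot x (a *m (c *m (d *m x))) = 0. Proof. by have [_ []] := skew4 x. Qed.
Let xbcd : dot x (b *m (c *m (d *m x))) = 0. Proof. by have [_ []] := skew4 x. Qed.
Let xabcd : dot x (a *m (b *m (c *m (d *m x)))) = 0.
Proof.
have [_ /(_ 4)] := Mx; rewrite fifthE dotZl dotC => /(congr1 (fun t => eps * t)).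
by rewrite mulrA eps_sq mul1r mulr0.
Qed.
Let table := (xx, xa, xb, xc, xd, xab, xac, xad, xbc, xbd, xcd, xabc, xabd, xacd,
  xbcd, xabcd, @dotNr R N, @oppr0 R, @dotZr R N, @mulr0 R).

(** The complement of [v1], [v2], [v3] and [v4] in the tangent space. *)
Definition complex5 X := T X /\ [/\ dot x (a *m (b *m X)) = 0, dot x (c *m (d *m X)) = 0,
  dot x (a *m (b *m (d *m X))) = 0 & dot x (a *m (b *m (c *m X))) = 0].

Lemma complex5_orth X : complex5 X -> orth_compl T [:: P 0 *m P 1 *m x; P 2 *m P 3 *m x;
  P 2 *m P 4 *m x; P 3 *m P 4 *m x] X.
Proof.
move=> [TX [X1 X2 X3 X4]]; split => // e; rewrite !inE => /or4P[] /eqP ->.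
all: rewrite -!mulmxA ?e24E ?e34E ?dotZl ?move_left ?sort4 ?dotNr.
- by rewrite X1 oppr0.
- by rewrite X2 oppr0.
- by rewrite X3 oppr0 mulr0.
- by rewrite X4 oppr0 mulr0.
Qed.

Lemma tangent5_e : [/\ T v1, T v2, T v3 & T v4].
Proof.
by split; apply/tangent5P; (split; [split|split]); rewrite ?sort4 ?table.
Qed.

Lemma complex5_I X : complex5 X -> complex5 (a *m (b *m X)).
Proof.
move=> [/tangent5P[[Xx Xa Xb Xc] [Xd Xe]] [X1 X2 X3 X4]]; split; first apply/tangent5P.
  by split; [split|split]; rewrite ?sort4 ?dotNr ?(X1, X2, X3, X4, Xa, Xb) ?oppr0.
by split; rewrite ?sort4 ?dotNr ?(Xx, Xc, Xd, Xe) ?oppr0.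
Qed.

Lemma tangent5_lin k u v : T u -> T v -> T (k *: u + v).
Proof.
move=> /tangent5P[[u1 u2 u3 u4] [u5 u6]] /tangent5P[[w1 w2 w3 w4] [w5 w6]]; apply/tangent5P.
by split; [split|split]; rewrite ?(mulmxDr, mulmxZ) dotDr dotZr
  ?(u1,u2,u3,u4,u5,u6,w1,w2,w3,w4,w5,w6) mulr0 addr0.
Qed.

Lemma decompose5 u : T u -> exists k1 k2 k3 k4 X, complex5 X /\
  u = k1 *: v1 + (k2 *: v2 + (k3 *: v3 + (k4 *: v4 + X))).
Proof.
move=> Tu; have [Tv1 Tv2 Tv3 Tv4] := tangent5_e.
pose k1 := dot v1 u; pose k2 := dot v2 u; pose k3 := dot v3 u; pose k4 := dot v4 u.
exists k1, k2, k3, k4, (- k1 *: v1 + (- k2 *: v2 + (- k3 *: v3 + (- k4 *: v4 + u)))); split;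
  last first.
  move: (v1) (v2) (v3) (v4) => w1 w2 w3 w4.
  by apply/matrixP => i j; rewrite !mxE; ring.
split; first by do 4!(apply: tangent5_lin => //).
split; rewrite !(mulmxDr, mulmxZ) ?sort4 !(dotDr, dotZr) ?table.
all: rewrite /k1 /k2 /k3 /k4 ?dotZl ?move_left ?sort4 ?table.
all: first [ring|case: eps1 => ->; ring].
Qed.

Lemma J5E k1 k2 k3 k4 X : complex5 X ->
  J x (k1 *: v1 + (k2 *: v2 + (k3 *: v3 + (k4 *: v4 + X)))) =
  - k2 *: v1 + (k1 *: v2 + (- k4 *: v3 + (k3 *: v4 + a *m (b *m X)))).
Proof.
move=> cX; have [lJ [J1 J2] [J3 J4] JX] := HJ Mx.
have [Tv1 Tv2 Tv3 Tv4] := tangent5_e; have [TX _] := cX.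
rewrite lJ; [|by []|by do 3!(apply: tangent5_lin => //)].
rewrite lJ; [|by []|by do 2!(apply: tangent5_lin => //)].
rewrite lJ; [|by []|by do 1!(apply: tangent5_lin => //)].
rewrite lJ // (JX X (complex5_orth cX)).
move: J1 J2 J3 J4; rewrite -!mulmxA e24E e34E => -> -> -> ->.
move: (v1) (v2) (v3) (v4) (a *m (b *m X)) => w1 w2 w3 w4 Z.
by apply/matrixP => i j; rewrite !mxE; ring.
Qed.

(** As in the case of three matrices, the product of the first two matrices takes
   normal values on [v1], [v2], [v3] and [v4], and is [J] on their complement. *)
Lemma J5_tangent u : T u ->
  [/\ T (J x u), J x (J x u) = - u & 0 <= dot ((a *m b) *m u) (J x u)].
Proof.
move=> Tu; have [Tv1 Tv2 Tv3 Tv4] := tangent5_e.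
have [k1 [k2 [k3 [k4 [X [cX ->]]]]]] := decompose5 Tu.
have cIX := complex5_I cX; have [TIX _] := cIX.
rewrite J5E // J5E //.
have TJ : T (- k2 *: v1 + (k1 *: v2 + (- k4 *: v3 + (k3 *: v4 + a *m (b *m X))))).
  by do 4!(apply: tangent5_lin => //).
split => //.
  rewrite ?sort4; move: (v1) (v2) (v3) (v4) => w1 w2 w3 w4.
  by apply/matrixP => i j; rewrite !mxE; ring.
set Ju := _ + _ in TJ *; set Y := a *m (b *m X).
have -> : a *m b *m (k1 *: v1 + (k2 *: v2 + (k3 *: v3 + (k4 *: v4 + X)))) =
    - k1 *: x + ((k2 * eps) *: (c *m x) + (k3 *: (a *m (b *m (c *m (d *m x)))) +
    (- (k4 * eps) *: (d *m x) + Y))).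
  rewrite -!mulmxA !(mulmxDr, mulmxZ) ?sort4 !scaleNr !scalerN !scalerA.
  by rewrite ?scaleNr ?opprK.
have [[J0 _ _ Jc] [Jd Je]] := (tangent5P Ju).1 TJ.
have [/(tangent5P X).1 [[X0 _ _ Xc] [Xd Xe]] _] := cX.
have Je' : dot (a *m (b *m (c *m (d *m x)))) Ju = 0.
  by rewrite !move_left ?sort4 ?dotNr Je ?oppr0.
rewrite !(dotDl, dotZl) Je' dotc dotd J0 Jc Jd !(mulr0, add0r).
have vY : [/\ dot v1 Y = 0, dot v2 Y = 0, dot v3 Y = 0 & dot v4 Y = 0].
  by split; rewrite /Y ?dotZl !move_left ?sort4 ?dotNr ?(X0, Xc, Xd, Xe) ?oppr0 ?mulr0.
rewrite dotC /Ju -/Y; move: (v1) (v2) (v3) (v4) (Y) vY => w1 w2 w3 w4 {}Y [Y1 Y2 Y3 Y4].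
by rewrite !(dotDl, dotZl) Y1 Y2 Y3 Y4 !(mulr0, add0r) dot_ge0.
Qed.

(** The complement is not zero: there are six normal vectors and four vectors
   [v1], [v2], [v3], [v4]. *)
Lemma J5_positive : (10 < N)%N ->
  exists2 u, T u & 0 < dot ((a *m b) *m u) (J x u).
Proof.
move=> N10.
have [X X0 HX] := exists_orth (fun i : 'I_10 => nth 0 [:: x; a *m x; b *m x; c *m x;
  d *m x; a *m (b *m (c *m (d *m x))); v1; v3; v2; v4] i) N10.
have HX' i (i10 : (i < 10)%N) := HX (Ordinal i10).
have cX : complex5 X.
  have E (y : V) : dot (eps *: y) X = 0 -> dot y X = 0.
    by rewrite dotZl => /(congr1 (fun t => eps * t)); rewrite mulrA eps_sq mul1r mulr0.
  have N0 (s : R) : - s = 0 -> s = 0 by lra.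
  have := HX' 0%N isT; have := HX' 1%N isT; have := HX' 2%N isT; have := HX' 3%N isT.
  have := HX' 4%N isT; have := HX' 5%N isT; have := HX' 6%N isT; have := E _ (HX' 9%N isT).
  have := HX' 8%N isT; rewrite /= scaleNr dotNl => /N0/E; have := HX' 7%N isT.
  rewrite /= !move_left ?sort4 ?dotNr.
  move=> /N0 X2 /N0 X4 /N0 X3 /N0 X1 Xe Xd Xc Xb Xa Xx.
  by split; [apply/tangent5P|].
have [TX _] := cX; exists X => //.
have [_ _ _ JX] := HJ Mx; rewrite (JX X (complex5_orth cX)).
by rewrite -!mulmxA !move_left ?sort4 dot_gt0.
Qed.

End AtPoint.

Theorem no_closed_kahler_power5 p (g : V -> V -> V -> R) :
  (1 < p)%N -> N = (6 + (2 + p.*2))%N -> hermitian_metric M J g ->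
  ~ is_ext_deriv M (fun x => wedge_pow (kahler_form J g x) (p := p)) (fun _ _ => 0).
Proof.
move=> p1 NE; apply: (no_closed_kahler_power_dim NE cP _ _ (clifford_mul_skew cP (_ : 0 != 1)))
  => //.
- by rewrite NE; lia.
- by move=> x Mx; have [] := HJ Mx.
- by move=> x u Mx Tu; exact: J5_tangent.
by move=> x Mx; apply: J5_positive => //; lia.
Qed.

End FiveMatrices.

Theorem proposition8 (R : realType) :
  (forall (l : nat) (P : 'I_3 -> 'M[R]_(2 * l))
      (J : 'cV[R]_(2 * l) -> 'cV[R]_(2 * l) -> 'cV[R]_(2 * l)),
    (0 < l - 2 - 1)%N ->
    clifford_system P ->
    focal_J2 P J ->
    ~ exists g, balanced_metric (focal_plus_cdim l 2) (focal_plus P) J g)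
  /\
  (forall (l : nat) (P : 'I_5 -> 'M[R]_(2 * l))
      (J : 'cV[R]_(2 * l) -> 'cV[R]_(2 * l) -> 'cV[R]_(2 * l)),
    (0 < l - 4 - 1)%N ->
    clifford_system P ->
    definite_case P ->
    focal_J4 P J ->
    ~ exists g, balanced_metric (focal_plus_cdim l 4) (focal_plus P) J g).
Proof.
split=> l P J l_gt cP.
  move=> HJ [g [hg closed]]; apply: (no_closed_kahler_power3 cP HJ _ hg closed).
  by rewrite /focal_plus_cdim; lia.
move=> /= definite HJ [g [hg closed]].
have [eps eps1 E] : exists2 eps : R, eps = 1 \/ eps = -1 &
    P 0 *m P 1 *m P 2 *m P 3 *m P 4 = eps%:M.
  by case: definite => ->; [exists 1; [left|]|exists (-1); [right|rewrite raddfN]].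
apply: (no_closed_kahler_power5 cP eps1 E HJ _ _ hg closed).
all: by rewrite /focal_plus_cdim; lia.
Qed.
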